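(* Let $V_1^{\mathbb R},V_2^{\mathbb R}$ be real vector spaces of dimensions $n_1+1,n_2+1$, let $V^{\mathbb R}=V_1^{\mathbb R}\otimes V_2^{\mathbb R}$, $V=V_1\otimes V_2$ its complexification, $\mathbf n=(n_1,n_2)$, and let $C\Sigma_{\mathbf n}\subseteq V$ be the cone over the Segre variety $\Sigma_{\mathbf n}\subset\mathbb P(V)$ of rank-one matrices, with real locus $C\Sigma_{\mathbf n}^{\mathbb R}$. Let $Q$ be any inner product on $V^{\mathbb R}$ with associated quadratic form $q(x)=Q(x,x)$. Then the distance function $$C\Sigma_{\mathbf n}^{\mathbb R}\to\mathbb R,\qquad x\otimes y\mapsto q(u-x\otimes y)$$ from a generic matrix $u\in V^{\mathbb R}$ to the real cone $C\Sigma_{\mathbf n}^{\mathbb R}$ has at least $\min(n_1,n_2)+1$ real critical points. In particular, if $Q_F$ is a Frobenius inner product on $V^{\mathbb R}$, then $$\mathrm{EDdegree}_Q(\Sigma_{\mathbf n})\ge\mathrm{EDdegree}_{Q_F}(\Sigma_{\mathbf n})=\min(n_1,n_2)+1.$$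
   Context: $\Sigma_{\mathbf n}$ is the image of $\mathbb P(V_1)\times\mathbb P(V_2)\to\mathbb P(V_1\otimes V_2)$, $(x,y)\mapsto x\otimes y$, where $V_i=V_i^{\mathbb R}\otimes\mathbb C$. Inner product means positive definite symmetric bilinear form; it is extended complex bilinearly to $V$. A Frobenius inner product is one of the form $Q_F(x_1\otimes x_2,y_1\otimes y_2)=Q_1(x_1,y_1)Q_2(x_2,y_2)$ (extended by linearity) for some inner products $Q_i$ on $V_i^{\mathbb R}$. For $x$ in the smooth locus $(C\Sigma_{\mathbf n})_{\mathrm{sm}}$, let $N_xC\Sigma_{\mathbf n}=\{v^*\in V: Q(v^*,v)=0\ \forall v\in T_xC\Sigma_{\mathbf n}\}$. Such a point $x$ is critical for the distance function from $u$ if $u-x\in N_xC\Sigma_{\mathbf n}$. The ED correspondence $\mathcal E=\mathcal E(\Sigma_{\mathbf n},Q)$ is the Zariski closure in $V\times V$ of $\{(x,u): x\in(C\Sigma_{\mathbf n})_{\mathrm{sm}},\ u-x\in N_xC\Sigma_{\mathbf n}\}$. The second projection $\mathrm{pr}_2\colon\mathcal E\to V$ has fibers of generically constant finite cardinality, and this cardinality is $\mathrm{EDdegree}_Q(\Sigma_{\mathbf n})$. The ED discriminant $\Sigma(\Sigma_{\mathbf n},Q)$ is the Zariski closure in $V$ of the set of critical values of $\mathrm{pr}_2$, i.e. of the set of $u\in V$ such that $\dim\big(d_{(x,u)}\mathrm{pr}_2(T_{(x,u)}\mathcal E)\big)<\dim V$ for some smooth point $(x,u)$ of $\mathcal E$.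 A data point $u$ is called generic if it lies in the complement of the ED discriminant.
   Formalization: Real critical points include the vertex of the cone when it is singular and lies in the fiber of the ED correspondence over u; counting only smooth points the claim fails, e.g. for u = diag(1,0) with the standard Frobenius product, which is generic but has only one smooth critical point. *)

(* Defs.v *)
(* V_1 and V_2 are the column vectors and the row vectors, so that
   V_1 (x) V_2 is the space of matrices and x (x) y is the product x *m y.
   Affine varieties live in spaces of row vectors 'rV[F]_k; a matrix is sent
   there by mxvec, and a pair of matrices by row_mx of the two mxvec's. *)
From HB Require Import structures.
From mathcomp Require Import all_boot all_order all_algebra.
From mathcomp Require Import sesquilinear.
From mathcomp Require Import boolp classical_sets cardinality reals complex.
From mathcomp Require Import mpoly.

Set Implicit Arguments.
Unset Strict Implicit.
Unset Printing Implicit Defensive.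

Import Order.TTheory GRing.Theory Num.Theory.
Local Open Scope classical_set_scope.
Local Open Scope ring_scope.

Section AffineGeometry.
Context {F : fieldType} {k : nat}.
Implicit Types (X S : set 'rV[F]_k) (a v : 'rV[F]_k).

Definition vanishing X : set {mpoly F[k]} :=
  [set p | forall a, X a -> p.@[a 0] = 0].

Definition zclosure X : set 'rV[F]_k :=
  [set a | forall p, vanishing X p -> p.@[a 0] = 0].

Definition zclosed X : Prop := zclosure X = X.

(* Zariski tangent space, as a linear subspace of the ambient space. *)
Definition tangent X a : set 'rV[F]_k :=
  [set v | forall p, vanishing X p ->
     \sum_(i < k) (p^`M(i)).@[a 0] * v 0 i = 0].

(* Maximal number of linearly independent vectors in S, i.e. the dimension of S
   when S is a linear subspace. *)
Definition lindim S : nat :=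
  \max_(d < k.+1 |
        `[< exists B : 'M[F]_(d, k), row_free B /\ forall i, S (row i B) >]) d.

(* The Jacobian criterion in the form given by Whitney and Milnor: the point a
   of X is smooth when the rank at a of the differentials of the equations of X
   is the maximal one.  For irreducible X (the only case used below: the cone
   over the Segre variety and the ED correspondence, which is the closure of a
   vector bundle over an irreducible base) the minimum of dim T_bX over X is
   dim X, so this is dim T_aX = dim X. *)
Definition smooth_point X a : Prop :=
  X a /\ forall b, X b -> (lindim (tangent X a) <= lindim (tangent X b))%N.

End AffineGeometry.

(* The cone over the Segre variety, vertex included. *)
Definition segre_cone (F : fieldType) (m n : nat) : set 'M[F]_(m, n) :=
  [set x *m y | x in [set: 'cV[F]_m] & y in [set: 'rV[F]_n]].
Arguments segre_cone : clear implicits.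

(* For theta = idfun the dot forms are bilinear and symmetric. *)
Notation inner_product U := {dot U for idfun}.

Definition frobenius (R : realType) (m n : nat)
    (Q : inner_product 'M[R]_(m, n)) : Prop :=
  exists (Q1 : inner_product 'cV[R]_m) (Q2 : inner_product 'rV[R]_n),
    forall (x1 y1 : 'cV[R]_m) (x2 y2 : 'rV[R]_n),
      Q (x1 *m x2) (y1 *m y2) = Q1 x1 y1 * Q2 x2 y2.

Section EDCorrespondence.
Context {R : realType} {m n : nat} (Q : inner_product 'M[R]_(m, n)).
Local Notation C := (R[i]%C).
Local Notation V := 'M[C]_(m, n).
Implicit Types (x u v w : V) (d : nat).

(* Complex bilinear (not sesquilinear) extension of Q. *)
Definition cform v w : C :=
  let re := map_mx (@complex.Re R) in let im := map_mx (@complex.Im R) in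
  Complex (Q (re v) (re w) - Q (im v) (im w))
          (Q (re v) (im w) + Q (im v) (re w)).

Definition cone : set 'rV[C]_(m * n) := mxvec @` segre_cone C m n.

Definition cone_smooth x : Prop := smooth_point cone (mxvec x).

Definition normal_space x : set V :=
  [set v | forall w, tangent cone (mxvec x) (mxvec w) -> cform v w = 0].

Definition critical u : set V :=
  [set x | cone_smooth x /\ normal_space x (u - x)].

Definition pair_mx x u : 'rV[C]_(m * n + m * n) := row_mx (mxvec x) (mxvec u).

Definition ED_correspondence : set 'rV[C]_(m * n + m * n) :=
  zclosure [set z | exists x u, critical u x /\ z = pair_mx x u].

Definition ED_fiber u : set V := [set x | ED_correspondence (pair_mx x u)].

Definition is_EDdegree d : Prop :=
  exists Z : set 'rV[C]_(m * n),
    [/\ zclosed Z, Z != [set: 'rV[C]_(m * n)]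
      & forall u, ~ Z (mxvec u) -> (ED_fiber u #= `I_d)%card].

(* The generic cardinality of the fibers; the default value 0 is immaterial,
   since no fiber over a generic point is empty. *)
Definition EDdegree : nat := xget 0%N is_EDdegree.

(* rsubmx is the differential of the second projection. *)
Definition critical_values : set V :=
  [set u | exists x, smooth_point ED_correspondence (pair_mx x u) /\
     (lindim (rsubmx @` tangent ED_correspondence (pair_mx x u)) < m * n)%N].

Definition ED_discriminant : set 'rV[C]_(m * n) :=
  zclosure (mxvec @` critical_values).

Definition complexify (x : 'M[R]_(m, n)) : V := map_mx (real_complex R) x.

Definition generic_data (u : 'M[R]_(m, n)) : Prop :=
  ~ ED_discriminant (mxvec (complexify u)).

(* Critical points on the real cone of the distance function from u.  Besides
   the critical points in the smooth locus, a singular point of the cone (the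
   vertex, when m, n > 1) is counted, once, when it lies in the fiber of the ED
   correspondence over u, i.e. when it is a limiting critical point.  This
   cannot be dropped: for the Frobenius form on 2 x 2 matrices, diag(1, 0) lies
   outside the ED discriminant ((a-d)^2+(b+c)^2) ((a+d)^2+(b-c)^2) = 0, and the
   fiber of the ED correspondence over it consists of diag(1, 0) and of 0. *)
Definition real_critical (u : 'M[R]_(m, n)) : set 'M[R]_(m, n) :=
  [set x | segre_cone R m n x /\
     (critical (complexify u) (complexify x) \/
      ~ cone_smooth (complexify x) /\
        ED_fiber (complexify u) (complexify x))].

End EDCorrespondence.

(* Main.v *)
(* Let w be the image of u under the Gram map of Q.  A nonzero rank-one matrix
   X = x y is critical exactly when w(u - X) is annihilated by x on the left and
   by y on the right.

   Real critical points. For fixed x <> 0 let y be the best approximation; the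
   norm of x y is an even function of x on the sphere of V_1, and it increases
   along an explicit odd gradient step whose fixed points are critical. The
   Lusternik-Schnirelmann argument, reduced to Tucker's lemma on the octahedron
   (proved with mod 2 chains), gives at least dim V_1 (the smaller one) pairs
   of fixed points, hence as many critical points, one of which may be the
   vertex when w has not full rank. It remains to see that a generic w has rank
   at least min(n1, n2): if two dimensions are missing, u is a limit of
   critical values, because X = s p q with p and q in the two kernels of w can
   be made a degenerate critical point of data close to u.

   ED degrees. The ED correspondence has tangent spaces that are Lagrangian for
   a symplectic form on V x V, which decides its smooth points. Fibers are
   generically finite, since the critical pairs are parametrized by affine
   charts of the dimension k of V, and k + 1 polynomials in k variables are
   algebraically dependent; their cardinality is generically constant by
   quantifier elimination. Evaluating it at a real point and applying the first
   part bounds it below. For a Frobenius form with Gram matrices A and B, the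
   vector x is an eigenvector of u B u^T A that determines X; where this matrix
   has a cyclic covector, eigenlines are determined by their eigenvalues, and
   there are at most min(n1, n2) + 1 of them. *)
Require Import Defs.
From mathcomp Require Import all_boot all_order all_algebra.
From mathcomp Require Import sesquilinear.
From mathcomp Require Import boolp classical_sets cardinality reals.
From mathcomp Require Import closed_field ring lra zify.
From mathcomp Require complex mpoly topology normedtype.

Set Implicit Arguments.
Unset Strict Implicit.
Unset Printing Implicit Defensive.

(** A general [Q] does not split over the two factors, so no singular value decomposition is
    available and the real count has to be topological: a smooth function on the projective space of
    lines in V_1 has at least as many critical points as V_1 has dimensions. What counts is distinct
    matrices, though, and every line killed by [w] yields the same one, the vertex. Hence the
    smaller factor is the one kept, and the corank of [w] there must be at most one; this is what
    the rank of generic data is needed for.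

    Neither irreducibility nor dimension theory is used for the ED correspondence. A Lagrangian
    subspace of a space of dimension 2k has dimension k, which settles the tangent spaces over X <>
    0; semicontinuity bounds all the others from below.

    Real and complex statements meet at points with natural coordinates: a nonzero polynomial does
    not vanish at all of them, so such a point can be at once a real data matrix and a generic
    complex one. Polynomial curves are likewise sampled at positive integers, and limits are taken
    inside the Zariski closure. *)

(** * Mod 2 chains, barycentric subdivision and Tucker's lemma *)

Module Chains.
Import Order.TTheory GRing.Theory Num.Theory.
Local Open Scope ring_scope.

(* A mod 2 chain is a list of lists; two of them are identified when all the
   functionals [ev f] agree on them. *)
Definition ev (T : Type) (f : seq T -> bool) (c : seq (seq T)) : bool :=
  \big[addb/false]_(s <- c) f s.

Lemma ev_map (T U : Type) f (g : seq T -> seq U) c :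
  ev f (map g c) = ev (f \o g) c.
Proof. exact: big_map. Qed.

Section Mod2Chains.
Context {T : Type}.
Implicit Types (s t : seq T) (c : seq (seq T)) (f : seq T -> bool).

(** Boundary of an ordered simplex. A single vertex has the empty list as its facet, so the complex
    is augmented; this is the [f [::]] from which the induction in [tucker] starts. *)
Fixpoint facets s : seq (seq T) :=
  if s is x :: s' then s' :: map (cons x) (facets s') else [::].

Definition bd c := flatten (map facets c).

Lemma ev_nil f : ev f [::] = false. Proof. exact: big_nil. Qed.

Lemma ev_cons f s c : ev f (s :: c) = f s (+) ev f c.
Proof. exact: big_cons. Qed.

Lemma ev_cat f c c' : ev f (c ++ c') = ev f c (+) ev f c'.
Proof. exact: big_cat. Qed.

Lemma ev_flatten_map f (g : seq T -> seq (seq T)) c :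
  ev f (flatten (map g c)) = ev (fun s => ev f (g s)) c.
Proof. by elim: c => [|s c IH]; rewrite ?ev_nil //= ev_cat IH ev_cons. Qed.

Lemma ev_addb f g c : ev (fun s => f s (+) g s) c = ev f c (+) ev g c.
Proof. exact: big_split. Qed.

Lemma ev_false c : ev (fun=> false) c = false.
Proof. by elim: c => [|s c IH]; rewrite ?ev_nil // ev_cons IH. Qed.

Lemma eq_ev_all (p : pred (seq T)) f g c :
  (forall s, p s -> f s = g s) -> all p c -> ev f c = ev g c.
Proof.
move=> fg; elim: c => [|s c IH] /=; first by rewrite !ev_nil.
by move=> /andP[ps pc]; rewrite !ev_cons fg // IH.
Qed.

Lemma eq_ev f g c : f =1 g -> ev f c = ev g c.
Proof. by move=> fg; apply: eq_bigr => s _; apply: fg. Qed.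

Lemma ev_bd f c : ev f (bd c) = ev (fun s => ev f (facets s)) c.
Proof. exact: ev_flatten_map. Qed.

Lemma ev_bd_cons f x c :
  ev f (bd (map (cons x) c)) = ev f c (+) ev (f \o cons x) (bd c).
Proof.
rewrite !ev_bd ev_map -ev_addb; apply: eq_ev => s /=.
by rewrite ev_cons ev_map.
Qed.

(** By [ev_bd_cons] the facets of the base of a cone appear twice and cancel: the boundary of a
    boundary is zero. *)
Lemma ev_bd_facets f s : ev f (bd (facets s)) = false.
Proof.
elim: s f => [|x s IH] f; first by rewrite ev_nil.
by rewrite /bd /= ev_cat -/(bd _) ev_bd_cons addbA addbb /= IH.
Qed.

Section Subdivision.
Variable bary : seq T -> T.

(** Barycentric subdivision as a cone from the barycentre over the subdivided boundary. The
    recursion runs on the number [n] of vertices, to be instantiated with [size s]. *)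
Fixpoint sdn n s : seq (seq T) :=
  if n is n'.+1 then map (cons (bary s)) (flatten (map (sdn n') (facets s)))
  else [:: s].

Definition sd s := sdn (size s) s.
Definition sdc c := flatten (map sd c).

Lemma size_facets s : all (fun t => size t == (size s).-1) (facets s).
Proof.
elim: s => [|x s IH] //=; rewrite eqxx /= all_map.
by case: s IH => [|y s] IH //=; apply: sub_all IH => t /= /eqP ->.
Qed.

(** The cone formula leaves the base; the rest is a cone over the boundary of a subdivided boundary,
    which is zero by induction and [ev_bd_facets]. Hence subdivision is a chain map ([bd_sdc]). *)
Lemma bd_sdn f n s : size s = n ->
  ev f (bd (sdn n s)) = ev f (flatten (map (sdn n.-1) (facets s))).
Proof.
elim: n s f => [|n IH] s f; first by case: s => // _; rewrite !ev_nil.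
move=> sz; rewrite /= ev_bd_cons; set g := _ \o _.
suff -> : ev g (bd (flatten (map (sdn n) (facets s)))) = false by rewrite addbF.
rewrite ev_bd ev_flatten_map.
transitivity (ev (fun t => ev g (flatten (map (sdn n.-1) (facets t)))) (facets s)).
  apply: (eq_ev_all _ (size_facets s)) => t; rewrite sz => /eqP szt.
  by rewrite -ev_bd IH.
transitivity (ev (fun t => ev g (sdn n.-1 t)) (bd (facets s))).
  by rewrite ev_bd; apply: eq_ev => t; rewrite ev_flatten_map.
exact: ev_bd_facets.
Qed.

Lemma bd_sdc f c : ev f (bd (sdc c)) = ev f (sdc (bd c)).
Proof.
rewrite ev_bd !ev_flatten_map; apply: eq_ev => s.
rewrite -ev_bd bd_sdn // ev_flatten_map.
by apply: (eq_ev_all _ (size_facets s)) => t /eqP <-.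
Qed.

Lemma eq_sdc c c' : (forall f, ev f c = ev f c') ->
  forall f, ev f (sdc c) = ev f (sdc c').
Proof. by move=> cc' f; rewrite !ev_flatten_map. Qed.

End Subdivision.
End Mod2Chains.

Section Alternation.

Fixpoint alternates (b : bool) (s : seq bool) : bool :=
  if s is x :: s' then (x == b) && alternates (~~ b) s' else true.

(** A word that does not alternate can be made alternating by one deletion in zero or two ways
    (either of two equal neighbours). An alternating word only survives the loss of an end, and
    losing its first entry changes the starting sign. *)
Lemma alternates_facets b s :
  ev (alternates b) (facets s) = alternates b s (+) alternates (~~ b) s.
Proof.
elim: s b => [|x s IH] b; first by rewrite ev_nil.
rewrite /= ev_cons ev_map; case: (eqVneq x b) => [->|xb] /=.
  rewrite (eq_ev _ (g := alternates (~~ b))) => [|t /=]; last by rewrite eqxx.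
  by rewrite IH negbK; case: b; case: (alternates _ s); case: (alternates _ s).
rewrite (eq_ev _ (g := fun=> false)) ?ev_false => [|t /=].
  by rewrite addbF negbK; case: x b xb => [] [].
by rewrite (negPf xb).
Qed.

Lemma alternates_negb b s : alternates b (map negb s) = alternates (~~ b) s.
Proof. by elim: s b => //= x s IH b; rewrite IH; case: x b => [] []. Qed.

Lemma facets_map (T U : Type) (g : T -> U) s :
  facets (map g s) = map (map g) (facets s).
Proof. by elim: s => //= x s ->; rewrite -!map_comp. Qed.

Lemma facets_subseq (T : eqType) (s : seq T) :
  all (fun t => subseq t s) (facets s).
Proof.
elim: s => // x s IH; rewrite [facets _]/= /= -/(subseq s (x :: s)) subseq_cons all_map.
by apply: sub_all IH => t /=; rewrite eqxx.
Qed.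

Lemma ev_facets_rem (T : eqType) (f : seq T -> bool) s :
  (forall t t', perm_eq t t' -> f t = f t') ->
  ev f (facets s) = \big[addb/false]_(x <- s) f (rem x s).
Proof.
elim: s f => [|x s IH] f fP; first by rewrite ev_nil big_nil.
rewrite /= ev_cons big_cons /= eqxx ev_map IH => [|t t' tt']; last first.
  by apply: fP; rewrite perm_cons.
congr (_ (+) _); apply: eq_big_seq => y ys /=.
case: eqVneq => [->|//]; apply: fP; rewrite perm_sym.
exact: perm_to_rem.
Qed.

Lemma ev_facets_perm (T : eqType) (f : seq T -> bool) s s' :
  (forall t t', perm_eq t t' -> f t = f t') -> perm_eq s s' ->
  ev f (facets s) = ev f (facets s').
Proof.
move=> fP ss'; rewrite !ev_facets_rem // (perm_big _ ss').
apply: eq_big_seq => x xs'; apply: fP; rewrite -(perm_cons x).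
have xs : x \in s by rewrite (perm_mem ss').
by rewrite -(permPl (perm_to_rem xs)) (permPl ss') perm_to_rem.
Qed.

Local Notation label := (nat * bool)%type.
Implicit Types (l : seq label).

(** The label [(i, b)] plays the part of a signed label of absolute value [i.+1]; the sign only
    breaks ties. *)
Definition label_le (x y : label) : bool :=
  (x.1 < y.1)%N || (x.1 == y.1) && (x.2 ==> y.2).

Lemma label_le_trans : transitive label_le.
Proof.
move=> [b bs] [a sa] [c cs]; rewrite /label_le /=.
case/orP=> [ab|/andP[/eqP <- ab]]; case/orP=> [bc|/andP[/eqP <- bc]].
- by rewrite (ltn_trans ab bc).
- by rewrite ab.
- by rewrite bc.
- by rewrite eqxx; move: ab bc; case: sa bs cs => [] [] []; rewrite ?orbT.
Qed.

Lemma label_le_anti : antisymmetric label_le.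
Proof.
move=> [a sa] [b bs]; rewrite /label_le /=; case: ltngtP => //= [<-].
by case: sa bs => [] [].
Qed.

Lemma label_le_total : total label_le.
Proof.
by move=> [a sa] [b bs]; rewrite /label_le /=; case: ltngtP; case: sa bs => [] [].
Qed.

Definition alt b l := alternates b (map snd (sort label_le l)).

Lemma alt_perm b l l' : perm_eq l l' -> alt b l = alt b l'.
Proof.
move/(perm_sortP label_le_total label_le_trans label_le_anti).
by rewrite /alt => ->.
Qed.

Lemma alt_facets b l : ev (alt b) (facets l) = alt b l (+) alt (~~ b) l.
Proof.
rewrite (ev_facets_perm (@alt_perm b) (s' := sort label_le l)); last first.
  by rewrite perm_sym perm_sort.
rewrite -alternates_facets facets_map ev_map.
apply: (eq_ev_all _ (facets_subseq _)) => t tl; rewrite /alt /=.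
rewrite (sorted_sort label_le_trans) //.
by apply: subseq_sorted tl _; [exact: label_le_trans | exact: sort_sorted label_le_total _].
Qed.

Definition flip (x : label) : label := (x.1, ~~ x.2).

Definition noncompl l := all (fun x => flip x \notin l) l.

(** Sorting looks at signs only when indices are tied, and without complementary pairs tied labels
    are equal; so flipping all signs keeps the order. *)
Lemma alt_flip b l : noncompl l -> alt b (map flip l) = alt (~~ b) l.
Proof.
move=> nl; rewrite /alt -alternates_negb -map_comp.
suff -> : sort label_le (map flip l) = map flip (sort label_le l).
  by rewrite -map_comp.
apply: (sorted_eq label_le_trans label_le_anti).
- exact: sort_sorted label_le_total _.
- have := sort_sorted label_le_total l.
  have : all (mem l) (sort label_le l) by apply/allP => x; rewrite mem_sort.
  case: (sort _ _) => //= x s; elim: s x => //= y s IH x /and3P[xl yl sl].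
  case/andP=> xy ys; rewrite IH ?yl // andbT.
  move: xy; rewrite /label_le /= => /orP[->//|/andP[/eqP e1]].
  rewrite e1 ltnn eqxx /=.
  have := allP nl x xl; rewrite /flip e1.
  by case: x y {IH xl e1 ys sl s} yl => [? []] [? []] //= ->.
- apply: (perm_trans (y := map flip l)); first by rewrite perm_sort.
  by rewrite perm_map // perm_sym perm_sort.
Qed.

(** In the sorted list a repeated index would come with opposite signs, which is a complementary
    pair; so the indices increase strictly below [k]. *)
Lemma alt_size b l k :
  noncompl l -> alt b l -> all (fun x => x.1 < k)%N l -> (size l <= k)%N.
Proof.
move=> nl al lk.
suff : uniq (map fst (sort label_le l)).
  move/uniq_leq_size => /(_ (iota 0 k)); rewrite size_map size_sort size_iota.
  apply => x /mapP[y]; rewrite mem_sort => /(allP lk) yk ->.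
  by rewrite mem_iota.
apply: (sorted_uniq ltn_trans ltnn).
have := sort_sorted label_le_total l; move: al; rewrite /alt.
have : all (mem l) (sort label_le l) by apply/allP => x; rewrite mem_sort.
case: (sort _ _) => //= x s; elim: s x b => //= y s IH x b /and3P[xl yl sl].
move=> /and3P[/eqP xb /eqP yb alt_s] /andP[xy ys].
rewrite (IH y (~~ b)) ?yl ?yb ?eqxx // andbT.
move: xy; rewrite /label_le => /orP[//|/andP[/eqP e1 _]].
case/negP: (allP nl x xl); rewrite /flip e1 xb -yb.
by case: y yl {IH ys yb e1}.
Qed.

(* Fan's parity argument: the number of alternating simplices in [h i], of both
   signs, has the same parity for all [i]. *)
Lemma tucker (T : Type) (opp : T -> T) (lab : T -> label)
    (h : nat -> seq (seq T)) (n k : nat) :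
  (forall f, ev f (bd (h 0)) = f [::]) ->
  (forall i f, ev f (bd (h i.+1)) = ev f (h i) (+) ev f (map (map opp) (h i))) ->
  (forall i, (i <= n)%N -> all (fun s => [&& size s == i.+1, noncompl (map lab s),
     all (fun x => x.1 < k)%N (map lab s) &
     map lab (map opp s) == map flip (map lab s)]) (h i)) ->
  (n < k)%N.
Proof.
move=> h0 hS hP.
pose f b := alt b \o map lab.
have fS i b : ev (f b) (bd (h i)) = ev (f b) (h i) (+) ev (f (~~ b)) (h i).
  rewrite ev_bd -ev_addb; apply: eq_ev => s.
  by rewrite /f /= -alt_facets facets_map ev_map.
(* The boundary of [h i.+1] is [h i] plus its antipode, and the antipodal map exchanges the two
   starting signs. The parity is 1 because the empty simplex alternates. *)
have {h0}odd i : (i <= n)%N -> ev (f true) (h i) (+) ev (f false) (h i).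
  elim: i => [|i IH] ilen; rewrite -fS; first by rewrite h0.
  rewrite hS; move/ltnW/IH: (ilen).
  congr (is_true (_ (+) _)); rewrite ev_map.
  apply: eq_ev_all (hP i (ltnW ilen)) => s /and4P[_ ns _ /eqP es].
  by rewrite /f /= es alt_flip.
have [b] : exists b, ev (f b) (h n).
  by move: (odd n (leqnn n)); case E: ev; [exists true | exists false].
elim: (h n) (hP n (leqnn n)) => [|s c IH]; first by rewrite ev_nil.
case/andP=> /and4P[/eqP szs ns sk _] /IH {}IH; rewrite ev_cons.
case: (boolP (f b s)) => // fs _.
by have := alt_size ns fs sk; rewrite size_map szs.
Qed.

End Alternation.
End Chains.

(** * Fine antipodally symmetric triangulations of the octahedral sphere *)

Module Octahedron.
Import Order.TTheory GRing.Theory Num.Theory Chains.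
Local Open Scope ring_scope.

Section Octahedron.
Context {R : realType} {m : nat}.
Local Notation V := 'rV[R]_m.
Implicit Types (D : R) (s t : seq V) (u v w : V) (a : 'cV[R]_m) (c : seq (seq V)).

Definition dot a v : R := (v *m a) 0 0.

Lemma dotE a v : dot a v = \sum_i v 0 i * a i 0. Proof. exact: mxE. Qed.
Lemma dotZ a r v : dot a (r *: v) = r * dot a v.
Proof. by rewrite /dot -scalemxAl mxE. Qed.
Lemma dotNl a v : dot (- a) v = - dot a v.
Proof. by rewrite /dot mulmxN mxE. Qed.
Lemma dot_sum a s : dot a (\sum_(v <- s) v) = \sum_(v <- s) dot a v.
Proof. by rewrite /dot mulmx_suml summxE. Qed.

Definition bary s : V := (size s)%:R^-1 *: \sum_(v <- s) v.

Lemma bary_opp s : bary (map -%R s) = - bary s.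
Proof. by rewrite /bary size_map big_map sumrN scalerN. Qed.

Lemma sum_le_size (I : eqType) (r : seq I) (F : I -> R) x :
  (forall i, i \in r -> F i <= x) -> \sum_(i <- r) F i <= (size r)%:R * x.
Proof.
elim: r => [|i r IH] Fx; first by rewrite big_nil mul0r.
rewrite big_cons /= -natr1 mulrDl mul1r addrC.
by rewrite lerD ?Fx ?mem_head // IH // => j jr; rewrite Fx // inE jr orbT.
Qed.

(** The convex hull as an intersection of half-spaces, so that no convex coefficients appear. *)
Definition hull s v :=
  forall a x, (forall w, w \in s -> dot a w <= x) -> dot a v <= x.

Lemma hull_mem s v : v \in s -> hull s v.
Proof. by move=> vs a x; apply. Qed.

Lemma hull_sub s t v : {subset s <= t} -> hull s v -> hull t v.
Proof. by move=> st hv a x tx; apply: hv => w /st /tx. Qed.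

Lemma hull_bary s : s != [::] -> hull s (bary s).
Proof.
move=> s0 a x sx; have s_gt0 : 0 < (size s)%:R :> R.
  by rewrite ltr0n lt0n size_eq0.
by rewrite dotZ dot_sum mulrC ler_pdivrMr // mulrC sum_le_size.
Qed.

(** In the average of the differences with [v], the term of [v] itself vanishes: hence a factor
    below 1, which makes subdivision contract. *)
Lemma bary_near s a D : (forall v w, v \in s -> w \in s -> dot a v - dot a w <= D) ->
  forall v, v \in s -> dot a (bary s) - dot a v <= (size s).-1%:R / (size s)%:R * D.
Proof.
move=> sD v vs; have s_gt0 : (0 < size s)%N by case: s vs {sD}.
have s_gt0' : 0 < (size s)%:R :> R by rewrite ltr0n.
rewrite dotZ dot_sum mulrAC ler_pdivlMr // mulrBl mulrAC mulVf ?mul1r ?gt_eqF //.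
have -> : dot a v * (size s)%:R = \sum_(w <- s) dot a v.
  by rewrite big_const_seq count_predT iter_addr_0 mulr_natr.
rewrite -sumrB (big_rem v vs) /= subrr add0r -(size_rem vs).
by apply: sum_le_size => w /mem_rem ws; apply: sD.
Qed.

Lemma sdn_hull n s t : size s = n -> t \in sdn bary n s ->
  size t = n /\ forall v, v \in t -> hull s v.
Proof.
elim: n s t => [|n IH] s t szs /=.
  by rewrite inE => /eqP ->; split=> // v; apply: hull_mem.
case/mapP=> t' /flatten_mapP[f fs t'f] ->.
have szf : size f = n by have /allP/(_ _ fs) := size_facets s; rewrite szs => /eqP.
have [szt' ht'] := IH f t' szf t'f.
split=> [|v]; first by rewrite /= szt'.
rewrite inE => /orP[/eqP ->|/ht' hv]; first by apply: hull_bary; case: s szs {fs}.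
by apply: hull_sub hv; apply/mem_subseq/(allP (facets_subseq s)).
Qed.

(** The classical shrinking factor, for the width in one direction [a]. A new edge either lies in a
    subdivided facet (induction) or starts at the barycentre ([bary_near] for [a] and [- a]). The
    fixed [M] dominates the factors of all lower dimensions. *)
Lemma sdn_diam M n s t a D : size s = n -> (n <= M.+1)%N -> t \in sdn bary n s ->
  (forall v w, v \in s -> w \in s -> `|dot a v - dot a w| <= D) ->
  forall v w, v \in t -> w \in t ->
    `|dot a v - dot a w| <= M%:R / M.+1%:R * D.
Proof.
elim: n s t => [|n IH] s t szs nM /=.
  by rewrite inE => /eqP -> _ v; case: s szs.
case/mapP=> t' /flatten_mapP[f fs t'f] -> sD v w.
have szf : size f = n by have /allP/(_ _ fs) := size_facets s; rewrite szs => /eqP.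
have fsub : {subset f <= s} by apply/mem_subseq/(allP (facets_subseq s)).
have [_ ht'] := sdn_hull szf t'f.
have D0 : 0 <= D.
  case: s szs sD {fs fsub} => // x s _ /(_ x x); rewrite mem_head => /(_ isT isT).
  by rewrite subrr normr0.
have nM' : n%:R / n.+1%:R * D <= M%:R / M.+1%:R * D.
  apply: ler_wpM2r => //; rewrite ler_pdivrMr ?ltr0n // mulrAC ler_pdivlMr ?ltr0n //.
  by rewrite -!natrM ler_nat; lia.
have near b : (b == a) || (b == - a) -> forall v', v' \in t' ->
    dot b (bary s) - dot b v' <= M%:R / M.+1%:R * D.
  move=> ba v' v't'; apply: le_trans nM'.
  have sDb x y : x \in s -> y \in s -> dot b x - dot b y <= D.
    move=> xs ys; case/orP: ba => /eqP ->; apply: le_trans (sD x y xs ys).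
      exact: ler_norm.
    by rewrite !dotNl -opprD -normrN; apply: ler_norm.
  have := bary_near sDb; rewrite szs /= => bn.
  rewrite -dotNl addrC -lerBrDr; apply: (ht' _ v't') => z zf.
  by rewrite dotNl lerBrDr addrC; apply: bn; apply: fsub.
have nearN v' : v' \in t' -> `|dot a (bary s) - dot a v'| <= M%:R / M.+1%:R * D.
  move=> v't'; rewrite ler_norml near ?eqxx // andbT lerNl.
  by have := near (- a); rewrite eqxx orbT => /(_ isT _ v't'); rewrite !dotNl opprB opprK addrC.
rewrite !inE => /orP[/eqP ->|vt'] /orP[/eqP ->|wt'].
- by rewrite subrr normr0 mulr_ge0 // divr_ge0.
- exact: nearN.
- by rewrite distrC; apply: nearN.
- apply: (IH f t') => //; first exact: ltnW.
  by move=> x y xf yf; apply: sD; apply: fsub.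
Qed.

Lemma sdn_opp n s : sdn bary n (map -%R s) = map (map -%R) (sdn bary n s).
Proof.
elim: n s => [|n IH] s //=; rewrite facets_map bary_opp -!map_comp.
have -> : map (sdn bary n \o map -%R) (facets s)
    = map (map (map -%R) \o sdn bary n) (facets s).
  by apply: eq_map => t /=; rewrite IH.
by rewrite map_comp -map_flatten -map_comp.
Qed.

Definition vertex (i : nat) : V := \row_j (i == j :> nat)%:R.

(** The octahedral sphere in the first [n] axes, one simplex for each choice of signs.
    [hemisphere n] is half of the next sphere, with [orthants n] as its equator. *)
Fixpoint orthants n : seq (seq V) :=
  if n is n'.+1 then map (cons (vertex n')) (orthants n')
    ++ map (cons (- vertex n')) (orthants n')
  else [:: [::]].

Definition hemisphere n := map (cons (vertex n)) (orthants n).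

Lemma map_opp_cons v c :
  map (map -%R) (map (cons v) c) = map (cons (- v)) (map (map -%R) c).
Proof. by rewrite -!map_comp. Qed.

Lemma ev_orthants_opp f n : ev f (map (map -%R) (orthants n)) = ev f (orthants n).
Proof.
elim: n f => [|n IH] f //.
rewrite [orthants _]/= map_cat !ev_cat !map_opp_cons opprK addbC.
by rewrite !(ev_map f (cons (vertex n))) !(ev_map f (cons (- vertex n))) !IH addbC.
Qed.

Lemma ev_bd_orthants f n : ev f (bd (orthants n)) = false.
Proof.
elim: n f => [|n IH] f; first by rewrite ev_nil.
by rewrite ev_bd ev_cat -!ev_bd !ev_bd_cons !IH !addbF addbb.
Qed.

Lemma ev_bd_hemisphere f n : ev f (bd (hemisphere n)) = ev f (orthants n).
Proof. by rewrite ev_bd_cons ev_bd_orthants addbF. Qed.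

Lemma ev_orthantsS f n : ev f (orthants n.+1) =
  ev f (hemisphere n) (+) ev f (map (map -%R) (hemisphere n)).
Proof.
rewrite /= ev_cat; congr (_ (+) _); rewrite map_opp_cons.
by rewrite !(ev_map f (cons (- vertex n))) ev_orthants_opp.
Qed.

Definition refine r n := iter r (sdc bary) (hemisphere n).

Lemma bd_iter_sdc r c f : ev f (bd (iter r (sdc bary) c)) = ev f (iter r (sdc bary) (bd c)).
Proof.
elim: r f => [//|r IH] f; rewrite [iter _ _ _]/= bd_sdc.
exact: eq_sdc.
Qed.

Lemma eq_iter_sdc r c c' : (forall f, ev f c = ev f c') ->
  forall f, ev f (iter r (sdc bary) c) = ev f (iter r (sdc bary) c').
Proof. by move=> cc'; elim: r => //= r IH; apply: eq_sdc. Qed.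

Lemma sdc_cat c c' : sdc bary (c ++ c') = sdc bary c ++ sdc bary c'.
Proof. by rewrite /sdc map_cat flatten_cat. Qed.

Lemma sdc_opp c : sdc bary (map (map -%R) c) = map (map -%R) (sdc bary c).
Proof.
rewrite /sdc map_flatten -!map_comp; congr flatten; apply: eq_map => s /=.
by rewrite /sd size_map sdn_opp.
Qed.

Lemma ev_bd_refine0 r f : ev f (bd (refine r 0)) = f [::].
Proof.
rewrite bd_iter_sdc; suff -> : iter r (sdc bary) (bd (hemisphere 0)) = [:: [::]].
  by rewrite ev_cons ev_nil addbF.
by elim: r => //= r ->.
Qed.

Lemma ev_bd_refineS r n f :
  ev f (bd (refine r n.+1)) = ev f (refine r n) (+) ev f (map (map -%R) (refine r n)).
Proof.
pose c := hemisphere n ++ map (map -%R) (hemisphere n).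
rewrite bd_iter_sdc (@eq_iter_sdc r _ c) => [|g]; last first.
  by rewrite ev_bd_hemisphere ev_orthantsS ev_cat.
rewrite -ev_cat; congr ev; rewrite /c /refine.
by elim: r => //= r ->; rewrite sdc_cat sdc_opp.
Qed.

Definition l1 v : R := \sum_i `|v 0 i|.

(** One sign vector for the whole simplex: on it the l1 norm is the linear form [dot a], so
    barycentres stay on the l1 sphere without any radial projection. *)
Definition in_orthant s := exists a, (forall i, `|a i 0| = 1) /\
  forall v, v \in s -> (forall i, 0 <= a i 0 * v 0 i) /\ dot a v = 1.

Lemma dot_delta i v : dot (delta_mx i 0) v = v 0 i.
Proof.
rewrite dotE (bigD1 i) //= mxE !eqxx mulr1 big1 ?addr0 // => j ji.
by rewrite mxE (negPf ji) mulr0.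
Qed.

Lemma in_orthant_l1 s v : in_orthant s -> v \in s -> l1 v = 1.
Proof.
case=> a [a1 sa] /sa[v0 <-]; rewrite dotE; apply: eq_bigr => i _.
by rewrite mulrC -[RHS]ger0_norm // normrM a1 mul1r.
Qed.

Lemma in_orthant_hull s t : (forall v, v \in t -> hull s v) -> in_orthant s -> in_orthant t.
Proof.
move=> ts [a [a1 sa]]; exists a; split=> // v /ts hv; split=> [i|].
  have := hv (- a i 0 *: delta_mx i 0) 0; rewrite /dot -scalemxAr mxE -/(dot _ _) dot_delta.
  rewrite mulNr oppr_le0; apply => w /sa[wi _].
  by rewrite -scalemxAr mxE -/(dot _ _) dot_delta mulNr oppr_le0.
apply/eqP; rewrite eq_le; apply/andP; split; first by apply: hv => w /sa[_ ->].
by rewrite -lerN2 -dotNl; apply: hv => w /sa[_ aw]; rewrite dotNl aw.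
Qed.

Lemma vertexE (i : 'I_m) : vertex i = delta_mx 0 i.
Proof. by apply/rowP => j; rewrite !mxE eqxx eq_sym. Qed.

Lemma orthants_signs n s : (n <= m)%N -> s \in orthants n ->
  size s = n /\ exists a, (forall i, `|a i 0| = 1) /\ forall v, v \in s ->
     exists2 j : 'I_m, (j < n)%N & v = a j 0 *: delta_mx 0 j.
Proof.
elim: n s => [|n IH] s nm.
  by rewrite inE => /eqP ->; split=> //; exists (const_mx 1); split=> // i; rewrite mxE normr1.
pose j := Ordinal nm.
have key x t : `|x| = 1 -> t \in orthants n -> s = x *: delta_mx 0 j :: t ->
    size s = n.+1 /\ exists a, (forall i, `|a i 0| = 1) /\ forall v, v \in s ->
     exists2 j : 'I_m, (j < n.+1)%N & v = a j 0 *: delta_mx 0 j.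
  move=> x1 /(IH _ (ltnW nm))[szt [a [a1 ta]]] ->; split; first by rewrite /= szt.
  exists (\col_i if i == j then x else a i 0); split=> [i|v]; first by rewrite mxE; case: eqP.
  rewrite inE => /orP[/eqP ->|/ta[i ilt ->]]; first by exists j; rewrite ?mxE ?eqxx.
  exists i; first exact: ltnW.
  by rewrite mxE ifN // -val_eqE /= ltn_eqF.
have vj : vertex n = delta_mx 0 j := vertexE j.
rewrite /= mem_cat => /orP[] /mapP[t tn st].
  by apply: (key 1 t); rewrite ?normr1 ?scale1r -?vj.
by apply: (key (-1) t); rewrite ?normrN1 ?scaleN1r -?vj.
Qed.

Lemma hemisphere_orthant n s : (n < m)%N -> s \in hemisphere n ->
  [/\ size s = n.+1, in_orthant s &
      forall v w i, v \in s -> w \in s -> `|v 0 i - w 0 i| <= 2].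
Proof.
move=> nm sn; have sn1 : s \in orthants n.+1 by rewrite /= mem_cat sn.
have [szs [a [a1 sa]]] := orthants_signs nm sn1.
have vi v i : v \in s -> `|v 0 i| <= 1.
  move=> /sa[j _ ->]; rewrite !mxE normrM a1 mul1r.
  by case: (_ && _); rewrite ?normr0 ?normr1.
split=> //; last first.
  move=> v w i vs ws; apply: le_trans (ler_normB _ _) _.
  by rewrite -[2]/(1 + 1) lerD ?vi.
exists a; split=> // v /sa[j _ ->]; have aa : a j 0 * a j 0 = 1.
  by rewrite -expr2 -real_normK ?num_real // a1 expr1n.
split=> [i|].
  rewrite !mxE eqxx /=; case: (eqVneq i j) => [->|_]; rewrite ?mulr0 //.
  by rewrite mulr1 aa.
by rewrite dotZ /dot -rowE mxE.
Qed.

Lemma refine_orthant r n s : (n < m)%N -> s \in refine r n ->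
  [/\ size s = n.+1, in_orthant s &
      forall v w i, v \in s -> w \in s ->
        `|v 0 i - w 0 i| <= (n%:R / n.+1%:R) ^+ r * 2].
Proof.
move=> nm; elim: r s => [|r IH] s.
  by move/(hemisphere_orthant nm); rewrite expr0 mul1r.
case/flatten_mapP=> t /IH[szt ot td]; rewrite /sd szt => st.
have [szs hs] := sdn_hull szt st; split=> //; first exact: in_orthant_hull ot.
move=> v w i vs ws; rewrite -!(dot_delta i) exprS -mulrA.
apply: (sdn_diam szt _ st) => // v' w' v't w't; rewrite !dot_delta.
exact: td.
Qed.

(** Induction on [r] from (n + r + 1) n <= (n + r) (n + 1); it provides an explicit number of
    subdivisions for a given mesh. *)
Lemma ratio_expr_le n r : (n + r)%:R * (n%:R / n.+1%:R) ^+ r <= n%:R :> R.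
Proof.
elim: r => [|r IH]; first by rewrite addn0 mulr1.
rewrite exprSr mulrA; have n1 : 0 < n.+1%:R :> R by rewrite ltr0n.
rewrite mulrA ler_pdivrMr // mulrAC.
have /le_trans : (n + r.+1)%:R * n%:R * (n%:R / n.+1%:R) ^+ r
    <= (n + r)%:R * n.+1%:R * (n%:R / n.+1%:R) ^+ r :> R.
  rewrite ler_wpM2r ?exprn_ge0 ?divr_ge0 // -!natrM ler_nat; nia.
apply; rewrite mulrAC ler_wpM2r //; exact: ltW.
Qed.

Lemma ratio_expr_small n D : 0 < D -> exists r, (n%:R / n.+1%:R) ^+ r * 2 <= D.
Proof.
move=> D0; exists (Num.truncn (2 * n%:R / D)).+1.
set r := (X in _ ^+ X); have r0 : 0 < (n + r)%:R :> R by rewrite ltr0n addn_gt0 orbT.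
have : 2 * n%:R / D <= (n + r)%:R.
  apply: ltW; apply: lt_le_trans (truncnS_gt _) _; by rewrite ler_nat leq_addl.
rewrite ler_pdivrMr // => nD.
rewrite -(ler_pM2l r0) mulrA; apply: le_trans nD; rewrite mulrC.
by rewrite ler_wpM2l // ratio_expr_le.
Qed.

End Octahedron.

(** Otherwise no simplex of a subdivision with mesh at most [D] carries complementary labels, and
    [tucker], applied to the refined hemispheres up to dimension [n], would give [n < k]. *)
Lemma antipodal_labels (R : realType) n k (lab : 'rV[R]_n.+1 -> nat * bool) (D : R) :
  (k <= n)%N -> 0 < D ->
  (forall v, l1 v = 1 -> ((lab v).1 < k)%N /\ lab (- v) = flip (lab v)) ->
  exists v w, [/\ l1 v = 1, l1 w = 1, forall i, `|v 0 i - w 0 i| <= D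
                 & lab w = flip (lab v)].
Proof.
move=> kn D0 labP; apply: contrapT => nex.
have [r rD] := ratio_expr_small n D0.
have q0 i : 0 <= i%:R / i.+1%:R :> R by rewrite divr_ge0.
suff : (n < k)%N by rewrite ltnNge kn.
apply: (tucker (opp := -%R) (lab := lab) (h := refine r)).
- exact: ev_bd_refine0.
- by move=> i f; apply: ev_bd_refineS.
move=> i ilen; apply/allP => s /(refine_orthant (m := n.+1) ilen)[-> os sD].
have s1 v : v \in s -> l1 v = 1 by apply: in_orthant_l1.
rewrite eqxx andTb; apply/and3P; split.
- apply/allP => x /mapP[v vs ->]; apply/negP => /mapP[w ws vw].
  apply: nex; exists v, w; split; rewrite ?s1 // => j.
  (* Hemispheres of lower dimension shrink at least as fast, so the number of subdivisions chosen
     for dimension [n] serves them all. *)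
  apply: le_trans (sD v w j vs ws) _; apply: le_trans rD.
  rewrite ler_wpM2r // lerXn2r ?nnegrE //.
  rewrite ler_pdivrMr ?ltr0n // mulrAC ler_pdivlMr ?ltr0n // -!natrM ler_nat; lia.
- by apply/allP => x /mapP[v /s1 /labP[vk _] ->].
- rewrite -!map_comp; apply/eqP/eq_in_map => v /s1 /labP[_]; exact.
Qed.

End Octahedron.

(** * A discrete Lusternik-Schnirelmann theorem on the sphere *)

Module Lyapunov.
From mathcomp Require Import topology normedtype.
Import Order.TTheory GRing.Theory Num.Theory numFieldNormedType.Exports.
Import Chains Octahedron.
Local Open Scope classical_set_scope.
Local Open Scope ring_scope.

Section Uniformity.
Context {R : realType}.

Lemma finite_uniform (T : eqType) (s : seq T) (P : R -> T -> Prop) :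
  (forall x d e, 0 < d -> d <= e -> P e x -> P d x) ->
  (forall x, x \in s -> exists2 e, 0 < e & P e x) ->
  exists2 e, 0 < e & forall x, x \in s -> P e x.
Proof.
move=> Pdown; elim: s => [|x s IH] sP; first by exists 1.
have [e e0 eP] : exists2 e, 0 < e & forall x, x \in s -> P e x.
  by apply: IH => y ys; apply: sP; rewrite inE ys orbT.
have [d d0 dP] := sP x (mem_head _ _).
have m0 : 0 < Num.min d e by rewrite lt_min d0 e0.
exists (Num.min d e) => // y; rewrite inE => /orP[/eqP ->|ys].
  by apply: Pdown dP => //; rewrite ge_min lexx.
by apply: Pdown (eP y ys) => //; rewrite ge_min lexx orbT.
Qed.

(** The common form of the compactness arguments below: [e] may be a gain, a separating distance, or
    the inverse of an upper bound. *)
Lemma compact_uniform (n : nat) (K : set 'rV[R]_n.+1) (P : R -> 'rV[R]_n.+1 -> Prop) :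
  compact K -> (forall x d e, 0 < d -> d <= e -> P e x -> P d x) ->
  (forall x, K x -> exists2 e, 0 < e &
     forall x', `|x - x'| < e -> K x' -> P e x') ->
  exists2 e, 0 < e & forall x, K x -> P e x.
Proof.
move=> /compact_near_coveringP cK Pdown KP.
have [x /KP[e e0 eP]|e /= e0 He] := cK R 0^'+ (fun e x => K x -> P e x) _.
  exists (ball x e, [set d | 0 < d < e]).
    split; first by apply: nbhsx_ballx.
    by exists e => //= d /=; rewrite sub0r normrN => de d0; rewrite d0 (le_lt_trans (ler_norm d)).
  move=> [x' d] /= [xx' /andP[d0 de]] Kx'; apply: (Pdown _ d e) => //; first exact: ltW.
  by apply: eP => //; move: xx'; rewrite -ball_normE.
exists (e / 2); first by rewrite divr_gt0.
move=> x Kx; apply: (He (e / 2)) => //=; last by rewrite divr_gt0.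
by rewrite sub0r normrN gtr0_norm ?divr_gt0 // ltr_pdivrMr // ltr_pMr // ltr1n.
Qed.

Definition cts_at (n : nat) (W : normedModType R) (f : 'rV[R]_n.+1 -> W) x :=
  forall e, 0 < e -> exists2 d, 0 < d & forall x', `|x - x'| < d -> `|f x - f x'| < e.

Lemma continuous_cts_at (n : nat) (W : normedModType R) (f : 'rV[R]_n.+1 -> W) x :
  {for x, continuous f} -> cts_at f x.
Proof.
move=> /cvgrPdist_lt fx e e0; have /nbhs_ballP[d d0 dP] := fx e e0.
by exists d => // x' xx'; apply: dP; rewrite -ball_normE.
Qed.

Lemma cts_at_comp (n : nat) (W : normedModType R) (f : 'rV[R]_n.+1 -> 'rV[R]_n.+1)
    (g : 'rV[R]_n.+1 -> W) x : cts_at f x -> cts_at g (f x) -> cts_at (g \o f) x.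
Proof.
move=> fx gx e /gx[d /fx[d' d'0 dd'] de]; exists d' => // x' /dd'; exact: de.
Qed.

Lemma continuous_sum (T : topologicalType) (I : Type) (r : seq I) (F : I -> T -> R) x :
  (forall i, {for x, continuous (F i)}) ->
  {for x, continuous (fun y => \sum_(i <- r) F i y)}.
Proof.
move=> Fx; elim: r => [|i r IH].
  rewrite (_ : (fun y => _) = fun=> 0); first exact: cvg_cst.
  by apply/funext => y; rewrite big_nil.
rewrite (_ : (fun y => _) = fun y => F i y + \sum_(j <- r) F j y); last first.
  by apply/funext => y; rewrite big_cons.
by apply: cvgD; [apply: Fx | apply: IH].
Qed.

Lemma continuous_prod (T : topologicalType) (I : Type) (r : seq I) (F : I -> T -> R) x :
  (forall i, {for x, continuous (F i)}) ->
  {for x, continuous (fun y => \prod_(i <- r) F i y)}.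
Proof.
move=> Fx; elim: r => [|i r IH].
  rewrite (_ : (fun y => _) = fun=> 1); first exact: cvg_cst.
  by apply/funext => y; rewrite big_nil.
rewrite (_ : (fun y => _) = fun y => F i y * \prod_(j <- r) F j y); last first.
  by apply/funext => y; rewrite big_cons.
by apply: cvgM; [apply: Fx | apply: IH].
Qed.

End Uniformity.

Section Sphere.
Context {R : realType} {n : nat}.
Local Notation V := 'rV[R]_n.+1.
Implicit Types (x v w c : V) (e d : R).

Definition sphere : set V := [set x | l1 x = 1].

Lemma l1_opp x : l1 (- x) = l1 x.
Proof. by apply: eq_bigr => i _; rewrite mxE normrN. Qed.

Lemma l1_scale a x : l1 (a *: x) = `|a| * l1 x.
Proof. by rewrite /l1 mulr_sumr; apply: eq_bigr => i _; rewrite mxE normrM. Qed.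

Lemma l1_eq0 x : (l1 x == 0) = (x == 0).
Proof.
apply/eqP/eqP => [x0|->]; last by rewrite /l1 big1 // => i _; rewrite mxE normr0.
apply/rowP => i; rewrite mxE; apply/eqP; rewrite -normr_eq0.
by move/eqP: x0; rewrite psumr_eq0 // => /allP/(_ i)/(_ (mem_index_enum _)).
Qed.

Lemma continuous_l1 : continuous (@l1 R n.+1).
Proof.
move=> x; apply: (@continuous_sum R V) => i.
apply: (@continuous_comp V R R (fun y => y 0 i) (fun y => `|y|)).
  exact: (@coord_continuous R 1 n.+1 0 i x).
exact: norm_continuous.
Qed.

Lemma norm_le_entries x d : 0 <= d -> (forall i, `|x 0 i| <= d) -> `|x| <= d.
Proof.
move=> d0 xd; rewrite [leLHS]/Num.Def.normr /= mx_normrE (bigmax_le _ d0) // => -[i j] _ /=.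
by rewrite ord1.
Qed.

Lemma compact_sphere_sub (A : set V) : closed A -> compact (sphere `&` A).
Proof.
move=> cA; apply: bounded_closed_compact.
  exists 1; split=> // y y1 x [sx _] /=; apply: le_trans (ltW y1).
  apply: norm_le_entries => // i; rewrite -[leRHS]sx /l1 (bigD1 i) //= lerDl.
  exact: sumr_ge0.
apply: closedI => //; rewrite /sphere.
have -> : [set x : V | l1 x = 1] = @l1 R n.+1 @^-1` [set 1] by [].
by apply: closed_comp => [x _|]; [exact: continuous_l1 | exact: closed_eq].
Qed.

Section Descent.
Variables (phi : V -> V) (g : V -> R) (cs : seq V).
Let pts := cs ++ map -%R cs.
Hypothesis phiS : forall x, sphere x -> sphere (phi x).
Hypothesis phiN : forall x, phi (- x) = - phi x.
Hypothesis gN : forall x, g (- x) = g x.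
Hypothesis phi_cts : forall x, sphere x -> cts_at phi x.
Hypothesis g_cts : forall x, sphere x -> cts_at g x.
Hypothesis csP : forall c, c \in cs -> sphere c /\ phi c = c.
Hypothesis g_lt : forall x, sphere x -> x \notin pts -> g x < g (phi x).

Let ptsP c : c \in pts -> sphere c /\ phi c = c.
Proof.
rewrite mem_cat => /orP[/csP //|/mapP[c' /csP[sc pc] ->]].
by rewrite /sphere /= l1_opp phiN pc.
Qed.

Let g_le x : sphere x -> g x <= g (phi x).
Proof.
by move=> sx; have [/ptsP[_ ->] //|/(g_lt sx)/ltW] := boolP (x \in pts).
Qed.

Let iterS t x : sphere x -> sphere (iter t phi x).
Proof. by move=> sx; elim: t => //= t; apply: phiS. Qed.

Let iterN t x : iter t phi (- x) = - iter t phi x.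
Proof. by elim: t => //= t ->; rewrite phiN. Qed.

Let iter_cts t x : sphere x -> cts_at (iter t phi) x.
Proof.
move=> sx; elim: t => [|t IH] /=; first by move=> e e0; exists e.
exact: (cts_at_comp IH (phi_cts (iterS t sx))).
Qed.

Let g_iter_le s t x : sphere x -> (s <= t)%N -> g (iter s phi x) <= g (iter t phi x).
Proof.
move=> sx; elim: t => [|t IH]; first by rewrite leqn0 => /eqP ->.
rewrite leq_eqVlt => /orP[/eqP -> //|/IH/le_trans]; apply.
exact: g_le (iterS t sx).
Qed.

(** Away from the fixed points the increase of [g] is positive and continuous, hence bounded below
    by compactness. *)
Let gain r : 0 < r -> exists2 e, 0 < e &
  forall x, sphere x -> (forall c, c \in pts -> r <= `|c - x|) -> g x + e <= g (phi x).
Proof.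
move=> r0; pose A : set V := [set x | forall c, c \in pts -> r <= `|c - x|].
have cA : closed A.
  have -> : A = \bigcap_(c in [set c | c \in pts]) ((fun x => `|c - x|) @^-1` [set y | r <= y]).
    by apply/seteqP; split=> x Ax c; exact: Ax.
  apply: closed_bigI => c _; apply: closed_comp => [x _|]; last exact: closed_ge.
  apply: (@continuous_comp V V R (fun y => c - y) (fun y => `|y|)).
    by apply: (@cvgB R V V (nbhs x)); [exact: cvg_cst | exact: cvg_id].
  exact: norm_continuous.
have [x d e d0 de|x [sx Ax]|e e0 eP] :=
    @compact_uniform R n _ (fun e x => g x + e <= g (phi x)) (compact_sphere_sub cA).
- by apply: le_trans; rewrite lerD2l.
- have xp : x \notin pts by apply/negP => /Ax; rewrite subrr normr0 leNgt r0.
  (* A quarter of the increase: the perturbations of [g x] and of [g (phi x)] cost at most one such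
     part each, and one more is the gain claimed nearby. *)
  pose e := (g (phi x) - g x) / 4.
  have e0 : 0 < e by rewrite divr_gt0 ?subr_gt0 ?g_lt.
  have [d1 d10 H1] := g_cts sx e0.
  have [d2 d20 H2] := cts_at_comp (phi_cts sx) (g_cts (phiS sx)) e0.
  have m0 : 0 < Num.min e (Num.min d1 d2) by rewrite !lt_min e0 d10.
  exists (Num.min e (Num.min d1 d2)) => // x'; rewrite !lt_min => /and3P[_ /H1 h1 /H2 h2] _.
  have : Num.min e (Num.min d1 d2) <= e by rewrite ge_min lexx.
  move: h1 h2; rewrite /= !ltr_norml => /andP[h1 h2] /andP[h3 h4] h5.
  by rewrite /e in h1 h2 h3 h4 h5 *; lra.
- by exists e => // x sx Ax; apply: eP.
Qed.

(** An orbit that leaves a fixed point [c] and later approaches another one [c'] has gained so much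
    on the way that [g c < g c']. Since [g (- c) = g c], no orbit comes near both [c] and [- c]. The
    bound [T] exists because [g] is bounded and grows steadily along an orbit that stays away from
    all fixed points. *)
Let antipodal_split : exists (T : nat) (r : R), 
  (forall x, sphere x -> exists2 t, (t <= T)%N &
     exists2 c, c \in pts & `|c - iter t phi x| <= r) /\
  forall x c t t', sphere x -> c \in pts -> `|c - iter t phi x| <= r ->
     `|- c - iter t' phi x| <= r -> False.
Proof.
(* Open balls of radius [rho] around distinct fixed points are disjoint. *)
have [rho rho0 rhoP] : exists2 r, 0 < r & forall p, p \in [seq (c, c') | c <- pts, c' <- pts] ->
    p.1 != p.2 -> 2 * r <= `|p.1 - p.2|.
  apply: (@finite_uniform R (V * V)%type) => [[c c'] d e d0 de H cc'|[c c'] _].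
    by apply: le_trans (H cc'); rewrite ler_pM2l.
  case: (eqVneq c c') => [_|cc']; first by exists 1.
  exists (`|c - c'| / 2) => [|_]; first by rewrite divr_gt0 // normr_gt0 subr_eq0.
  by rewrite mulrC divfK ?pnatr_eq0 ?lexx.
(* One step from the [r1]-ball of a fixed point stays in its [rho]-ball, so an orbit cannot jump
   directly from one fixed point to the neighbourhood of another. *)
have [r1 r10 r1P] : exists2 r, 0 < r & forall c, c \in pts ->
    r <= rho /\ forall x, `|c - x| < r -> `|c - phi x| < rho.
  apply: finite_uniform => [c d e d0 de [er H]|c /ptsP[sc pc]].
    by split=> [|x xd]; [exact: le_trans er|apply/H/(lt_le_trans xd)].
  have [d d0 dP] := phi_cts sc rho0; exists (Num.min d rho); first by rewrite lt_min d0.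
  split=> [|x]; first by rewrite ge_min lexx orbT.
  by rewrite lt_min => /andP[/dP]; rewrite pc.
have [delta delta0 deltaP] := gain r10.
(* [delta] is gained by a step outside the [r1]-balls; comparing [g] with its values at the two
   fixed points costs less than [delta / 2] at either end. *)
have [r2 r20 r2P] : exists2 r, 0 < r & forall c, c \in pts ->
    r < r1 /\ forall x, `|c - x| <= r -> `|g c - g x| < delta / 2.
  apply: finite_uniform => [c d e d0 de [er H]|c /ptsP[sc pc]].
    by split=> [|x xd]; [exact: le_lt_trans er|apply/H/(le_trans xd)].
  have [|d d0 dP] := g_cts sc (e := delta / 2); first by rewrite divr_gt0.
  have m0 : 0 < Num.min d r1 by rewrite lt_min d0.
  have half (y : R) : 0 < y -> y / 2 < y.
    by move=> y0; rewrite ltr_pdivrMr // ltr_pMr // ltr1n.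
  exists (Num.min d r1 / 2); first by rewrite divr_gt0.
  split=> [|x xm]; first by apply: lt_le_trans (half _ m0) _; rewrite ge_min lexx orbT.
  by apply/dP/(le_lt_trans xm)/(lt_le_trans (half _ m0)); rewrite ge_min lexx.
have [eps eps0 epsP] := gain r20.
have [B BP] : exists B, forall x, sphere x -> `|g x| <= B.
  have [|x [sx _]|e e0 eP] := @compact_uniform R n _ (fun e x => `|g x| <= e^-1)
    (@compact_sphere_sub setT closedT).
  - by move=> x d e d0 de /le_trans; apply; rewrite lef_pV2 // posrE (lt_le_trans d0).
  - have [d d0 dP] := g_cts sx ltr01.
    have y0 : 0 < `|g x| + 1 by rewrite ltr_wpDl.
    exists (Num.min d (`|g x| + 1)^-1); first by rewrite lt_min d0 invr_gt0.
    move=> x'; rewrite lt_min => /andP[/dP xx' _] _.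
    apply: (@le_trans _ _ (`|g x| + 1)).
      rewrite -lerBlDl; apply: le_trans (ltW xx'); rewrite distrC.
      by apply: le_trans (ler_norm _) _; apply: ler_dist_dist.
    rewrite -[leLHS]invrK lef_pV2 ?posrE ?invr_gt0 ?lt_min ?d0 ?invr_gt0 //.
    by rewrite ge_min lexx orbT.
  - by exists e^-1 => x sx; apply: eP.
(* An orbit that stays [r2]-away gains [eps] at each step, while [g] varies by at most [2 * B] in
   all. *)
exists (Num.truncn (2 * B / eps)).+1, r2; split.
  move=> x sx; apply: contrapT => nhit.
  set T := _.+1 in nhit *.
  have far t c : (t <= T)%N -> c \in pts -> r2 <= `|c - iter t phi x|.
    by move=> tT cp; case: (ltP `|c - iter t phi x| r2) => // /ltW h; case: nhit; exists t => //;
      exists c.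
  have grow t : (t <= T)%N -> g x + t%:R * eps <= g (iter t phi x).
    elim: t => [|t IH] tT; first by rewrite mul0r addr0.
    have := epsP _ (iterS t sx) (fun c => far t c (ltnW tT)); have := IH (ltnW tT).
    by rewrite -natr1 mulrDl mul1r addrA /= => h1 h2; apply: le_trans h2; rewrite lerD2r.
  have := grow T (leqnn T); apply/negP; rewrite -ltNge.
  have : 2 * B < T%:R * eps by rewrite -ltr_pdivrMr // truncnS_gt.
  have := BP _ sx; have := BP _ (iterS T sx); rewrite !ler_norml => /andP[h1 h2] /andP[h3 h4].
  by lra.
have key x c c' t t' : sphere x -> c \in pts -> c' \in pts -> c != c' -> (t <= t')%N ->
    `|c - iter t phi x| <= r2 -> `|c' - iter t' phi x| <= r2 -> g c < g c'.
  move=> sx cp c'p cc' tt' ct ct'.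
  have [r1rho near_phi] := r1P c cp; have [r21 gnear] := r2P c cp.
  have [_ gnear'] := r2P c' c'p.
  have sep c1 c2 : c1 \in pts -> c2 \in pts -> c1 != c2 -> 2 * rho <= `|c1 - c2|.
    by move=> h1 h2; apply: (rhoP (c1, c2)); apply: allpairs_f.
  (* The exit step: the point after it lies in the [rho]-ball of [c] but outside the [r1]-ball,
     hence far from every fixed point, so the next step gains [delta]. *)
  have [s /andP[ts st'] [sin sout]] : exists2 s, (t <= s < t')%N &
      `|c - iter s phi x| < r1 /\ r1 <= `|c - iter s.+1 phi x|.
    have : r1 <= `|c - iter t' phi x|.
      have := sep c c' cp c'p cc'; have := ler_distD (iter t' phi x) c c'.
      by rewrite (distrC (iter t' phi x) c'); lra.
    elim: t' tt' {ct'} => [|t' IH].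
      by rewrite leqn0 => /eqP t0 h; exfalso; move: ct; rewrite t0; lra.
    rewrite leq_eqVlt => /orP[/eqP <- h|tt' h]; first by exfalso; lra.
    have [lt1|/(IH tt')[s /andP[s1 s2] sP]] := ltP `|c - iter t' phi x| r1.
      by exists t'; rewrite ?leqnn ?andbT.
    by exists s; rewrite // s1 (ltn_trans s2).
  have zrho := near_phi _ sin.
  have st : (s.+2 <= t')%N.
    rewrite ltn_neqAle st' andbT; apply/eqP => e; move: ct'; rewrite -e => ct'.
    have := sep c c' cp c'p cc'; have := ler_distD (iter s.+1 phi x) c c'.
    by rewrite (distrC (iter s.+1 phi x) c'); move: zrho => /=; lra.
  have sz : sphere (iter s.+1 phi x) by apply: iterS.
  have far c2 : c2 \in pts -> r1 <= `|c2 - iter s.+1 phi x|.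
    move=> c2p; case: (eqVneq c c2) => [<- //|cc2].
    have := sep c c2 cp c2p cc2; have := ler_distD (iter s.+1 phi x) c c2.
    by rewrite (distrC (iter s.+1 phi x) c2); move: zrho => /=; lra.
  have := deltaP _ sz far; have := g_iter_le sx st; have /(g_iter_le sx) := leqW ts.
  have := gnear _ ct; have := gnear' _ ct'; rewrite !ltr_norml => /andP[h1 h2] /andP[h3 h4].
  by rewrite [iter s.+2 _ _]/=; lra.
move=> x c t t' sx cp ct ct'.
have Ncp : - c \in pts.
  move: cp; rewrite !mem_cat => /orP[cc|/mapP[c2 c2s ->]].
    by rewrite (map_f -%R cc) orbT.
  by rewrite opprK c2s.
have cNc : c != - c.
  apply/eqP => ec; have [] := ptsP cp; rewrite /sphere /= => lc _.
  suff c0 : c = 0 by move/eqP: lc; rewrite c0 -(scale0r 0) l1_scale normr0 mul0r eq_sym oner_eq0.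
  apply/rowP => i; have := congr1 (fun u : V => u 0 i) ec; rewrite !mxE; lra.
have [tt'|/ltnW tt'] := leqP t t'.
  by have := key _ _ _ _ _ sx cp Ncp cNc tt' ct ct'; rewrite gN ltxx.
rewrite eq_sym in cNc.
by have := key _ _ _ _ _ sx Ncp cp cNc tt' ct' ct; rewrite gN ltxx.
Qed.

(* The discrete form of the Lusternik-Schnirelmann theorem: the points whose
   orbit comes close to [c] form a closed set that misses its antipode. *)
Theorem lusternik_schnirelmann : (n < size cs)%N.
Proof.
have [T [r [hit excl]]] := antipodal_split.
pose A c x := exists2 t, (t <= T)%N & `|c - iter t phi x| <= r.
have AN c x : A (- c) (- x) <-> A c x.
  by split=> -[t tT h]; exists t => //; move: h; rewrite iterN -opprD normrN.
have Aexcl c x : sphere x -> c \in cs -> A c x -> A (- c) x -> False.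
  by move=> sx ccs [t _ h] [t' _ h']; apply: (excl x c t t') => //; rewrite mem_cat ccs.
have Aopen c x : sphere x -> ~ A c x ->
    exists2 e, 0 < e & forall x', `|x - x'| < e -> ~ A c x'.
  move=> sx nA; have [||e e0 eP] := @finite_uniform R nat (iota 0 T.+1)
    (fun e t => forall x', `|x - x'| < e -> r < `|c - iter t phi x'|).
  - by move=> t d e d0 de H x' xd; apply/H/(lt_le_trans xd).
  - move=> t; rewrite mem_iota add0n ltnS => tT.
    have rlt : r < `|c - iter t phi x|.
      by rewrite ltNge; apply/negP => h; apply: nA; exists t.
    have [|d d0 dP] := @iter_cts t x sx (`|c - iter t phi x| - r); first by rewrite subr_gt0.
    exists d => // x' /dP h; have := ler_distD (iter t phi x') c (iter t phi x).
    by rewrite (distrC (iter t phi x') (iter t phi x)); lra.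
  - by exists e => // x' xx' [t tT]; apply/negP; rewrite -ltNge; apply: eP => //; rewrite mem_iota.
(* [A c] and [A (- c)] are disjoint and their complements are open in the sphere ([Aopen]); by
   compactness a positive distance separates them, for all [c] at once. *)
have [D D0 DP] : exists2 e, 0 < e & forall c, c \in cs ->
    forall x, sphere x -> forall w, sphere w -> `|x - w| <= e -> A c x -> A (- c) w -> False.
  apply: finite_uniform => [c d e d0 de H x sx w sw xw|c ccs].
    by apply: H => //; apply: le_trans de.
  have [|x [sx _]|e e0 eP] := @compact_uniform R n _ (fun e x => forall w, sphere w ->
     `|x - w| <= e -> A c x -> A (- c) w -> False) (@compact_sphere_sub setT closedT).
  - by move=> x d e d0 de H w sw xw; apply: H => //; apply: le_trans de.
  - have [Acx|nA] := pselect (A c x); last first.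
      by have [e e0 eP] := Aopen c x sx nA; exists e => // x' /eP h _ w _ _ /h.
    have [e e0 eP] := Aopen (- c) x sx (Aexcl c x sx ccs Acx).
    exists (e / 2); first by rewrite divr_gt0.
    move=> x' xx' _ w _ x'w _; apply: eP.
    by have := ler_distD x' x w; lra.
  - by exists e => // x sx; apply: eP.
pose near c x := `[< A c x \/ A (- c) x >].
(* The index of the first [c] such that the orbit comes near [c] or [- c], together with the side.
   Antipodes receive flipped labels, and complementary labels within distance [D] are impossible, so
   [antipodal_labels] excludes [size cs <= n]. *)
pose lab x := (find (near ^~ x) cs, `[< A (nth 0 cs (find (near ^~ x) cs)) x >]).
have nearN c x : near c (- x) = near c x.
  rewrite /near; apply/asbool_equiv_eq; split=> -[].
  - by move=> h; right; rewrite -AN opprK.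
  - by rewrite AN; left.
  - by rewrite -AN; right.
  - by rewrite -AN opprK; left.
have has_near x : sphere x -> has (near ^~ x) cs.
  move=> /hit[t tT [c cp h]]; move: cp; rewrite mem_cat => /orP[cc|/mapP[c' cc' e]].
    by apply/hasP; exists c => //; apply/asboolP; left; exists t.
  by apply/hasP; exists c' => //; apply/asboolP; right; exists t; rewrite // -e.
have lab_side x : sphere x -> let c := nth 0 cs (lab x).1 in
    [/\ c \in cs, (lab x).2 -> A c x & ~~ (lab x).2 -> A (- c) x].
  move=> sx /=; have hx := has_near x sx; split.
  - by rewrite mem_nth // -has_find.
  - by move/asboolP.
  - by move/asboolPn => nA; have /asboolP[] := nth_find 0 hx.
rewrite ltnNge; apply/negP => sz.
have [x sx|v [w [sv sw vw lw]]] := @antipodal_labels R n (size cs) lab D sz D0.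
  split; first by rewrite /= -has_find; apply: has_near.
  have e1 : (lab (- x)).1 = (lab x).1 by apply: eq_find => c; apply: nearN.
  have [ccs h1 h2] := lab_side x sx.
  have sNx : sphere (- x) by rewrite /sphere /= l1_opp.
  have [_ h1' h2'] := lab_side (- x) sNx; rewrite e1 in h1' h2'.
  rewrite [LHS]surjective_pairing e1 /flip; congr (_, _).
  case e2: (lab x).2 h1 h2 => h1 h2; case e2': (lab (- x)).2 h1' h2' => h1' h2' //.
    have /AN := h1' isT; rewrite opprK => h3; by case: (Aexcl _ _ sx ccs (h1 isT)).
  have := h2' isT; rewrite AN => h3; by case: (Aexcl _ _ sx ccs h3 (h2 isT)).
have vwD : `|v - w| <= D.
  by apply: norm_le_entries => [|i]; [exact: ltW | rewrite !mxE].
have [ccs h1 h2] := lab_side v sv.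
have [_ h1' h2'] := lab_side w sw.
have e2 : (lab w).2 = ~~ (lab v).2 by rewrite lw.
have e1 : (lab w).1 = (lab v).1 by rewrite lw.
rewrite e1 e2 negbK in h1' h2'.
case: (boolP (lab v).2) => lv.
  exact: (DP _ ccs v sv w sw vwD (h1 lv) (h2' lv)).
by apply: (DP _ ccs w sw v sv) => //; [rewrite distrC | exact: h1' | exact: h2].
Qed.

End Descent.
End Sphere.
End Lyapunov.

(** * Real critical points as fixed points of a gradient step *)

Module RealCritical.
From mathcomp Require Import topology normedtype.
Import Order.TTheory GRing.Theory Num.Theory numFieldNormedType.Exports.
Import Octahedron Lyapunov.
Local Open Scope classical_set_scope.
Local Open Scope ring_scope.

Section EntrywiseContinuity.
Context {R : realType} {n : nat}.
Local Notation V := 'rV[R]_n.+1.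

Definition ctsm p q (F : V -> 'M[R]_(p, q)) (x : V) :=
  forall i j, {for x, continuous (fun z => F z i j)}.

Lemma ctsm_cst p q (A : 'M[R]_(p, q)) x : ctsm (fun=> A) x.
Proof. by move=> i j; exact: cst_continuous. Qed.

Lemma ctsm_id x : ctsm id x.
Proof. by move=> i j; exact: (@coord_continuous R 1 n.+1 i j x). Qed.

Lemma ctsmP p q (F : V -> 'M[R]_(p, q)) x (f : 'I_p -> 'I_q -> V -> R) :
  (forall z i j, F z i j = f i j z) -> (forall i j, {for x, continuous (f i j)}) ->
  ctsm F x.
Proof.
move=> Ff fx i j; rewrite (_ : (fun z => F z i j) = f i j) //.
by apply/funext => z; apply: Ff.
Qed.

Lemma ctsm_tr p q (F : V -> 'M[R]_(p, q)) x : ctsm F x -> ctsm (fun z => (F z)^T) x.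
Proof.
by move=> Fx; apply: (ctsmP (f := fun i j z => F z j i)) => // z i j; rewrite mxE.
Qed.

Lemma ctsmD p q (F G : V -> 'M[R]_(p, q)) x :
  ctsm F x -> ctsm G x -> ctsm (fun z => F z + G z) x.
Proof.
move=> Fx Gx; apply: (ctsmP (f := fun i j z => F z i j + G z i j)) => [z i j|i j].
  by rewrite mxE.
by apply: (@cvgD _ _ _ (nbhs x)); [apply: Fx | apply: Gx].
Qed.

Lemma ctsmN p q (F : V -> 'M[R]_(p, q)) x : ctsm F x -> ctsm (fun z => - F z) x.
Proof.
move=> Fx; apply: (ctsmP (f := fun i j z => - F z i j)) => [z i j|i j].
  by rewrite mxE.
by apply: (@cvgN _ _ _ (nbhs x)); apply: Fx.
Qed.

Lemma ctsmM p q r (F : V -> 'M[R]_(p, q)) (G : V -> 'M[R]_(q, r)) x :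
  ctsm F x -> ctsm G x -> ctsm (fun z => F z *m G z) x.
Proof.
move=> Fx Gx.
apply: (ctsmP (f := fun i j z => \sum_k F z i k * G z k j)) => [z i j|i j].
  by rewrite mxE.
apply: (@continuous_sum R V) => k.
by apply: (@cvgM _ _ (nbhs x)); [apply: Fx | apply: Gx].
Qed.

Lemma ctsmZ p q (f : V -> R) (F : V -> 'M[R]_(p, q)) x :
  {for x, continuous f} -> ctsm F x -> ctsm (fun z => f z *: F z) x.
Proof.
move=> fx Fx; apply: (ctsmP (f := fun i j z => f z * F z i j)) => [z i j|i j].
  by rewrite mxE.
by apply: (@cvgM _ _ (nbhs x)); [apply: fx | apply: Fx].
Qed.

Lemma continuous_det p (F : V -> 'M[R]_p) x :
  ctsm F x -> {for x, continuous (fun z => \det (F z))}.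
Proof.
move=> Fx; apply: (@continuous_sum R V) => s.
apply: (@cvgM _ _ (nbhs x)); first exact: cvg_cst.
by apply: (@continuous_prod R V) => i; apply: Fx.
Qed.

Lemma ctsm_adj p (F : V -> 'M[R]_p) x : ctsm F x -> ctsm (fun z => \adj (F z)) x.
Proof.
move=> Fx; apply: (ctsmP (f := fun i j z => cofactor (F z) j i)) => [z i j|i j].
  by rewrite mxE.
apply: (@cvgM _ _ (nbhs x)); first exact: cvg_cst.
apply: continuous_det; apply: (ctsmP (f := fun k l z => F z (lift j k) (lift i l))) => //.
by move=> z k l; rewrite !mxE.
Qed.

Lemma ctsm_cts_at (F : V -> V) x : ctsm F x -> cts_at F x.
Proof.
move=> Fx e e0; have e2 : 0 < e / 2 by rewrite divr_gt0.
have [||d d0 dP] := @finite_uniform R 'I_n.+1 (enum 'I_n.+1)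
  (fun d i => forall x', `|x - x'| < d -> `|F x 0 i - F x' 0 i| < e / 2).
- by move=> i d d' d0 dd' H x' xd; apply/H/(lt_le_trans xd).
- by move=> i _; have := continuous_cts_at (Fx 0 i); apply.
exists d => // x' xx'; apply: (@le_lt_trans _ _ (e / 2)).
  apply: norm_le_entries => [|i]; first exact: ltW.
  by rewrite !mxE ltW // dP // mem_enum.
by rewrite ltr_pdivrMr // ltr_pMr // ltr1n.
Qed.

End EntrywiseContinuity.

Section Core.
Context {R : realType} {m n : nat}.
Local Notation V := 'rV[R]_m.+1.
Local Notation M := 'M[R]_(m.+1, n).
Variables (B : M -> M -> R) (w : M).
Hypothesis BD : forall X Y Z : M, B (X + Y) Z = B X Z + B Y Z.
Hypothesis BZ : forall (t : R) (X Z : M), B (t *: X) Z = t * B X Z.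
Hypothesis Bsym : forall X Z : M, B X Z = B Z X.
Hypothesis Bpos : forall X : M, X != 0 -> 0 < B X X.
Implicit Types (x a : V) (y : 'rV[R]_n) (X Y : M).

Lemma form0l X : B 0 X = 0.
Proof. by rewrite -(scale0r (0 : M)) BZ mul0r. Qed.

Lemma formDr X Y Z : B Z (X + Y) = B Z X + B Z Y.
Proof. by rewrite Bsym BD !(Bsym Z). Qed.

Lemma formZr (t : R) X Z : B Z (t *: X) = t * B Z X.
Proof. by rewrite Bsym BZ !(Bsym Z). Qed.

Lemma form_ge0 X : 0 <= B X X.
Proof. by have [->|/Bpos/ltW //] := eqVneq X 0; rewrite form0l. Qed.

Lemma form_suml (I : Type) (r : seq I) (F : I -> M) Y :
  B (\sum_(i <- r) F i) Y = \sum_(i <- r) B (F i) Y.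
Proof.
elim: r => [|i r IH]; first by rewrite !big_nil form0l.
by rewrite !big_cons BD IH.
Qed.

Lemma form_expand X Y : B X Y = \sum_i \sum_j X i j * B (delta_mx i j) Y.
Proof.
rewrite {1}[X]matrix_sum_delta form_suml; apply: eq_bigr => i _.
by rewrite form_suml; apply: eq_bigr => j _; rewrite BZ.
Qed.

Definition gram X : M := \matrix_(i, j) B X (delta_mx i j).

Lemma gramE X Y : B X Y = \sum_i \sum_j gram X i j * Y i j.
Proof.
rewrite Bsym form_expand; apply: eq_bigr => i _; apply: eq_bigr => j _.
by rewrite mxE mulrC Bsym.
Qed.

Lemma gram_rank1 X a y : (a *m gram X *m y^T) 0 0 = B X (a^T *m y).
Proof.
rewrite gramE mxE exchange_big; apply: eq_bigr => j _; rewrite !mxE mulr_suml.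
by apply: eq_bigr => i _; rewrite !mxE big_ord1 !mxE mulrA [a 0 i * _]mulrC.
Qed.

Definition fiber_gram x : 'M[R]_n :=
  \matrix_(j, k) B (x^T *m delta_mx 0 j) (x^T *m delta_mx 0 k).

Lemma gram_fiber x y : x *m gram (x^T *m y) = y *m fiber_gram x.
Proof.
apply/rowP => k; rewrite [RHS]mxE.
have -> : (x *m gram (x^T *m y)) 0 k = (x *m gram (x^T *m y) *m (delta_mx 0 k : 'rV_n)^T) 0 0.
  by rewrite trmx_delta -colE [RHS]mxE.
rewrite gram_rank1 {1}[y]row_sum_delta mulmx_sumr form_suml.
by apply: eq_bigr => j _; rewrite -scalemxAr BZ !mxE.
Qed.

Lemma fiber_gramE x y y' : (y *m fiber_gram x *m y'^T) 0 0 = B (x^T *m y) (x^T *m y').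
Proof. by rewrite -gram_fiber gram_rank1. Qed.

Lemma tr_mul_eq0 x y : x != 0 -> x^T *m y = 0 -> y = 0.
Proof.
move=> /rV0Pn[i xi] xy; apply/rowP => j.
have := congr1 (fun A : M => A i j) xy; rewrite !mxE big_ord1 !mxE => /eqP.
by rewrite mulf_eq0 (negPf xi) => /eqP.
Qed.

Lemma fiber_gram_unit x : x != 0 -> fiber_gram x \in unitmx.
Proof.
move=> x0; rewrite -row_free_unit -kermx_eq0.
apply/rowV0P => y /sub_kermxP yD; apply: (tr_mul_eq0 x0).
apply/eqP; apply: contraTT (lexx (0 : R)) => /Bpos.
by rewrite -fiber_gramE yD mul0mx mxE ltxx.
Qed.

(** The inverse written with the adjugate: continuity in [x] is then visible wherever the
    determinant does not vanish. *)
Definition fiber_inv x := (\det (fiber_gram x))^-1 *: \adj (fiber_gram x).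

Lemma fiber_invE x : x != 0 -> fiber_inv x = invmx (fiber_gram x).
Proof. by move/fiber_gram_unit => u; rewrite /fiber_inv /invmx u. Qed.

(* [x^T *m best x] is the point of x (x) V_2 nearest to the data, whose Gram
   image is [w]; [gain x] is its squared norm. *)
Definition best x := x *m w *m fiber_inv x.

Definition residual x := w - gram (x^T *m best x).

Definition gain x := (x *m w *m (best x)^T) 0 0.

(** Half the gradient of [gain]: since [best x] is optimal, its variation does not contribute to
    first order. *)
Definition ascent x : V := (residual x *m (best x)^T)^T.

Lemma bestP x : x != 0 -> best x *m fiber_gram x = x *m w.
Proof. by move=> x0; rewrite /best fiber_invE // mulmxKV // fiber_gram_unit. Qed.

Lemma mul_residual x : x != 0 -> x *m residual x = 0.
Proof. by move=> x0; rewrite mulmxBr gram_fiber bestP // subrr. Qed.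

Lemma gainE x : x != 0 -> gain x = B (x^T *m best x) (x^T *m best x).
Proof. by move=> x0; rewrite /gain -bestP // fiber_gramE. Qed.

(** Expand the squared length of [x^T *m best x - x^T *m y], which is nonnegative. So [gain x] is a
    maximum over [y], attained at [best x]. *)
Lemma gain_ge x y : x != 0 ->
  2 * (x *m w *m y^T) 0 0 - B (x^T *m y) (x^T *m y) <= gain x.
Proof.
move=> x0; rewrite -bestP // fiber_gramE gainE //.
have := form_ge0 (x^T *m best x - x^T *m y).
rewrite -scaleN1r BD !formDr !BZ !formZr (Bsym (x^T *m y) (x^T *m best x)).
by lra.
Qed.

(** The vector [best x] is kept while [x] moves: this yields a quadratic lower bound for [gain]
    without differentiating it. *)
Lemma gain_step x a : x != 0 -> x + a != 0 ->
  gain x + 2 * (a *m residual x *m (best x)^T) 0 0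
    - B (a^T *m best x) (a^T *m best x) <= gain (x + a).
Proof.
move=> x0 xa0; apply: le_trans (gain_ge (best x) xa0).
set y := best x; set X := x^T *m y.
have -> : (a *m residual x *m y^T) 0 0 = (a *m w *m y^T) 0 0 - B X (a^T *m y).
  by rewrite mulmxBr mulmxBl mxE [X in _ + X]mxE gram_rank1.
have -> : ((x + a) *m w *m y^T) 0 0 = gain x + (a *m w *m y^T) 0 0.
  by rewrite !mulmxDl mxE.
rewrite linearD /= mulmxDl -/X BD !formDr (Bsym _ X) -gainE //.
by lra.
Qed.

Lemma ascentE x : (ascent x *m (ascent x)^T) 0 0 = (ascent x *m residual x *m (best x)^T) 0 0.
Proof. by rewrite {2}/ascent trmxK mulmxA. Qed.

Lemma mul_tr_gt0 x : x != 0 -> 0 < (x *m x^T) 0 0.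
Proof.
move=> /rV0Pn[i xi]; rewrite mxE (bigD1 i) //= ltr_wpDr //.
  by rewrite sumr_ge0 // => j _; rewrite mxE -expr2 sqr_ge0.
by rewrite mxE -expr2 exprn_even_gt0.
Qed.

Lemma ascent_orth x : x != 0 -> ascent x *m x^T = 0.
Proof.
move=> x0; apply: trmx_inj; rewrite trmx_mul trmxK trmx0 /ascent trmxK mulmxA.
by rewrite mul_residual // mul0mx.
Qed.

Definition curv x := B ((ascent x)^T *m best x) ((ascent x)^T *m best x).

(** Along s times [ascent x], the bound of [gain_step] rises by 2 s N - s^2 c, where N is the
    squared length of the ascent and c is [curv x]. The optimal s is N / c; the denominator 1 + c
    cannot vanish and keeps s in the range of increase. *)
Definition stepsize x := (ascent x *m (ascent x)^T) 0 0 / (1 + curv x).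

Definition improve x := x + stepsize x *: ascent x.

(** The step is orthogonal to [x] ([gain] being constant on lines through 0), so it cannot lead to
    0. *)
Lemma improve_neq0 x : x != 0 -> improve x != 0.
Proof.
move=> x0; apply: contraTneq (mul_tr_gt0 x0) => ix0; rewrite -leNgt.
have : improve x *m x^T = x *m x^T.
  by rewrite mulmxDl -scalemxAl ascent_orth // scaler0 addr0.
by rewrite ix0 mul0mx => <-; rewrite mxE.
Qed.

Lemma gain_improve x : x != 0 -> ascent x != 0 -> gain x < gain (improve x).
Proof.
move=> x0 v0; apply: lt_le_trans (gain_step x0 (improve_neq0 x0)).
rewrite -!scalemxAl mxE -ascentE linearZ /= -scalemxAl BZ formZr -/(curv x).
rewrite -addrA ltrDl /stepsize.
have := mul_tr_gt0 v0; set N := (ascent x *m _) 0 0 => N0.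
have c0 : 0 <= curv x by apply: form_ge0.
have c1 : 0 < 1 + curv x by rewrite ltr_wpDr.
have -> : 2 * (N / (1 + curv x) * N) - N / (1 + curv x) * (N / (1 + curv x) * curv x)
    = N ^+ 2 / (1 + curv x) ^+ 2 * (2 + curv x).
  by field; rewrite gt_eqF.
by rewrite mulr_gt0 ?divr_gt0 ?exprn_gt0 // ltr_wpDr.
Qed.

Lemma trmxN p q (A : 'M[R]_(p, q)) : (- A)^T = - A^T.
Proof. by rewrite linearN. Qed.

Lemma fiber_gramN x : fiber_gram (- x) = fiber_gram x.
Proof.
apply/matrixP => i j; rewrite !mxE trmxN !mulNmx.
rewrite -(scaleN1r (x^T *m delta_mx 0 i)) -(scaleN1r (x^T *m delta_mx 0 j)) BZ formZr.
by rewrite mulrA mulrNN !mul1r.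
Qed.

Lemma bestN x : best (- x) = - best x.
Proof. by rewrite /best /fiber_inv fiber_gramN !mulNmx. Qed.

Lemma residualN x : residual (- x) = residual x.
Proof. by rewrite /residual bestN trmxN mulNmx mulmxN opprK. Qed.

Lemma ascentN x : ascent (- x) = - ascent x.
Proof. by rewrite /ascent residualN bestN trmxN mulmxN trmxN. Qed.

Lemma gainN x : gain (- x) = gain x.
Proof. by rewrite /gain bestN trmxN !mulNmx mulmxN opprK. Qed.

Lemma curvN x : curv (- x) = curv x.
Proof. by rewrite /curv bestN ascentN trmxN mulNmx mulmxN opprK. Qed.

Lemma improveN x : improve (- x) = - improve x.
Proof.
rewrite /improve /stepsize curvN ascentN trmxN mulNmx mulmxN opprK.
by rewrite scalerN opprD.
Qed.

Lemma gain_scale t x : t != 0 -> x != 0 -> gain (t *: x) = gain x.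
Proof.
move=> t0 x0; have tx0 : t *: x != 0 by rewrite scaler_eq0 negb_or t0.
have b : t *: best (t *: x) = best x.
  have inj := can_inj (mulmxK (fiber_gram_unit x0)); apply: inj.
  rewrite bestP // -scalemxAl; apply: (scalerI t0).
  have fgt : fiber_gram (t *: x) = (t * t) *: fiber_gram x.
    apply/matrixP => k l; rewrite !mxE [(t *: x)^T]linearZ /= -!scalemxAl BZ formZr.
    by rewrite mulrA.
  by have := bestP tx0; rewrite fgt -scalemxAr -scalerA -scalemxAl.
by rewrite /gain -scalemxAl scalemxAl -b linearZ /= -!scalemxAl scalemxAr.
Qed.

Definition normalize x := (l1 x)^-1 *: x.

Definition flow x := normalize (improve x).

Lemma l1_normalize x : x != 0 -> l1 (normalize x) = 1.
Proof.
move=> x0; rewrite l1_scale normfV ger0_norm ?sumr_ge0 // mulVf //.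
by rewrite l1_eq0.
Qed.

Lemma sphere_neq0 x : sphere x -> x != 0.
Proof. by rewrite -l1_eq0 => ->; rewrite oner_eq0. Qed.

Lemma ctsm_form (F : V -> M) Y x : ctsm F x -> {for x, continuous (fun z => B (F z) Y)}.
Proof.
move=> Fx; rewrite (_ : (fun z => _) =
    fun z => \sum_i \sum_j F z i j * B (delta_mx i j) Y); last first.
  by apply/funext => z; apply: form_expand.
apply: (@continuous_sum R V) => i; apply: (@continuous_sum R V) => j.
by apply: (@cvgM _ _ (nbhs x)); [apply: Fx | apply: cvg_cst].
Qed.

Lemma ctsm_gram (F : V -> M) x : ctsm F x -> ctsm (fun z => gram (F z)) x.
Proof.
move=> Fx; apply: (ctsmP (f := fun i j z => B (F z) (delta_mx i j))) => [z i j|i j].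
  by rewrite mxE.
exact: ctsm_form.
Qed.

Lemma ctsm_form2 (F : V -> M) x : ctsm F x -> {for x, continuous (fun z => B (F z) (F z))}.
Proof.
move=> Fx; rewrite (_ : (fun z => _) =
    fun z => \sum_i \sum_j gram (F z) i j * F z i j); last first.
  by apply/funext => z; apply: gramE.
apply: (@continuous_sum R V) => i; apply: (@continuous_sum R V) => j.
by apply: (@cvgM _ _ (nbhs x)); [apply: ctsm_gram | apply: Fx].
Qed.

Lemma ctsm_fiber_gram x : ctsm fiber_gram x.
Proof.
pose F (j : 'I_n) (z : V) : M := z^T *m delta_mx 0 j.
have Fc j : ctsm (F j) x by apply: ctsmM; [apply/ctsm_tr/ctsm_id|apply: ctsm_cst].
apply: (ctsmP (f := fun j k z => \sum_i \sum_l F j z i l * B (delta_mx i l) (F k z))).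
  by move=> z j k; rewrite mxE -form_expand.
move=> j k; apply: (@continuous_sum R V) => i; apply: (@continuous_sum R V) => l.
apply: (@cvgM _ _ (nbhs x)); first exact: Fc.
have e : (fun z => B (delta_mx i l) (F k z)) = (fun z => B (F k z) (delta_mx i l)).
  by apply/funext => z; rewrite Bsym.
have : {for x, continuous (fun z => B (delta_mx i l) (F k z))} by rewrite e; apply: ctsm_form.
exact.
Qed.

Lemma ctsm_best x : x != 0 -> ctsm best x.
Proof.
move=> x0; apply: ctsmM; first by apply: ctsmM; [apply: ctsm_id|apply: ctsm_cst].
apply: ctsmZ; last by apply/ctsm_adj/ctsm_fiber_gram.
apply: (@cvgV _ _ (nbhs x)); last by apply/continuous_det/ctsm_fiber_gram.
by have := fiber_gram_unit x0; rewrite unitmxE unitfE.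
Qed.

Lemma ctsm_ascent x : x != 0 -> ctsm ascent x.
Proof.
move=> x0; have cb := ctsm_best x0; apply: ctsm_tr.
apply: ctsmM; last exact: ctsm_tr.
apply: ctsmD; first exact: ctsm_cst.
apply/ctsmN/ctsm_gram; apply: ctsmM => //; exact/ctsm_tr/ctsm_id.
Qed.

Lemma continuous_gain x : x != 0 -> {for x, continuous gain}.
Proof.
move=> x0; have : ctsm (fun z => z *m w *m (best z)^T) x; last exact.
apply: ctsmM; last exact/ctsm_tr/ctsm_best.
by apply: ctsmM; [apply: ctsm_id|apply: ctsm_cst].
Qed.

Lemma ctsm_improve x : x != 0 -> ctsm improve x.
Proof.
move=> x0; have cv := ctsm_ascent x0.
apply: ctsmD; first exact: ctsm_id.
apply: ctsmZ => //; apply: (@cvgM _ _ (nbhs x)).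
  have : ctsm (fun z => ascent z *m (ascent z)^T) x; last exact.
  by apply: ctsmM => //; apply: ctsm_tr.
apply: (@cvgV _ _ (nbhs x)); first by rewrite gt_eqF // ltr_wpDr ?form_ge0.
apply: (@cvgD _ _ _ (nbhs x)); first exact: cvg_cst.
apply: (@ctsm_form2 (fun z => (ascent z)^T *m best z)).
by apply: ctsmM; [apply: ctsm_tr | apply: ctsm_best].
Qed.

Lemma ctsm_flow x : x != 0 -> ctsm flow x.
Proof.
move=> x0; have ci := ctsm_improve x0.
apply: ctsmZ => //; apply: (@cvgV _ _ (nbhs x)); first by rewrite l1_eq0 improve_neq0.
apply: (@continuous_sum R V) => i.
by apply: (@cvg_norm _ _ _ (nbhs x)); apply: ci.
Qed.

Lemma proportional_sphere x x' t : sphere x -> sphere x' -> x' = t *: x ->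
  x' = x \/ x' = - x.
Proof.
rewrite /sphere /= => sx + e; rewrite e l1_scale sx mulr1 => /eqP.
rewrite eqr_norml ler01 andbT => /orP[] /eqP ->.
  by left; rewrite scale1r.
by right; rewrite scaleN1r.
Qed.

Hypothesis rank_w : (m <= \rank w)%N.

Lemma left_kernel_line x x' : x != 0 -> x *m w = 0 -> x' *m w = 0 ->
  exists t, x' = t *: x.
Proof.
move=> x0 /sub_kermxP xw /sub_kermxP x'w; apply/sub_rVP.
apply: submx_trans x'w _.
rewrite -(geq_leqif (mxrank_leqif_sup xw)) mxrank_ker rank_rV x0 /=; lia.
Qed.

(** A nonzero product determines [x] up to a scalar. A zero one means [x *m w = 0], and [rank_w]
    leaves at most one line of such [x]: the vertex, too, comes from at most one antipodal pair. *)
Lemma critical_sphere_eq x x' : sphere x -> sphere x' ->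
  x^T *m best x = x'^T *m best x' -> x' = x \/ x' = - x.
Proof.
move=> sx sx' e; have [x0 x'0] := (sphere_neq0 sx, sphere_neq0 sx').
suff [t] : exists t, x' = t *: x by apply: proportional_sphere.
have [X0|X0] := eqVneq (x^T *m best x) 0.
  apply: left_kernel_line => //; rewrite -bestP //.
    by rewrite (tr_mul_eq0 x0 X0) mul0mx.
  by rewrite (tr_mul_eq0 x'0 (etrans (esym e) X0)) mul0mx.
have [i [j Xij]] := matrix0Pn _ X0.
have b'j : best x' 0 j != 0.
  by move: Xij; rewrite e mxE big_ord1 mulf_eq0 negb_or => /andP[].
exists (best x 0 j / best x' 0 j); apply/rowP => k; rewrite mxE.
apply: (mulIf b'j); have := congr1 (fun A : M => A k j) e.
by rewrite [LHS]mxE [RHS]mxE !big_ord1 ![_^T k _]mxE => <-; rewrite mulrAC divfK // mulrC.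
Qed.

(** Choosing one preimage on the sphere for each element of [s] that has one gives a list [cs]
    containing all zeros of [ascent] up to sign; [lusternik_schnirelmann] bounds its length. The
    case [y = 0] of the hypothesis is the vertex, for [x] in the kernel of [w]. *)
Theorem real_critical_points (s : seq M) :
  (forall x y, x != 0 -> x *m (w - gram (x^T *m y)) = 0 ->
     (w - gram (x^T *m y)) *m y^T = 0 -> x^T *m y \in s) ->
  (m < size s)%N.
Proof.
move=> sP; pose Z x := sphere x /\ ascent x = 0.
pose rep X := if pselect (exists x, Z x /\ x^T *m best x = X) is left h
              then Some (projT1 (cid h)) else None.
pose cs := pmap rep s.
have csZ c : c \in cs -> Z c.
  rewrite mem_pmap => /mapP[X _]; rewrite /rep; case: pselect => // h [->].
  by case: cid => x [].
have Zcs x : Z x -> x \in cs ++ map -%R cs.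
  move=> Zx; have [sx vx] := Zx; have x0 := sphere_neq0 sx.
  have Xs : x^T *m best x \in s.
    apply: sP => //; first exact: mul_residual.
    by apply: trmx_inj; rewrite trmx0.
  case: (pselect (exists z, Z z /\ z^T *m best z = x^T *m best x)); last first.
    by case; exists x.
  move=> h; pose c := projT1 (cid h).
  have [Zc cX] : Z c /\ c^T *m best c = x^T *m best x by rewrite /c; case: cid.
  have ccs : c \in cs.
    rewrite mem_pmap; apply/mapP; exists (x^T *m best x) => //.
    rewrite /rep; case: pselect => [h'|]; last by case.
    by rewrite /c (Prop_irrelevance h h').
  rewrite mem_cat; have [->|->] := critical_sphere_eq (proj1 Zc) sx cX.
    by rewrite ccs.
  by rewrite (map_f -%R ccs) orbT.
have szcs : (size cs <= size s)%N by rewrite size_pmap count_size.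
apply: leq_trans szcs.
apply: (@lusternik_schnirelmann R m flow gain cs).
- by move=> x /sphere_neq0/improve_neq0/l1_normalize.
- by move=> x; rewrite /flow improveN /normalize l1_opp scalerN.
- exact: gainN.
- by move=> x /sphere_neq0/ctsm_flow/ctsm_cts_at.
- by move=> x /sphere_neq0/continuous_gain/continuous_cts_at.
- move=> c /csZ[sc vc]; split=> //.
  by rewrite /flow /improve vc scaler0 addr0 /normalize sc invr1 scale1r.
- move=> x sx xp; have x0 := sphere_neq0 sx.
  rewrite /flow /normalize gain_scale ?improve_neq0 //.
    by apply: gain_improve => //; apply: contraNneq xp => vx; apply: Zcs.
  by rewrite invr_eq0 l1_eq0 improve_neq0.
Qed.

End Core.
End RealCritical.

(** * Polynomial functions, Zariski closure and natural points *)

Module Polynomials.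
Import complex mpoly.
Import Order.TTheory GRing.Theory Num.Theory.
Local Open Scope classical_set_scope.
Local Open Scope ring_scope.

Section FunctionAlgebras.
Context {T : Type} {K : comPzRingType} (P : (T -> K) -> Prop).

(** Two classes are meant, the polynomial functions ([polyfun]) and the terms of the first-order
    language ([definable_fun]); matrix expressions are treated once for both. *)
Definition fun_algebra := [/\ forall c, P (fun=> c),
  forall f g, P f -> P g -> P (fun t => f t + g t) &
  forall f g, P f -> P g -> P (fun t => f t * g t)].

Definition entries p q (A : T -> 'M[K]_(p, q)) := forall i j, P (fun t => A t i j).

Hypothesis PA : fun_algebra.

Lemma fun_algebra_ext f g : f =1 g -> P f -> P g.
Proof. by move=> /funext ->. Qed.

Lemma fun_algebra_sum (I : Type) (r : seq I) (Q : pred I) (f : I -> T -> K) :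
  (forall i, P (f i)) -> P (fun t => \sum_(i <- r | Q i) f i t).
Proof.
case: PA => Pc Pa Pm Pf; elim: r => [|i r IH].
  by apply: fun_algebra_ext (Pc 0) => t; rewrite big_nil.
case Qi: (Q i).
  by apply: fun_algebra_ext (Pa _ _ (Pf i) IH) => t; rewrite big_cons Qi.
by apply: fun_algebra_ext IH => t; rewrite big_cons Qi.
Qed.

Lemma fun_algebra_prod (I : Type) (r : seq I) (f : I -> T -> K) :
  (forall i, P (f i)) -> P (fun t => \prod_(i <- r) f i t).
Proof.
case: PA => Pc Pa Pm Pf; elim: r => [|i r IH].
  by apply: fun_algebra_ext (Pc 1) => t; rewrite big_nil.
by apply: fun_algebra_ext (Pm _ _ (Pf i) IH) => t; rewrite big_cons.
Qed.

Lemma entries_cst p q (A : 'M[K]_(p, q)) : entries (fun=> A).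
Proof. by case: PA => Pc _ _ i j; apply: Pc. Qed.

Lemma entriesD p q (A B : T -> 'M[K]_(p, q)) :
  entries A -> entries B -> entries (fun t => A t + B t).
Proof.
case: PA => _ Pa _ EA EB i j.
by apply: fun_algebra_ext (Pa _ _ (EA i j) (EB i j)) => t; rewrite mxE.
Qed.

Lemma entriesM p q r (A : T -> 'M[K]_(p, q)) (B : T -> 'M[K]_(q, r)) :
  entries A -> entries B -> entries (fun t => A t *m B t).
Proof.
move=> EA EB i j.
apply: (@fun_algebra_ext (fun t => \sum_k A t i k * B t k j)) => [t|].
  by rewrite mxE.
by case: PA => _ _ Pm; apply: fun_algebra_sum => k; apply: Pm.
Qed.

Lemma entriesN p q (A : T -> 'M[K]_(p, q)) : entries A -> entries (fun t => - A t).
Proof.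
case: PA => Pc _ Pm EA i j.
by apply: fun_algebra_ext (Pm _ _ (Pc (-1)) (EA i j)) => t; rewrite mxE mulN1r.
Qed.

Lemma entriesZ p q (f : T -> K) (A : T -> 'M[K]_(p, q)) :
  P f -> entries A -> entries (fun t => f t *: A t).
Proof.
case: PA => _ _ Pm Pf EA i j.
by apply: fun_algebra_ext (Pm _ _ Pf (EA i j)) => t; rewrite mxE.
Qed.

Lemma entries_tr p q (A : T -> 'M[K]_(p, q)) : entries A -> entries (fun t => (A t)^T).
Proof. by move=> EA i j; apply: fun_algebra_ext (EA j i) => t; rewrite mxE. Qed.

Lemma entries_vec p q (A : T -> 'rV[K]_(p * q)) :
  entries A -> entries (fun t => vec_mx (A t)).
Proof. by move=> EA i j; apply: fun_algebra_ext (EA 0 (mxvec_index i j)) => t; rewrite mxE. Qed.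

Lemma entries_mxvec p q (A : T -> 'M[K]_(p, q)) :
  entries A -> entries (fun t => mxvec (A t)).
Proof.
move=> EA i j; case/mxvec_indexP: j => k l.
by apply: fun_algebra_ext (EA k l) => t; rewrite ord1 mxvecE.
Qed.

Lemma fun_algebra_det p (A : T -> 'M[K]_p) : entries A -> P (fun t => \det (A t)).
Proof.
case: PA => Pc _ Pm EA; apply: fun_algebra_sum => s; apply: Pm; first exact: Pc.
by apply: fun_algebra_prod => i; apply: EA.
Qed.

End FunctionAlgebras.

Lemma mpoly_closure (K : comNzRingType) k (P : {mpoly K[k]} -> Prop) :
  (forall c, P c%:MP) -> (forall i, P 'X_i) ->
  (forall p q, P p -> P q -> P (p + q)) -> (forall p q, P p -> P q -> P (p * q)) ->
  forall p, P p.
Proof.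
move=> PC PX PD PM; elim/mpolyind => [|c m p _ _ Pp]; first by rewrite -mpolyC0.
apply: PD => //; rewrite -mul_mpolyC mpolyXE_id; apply: (PM) => //.
apply: (big_rec P) => [|i q _ Pq]; first by rewrite -mpolyC1.
apply: (PM) => //; elim: (m i) => [|d IH]; first by rewrite expr0 -mpolyC1.
by rewrite exprS; apply: (PM).
Qed.

Section PolynomialFunctions.
Context {K : fieldType} {k : nat}.
Implicit Types (f g : 'rV[K]_k -> K) (X S : set 'rV[K]_k).

Definition polyfun f := exists p : {mpoly K[k]}, forall a, f a = p.@[a 0].

Lemma polyfun_algebra : fun_algebra polyfun.
Proof.
split=> [c|f g [p fp] [q gq]|f g [p fp] [q gq]].
- by exists c%:MP => a; rewrite mevalC.
- by exists (p + q) => a; rewrite mevalD fp gq.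
- by exists (p * q) => a; rewrite mevalM fp gq.
Qed.

Lemma polyfun_id : entries polyfun (@id 'rV[K]_k).
Proof. by move=> i j; exists 'X_j => a; rewrite mevalXU ord1. Qed.

Lemma zclosure_polyfun S f a :
  polyfun f -> (forall s, S s -> f s = 0) -> zclosure S a -> f a = 0.
Proof. by move=> [p fp] fS /(_ p); rewrite fp; apply=> s /fS; rewrite fp. Qed.

Lemma zclosure_sub S : S `<=` zclosure S.
Proof. by move=> a Sa p; apply. Qed.

Lemma vanishing_zclosure S : vanishing (zclosure S) = vanishing S.
Proof.
by apply/seteqP; split=> p pS a Sa; [apply/pS/zclosure_sub | apply: Sa].
Qed.

End PolynomialFunctions.

Section ChainRule.
Context {K : fieldType} {k : nat}.
Implicit Types (p : {mpoly K[k]}) (c : 'I_k -> {poly K}).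

Lemma chain_rule p c : exists q : {poly K},
  (forall t, q.[t] = p.@[fun i => (c i).[t]]) /\
  q^`().[0] = \sum_i (p^`M(i)).@[fun i => (c i).[0]] * (c i)^`().[0].
Proof.
elim/mpoly_closure: p => [a|i|p q [P [Pe Pd]] [Q [Qe Qd]]|p q [P [Pe Pd]] [Q [Qe Qd]]].
- exists a%:P; split=> [t|]; first by rewrite hornerC mevalC.
  by rewrite derivC horner0 big1 // => i _; rewrite mderivC meval0 mul0r.
- exists (c i); split=> [t|]; first by rewrite mevalXU.
  rewrite (bigD1 i) //= big1 => [|j ji].
    rewrite mderivX; have -> : (U_(i) - U_(i) = 0 :> 'X_{1..k})%MM.
      by apply/mnmP => l; rewrite mnmBE subnn mnm0E.
    by rewrite mnm1E eqxx mpolyX0 scale1r meval1 mul1r addr0.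
  by rewrite mderivX mnm1E eq_sym (negPf ji) scale0r meval0 mul0r.
- exists (P + Q); split=> [t|]; first by rewrite hornerD mevalD Pe Qe.
  rewrite derivD hornerD Pd Qd -big_split; apply: eq_bigr => i _ /=.
  by rewrite mderivD mevalD mulrDl.
- exists (P * Q); split=> [t|]; first by rewrite hornerM mevalM Pe Qe.
  rewrite derivM hornerD !hornerM Pd Qd Pe Qe mulr_suml mulr_sumr -big_split.
  apply: eq_bigr => i _ /=; rewrite mderivM mevalD !mevalM; ring.
Qed.

End ChainRule.

Lemma infinite_roots (K : numFieldType) (p : {poly K}) :
  (forall n : nat, (0 < n)%N -> p.[n%:R] = 0) -> p = 0.
Proof.
move=> p0; apply: (@roots_geq_poly_eq0 _ _ [seq n.+1%:R | n <- iota 0 (size p)]).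
- by apply/allP => x /mapP[n _ ->]; apply/rootP/p0.
- rewrite map_inj_uniq ?iota_uniq // => i j /eqP.
  by rewrite eqr_nat => /eqP[].
- by rewrite size_map size_iota.
Qed.


Section CharZero.
Context {K : numFieldType} {k : nat}.
Implicit Types (p : {mpoly K[k]}).

(** On a line parallel to an axis, a polynomial vanishing at all naturals is zero, and so is its
    derivative. Hence the partial derivatives also vanish at all natural points, and induction on
    the degree of a monomial kills its coefficient, in characteristic zero. *)
Lemma mpoly_nat_point p : p != 0 -> exists a : 'I_k -> nat, p.@[fun i => (a i)%:R] != 0.
Proof.
move=> p0; apply: contrapT => nex.
have {nex}p0' (a : 'I_k -> nat) : p.@[fun i => (a i)%:R] = 0.
  by apply/eqP; apply: contraT => h; case: nex; exists a.
case/negP: p0; apply/eqP/mpolyP => m; rewrite mcoeff0.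
move: {2}(mdeg m) (erefl (mdeg m)) => d; elim: d m p p0' => [|d IH] m p p0 dm.
  move/eqP: dm; rewrite mdeg_eq0 => /eqP ->.
  have := p0 (fun=> 0%N); rewrite mevalE => e; rewrite -[RHS]e.
  rewrite [p in LHS]mpolyE raddf_sum /=; apply: eq_bigr => n _.
  rewrite mcoeffZ mcoeffX; congr (_ * _).
  case: eqVneq => [->|n0]; first by rewrite big1 // => i _; rewrite mnm0E expr0.
  have [i ni] : exists i, n i != 0%N.
    apply/existsP; apply: contraNT n0 => /existsPn ni.
    by apply/eqP/mnmP => i; rewrite mnm0E; apply/eqP; have := ni i; rewrite negbK.
  by rewrite (bigD1 i) //= expr0n (negPf ni) mul0r.
have [i mi] : exists i, (0 < m i)%N.
  apply/existsP; apply: contraPT dm => /existsPn mi.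
  suff -> : m = 0%MM by rewrite mdeg0.
  by apply/mnmP => i; rewrite mnm0E; apply/eqP; have := mi i; rewrite lt0n negbK.
have mE : m = (m - U_(i) + U_(i))%MM.
  by rewrite submK //; apply/mnm_lepP => j; rewrite mnm1E; case: eqVneq => // <-.
have : (p^`M(i))@_(m - U_(i)) = 0.
  apply: IH => [a|]; last by move/eqP: dm; rewrite {1}mE mdegD mdeg1 addn1 eqSS => /eqP.
  pose c j : {poly K} := if j == i then 'X + (a i)%:R%:P else (a j)%:R%:P.
  have [q [qe qd]] := chain_rule p c.
  have q0 : q = 0.
    apply: infinite_roots => n _; rewrite qe.
    rewrite -[RHS](p0 (fun j => if j == i then (n + a i)%N else a j)).
    apply: meval_eq => j; rewrite /c; case: ifP => _;
      first by rewrite hornerD hornerX hornerC natrD.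
    by rewrite hornerC.
  move: qd; rewrite q0 derivC horner0 (bigD1 i) //= big1 => [|j ji].
    rewrite /c eqxx derivD derivX derivC addr0 !hornerE => e.
    rewrite [RHS]e; apply: meval_eq => j; case: eqVneq => [->|_].
      by rewrite hornerD hornerX hornerC add0r.
    by rewrite hornerC.
  by rewrite /c (negPf ji) derivC horner0 mulr0.
rewrite mcoeff_mderiv -mE => /eqP; rewrite mulrn_eq0 /= => /eqP //.
Qed.

End CharZero.
End Polynomials.

(** * Zariski tangent spaces, polynomial curves and generic points *)

Module Tangents.
Import complex mpoly.
Import Order.TTheory GRing.Theory Num.Theory.
Import Polynomials.
Local Open Scope classical_set_scope.
Local Open Scope ring_scope.

Section Lindim.
Context {K : fieldType} {k : nat}.
Implicit Types (S X : set 'rV[K]_k) (a b v : 'rV[K]_k) (p : {mpoly K[k]}).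

Lemma lindim_ge S d (B : 'M[K]_(d, k)) :
  row_free B -> (forall i, S (row i B)) -> (d <= lindim S)%N.
Proof.
move=> fB SB; have dk : (d < k.+1)%N by rewrite ltnS -(eqP fB) rank_leq_col.
rewrite -[d]/(nat_of_ord (Ordinal dk)) /lindim.
by apply: (leq_bigmax_cond (Ordinal dk)); apply/asboolP; exists B.
Qed.

Lemma lindim_le S d :
  (forall d' (B : 'M[K]_(d', k)), row_free B -> (forall i, S (row i B)) -> (d' <= d)%N) ->
  (lindim S <= d)%N.
Proof. by move=> H; apply/bigmax_leqP => i /asboolP[B [fB SB]]; apply: H SB. Qed.

Lemma lindim_sub S S' : S `<=` S' -> (lindim S <= lindim S')%N.
Proof. by move=> SS'; apply: lindim_le => d B fB SB; apply: lindim_ge fB _ => i; apply/SS'. Qed.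

Lemma lindim_row_space m (A : 'M[K]_(m, k)) :
  lindim [set v | (v <= A)%MS] = \rank A.
Proof.
apply/eqP; rewrite eqn_leq; apply/andP; split.
  apply: lindim_le => d B fB AB; apply: (@leq_trans (\rank B)).
    by rewrite (eqP fB).
  by apply/mxrankS/row_subP => i; apply: AB.
apply: (lindim_ge (row_base_free A)) => i /=.
by apply: submx_trans (row_sub i _) _; rewrite eq_row_base.
Qed.

Lemma lindim_kernel m (A : 'M[K]_(k, m)) :
  lindim [set v | v *m A = 0] = (k - \rank A)%N.
Proof.
rewrite -mxrank_ker -lindim_row_space; congr lindim; apply/seteqP.
by split=> v /=; [move/sub_kermxP | move/sub_kermxP].
Qed.

Definition grad p a : 'rV[K]_k := \row_i (p^`M(i)).@[a 0].

Lemma tangentE X a :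
  tangent X a = [set v | forall p, vanishing X p -> v *m (grad p a)^T = 0].
Proof.
apply/seteqP; split=> v Tv p /Tv.
  move=> e; apply/matrixP => i j; rewrite !mxE !ord1 -[RHS]e.
  by apply: eq_bigr => l _; rewrite !mxE mulrC.
move=> /matrixP/(_ 0 0); rewrite !mxE => e; rewrite -[RHS]e.
by apply: eq_bigr => l _; rewrite !mxE mulrC.
Qed.

Lemma entries_grad c (p : 'I_c -> {mpoly K[k]}) :
  entries polyfun (fun a => \matrix_(i < c) grad (p i) a).
Proof. by move=> i j; exists ((p i)^`M(j)) => a; rewrite !mxE. Qed.

(* The rank of the differentials is lower semicontinuous. *)
Lemma lindim_tangent_ge S d b :
  (forall s, S s -> (d <= lindim (tangent (zclosure S) s))%N) ->
  zclosure S b -> (d <= lindim (tangent (zclosure S) b))%N.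
Proof.
move=> Sd Sb.
pose jac c (p : 'I_c -> {mpoly K[k]}) a := \matrix_(i < c) grad (p i) a.
(* A maximal family of equations of [S] with independent gradients at [b]: the gradient of any other
   equation depends on theirs, so they cut out the whole tangent space at [b]. *)
pose good c := `[< exists p : 'I_c -> {mpoly K[k]},
  (forall i, vanishing S (p i)) /\ row_free (jac c p b) >].
have good0 : exists c, good c.
  exists 0%N; apply/asboolP; exists (fun=> 0); split; first by case.
  by rewrite /row_free -leqn0 rank_leq_row.
have goodk c : good c -> (c <= k)%N.
  by move=> /asboolP[p [_ /eqP <-]]; apply: rank_leq_col.
case: (ex_maxnP good0 goodk) => c /asboolP[p [Sp fp]] cmax.
have rb : \rank (jac c p b) = c := eqP fp.
have Tb : tangent (zclosure S) b = [set v | v *m (jac c p b)^T = 0].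
  rewrite tangentE vanishing_zclosure; apply/seteqP; split=> v /= Tv.
    apply/matrixP => i j; rewrite ord1 mxE [RHS]mxE.
    have /matrixP/(_ 0 0) := Tv _ (Sp j); rewrite !mxE => e; rewrite -[RHS]e.
    by apply: eq_bigr => l _; rewrite !mxE.
  move=> q Sq; suff /submxP[u ->] : (grad q b <= jac c p b)%MS.
    by rewrite trmx_mul mulmxA Tv mul0mx.
  apply: contraT => nq; suff : (c.+1 <= c)%N by rewrite ltnn.
  apply: cmax; apply/asboolP.
  exists (fun i => oapp p q (unlift ord_max i)); split.
    by move=> i; case: unliftP => [j _|_] /=.
  set J := jac _ _ _.
  have rowsJ : (jac c p b + grad q b <= J)%MS.
    rewrite addsmx_sub; apply/andP; split.
      apply/row_subP => i; rewrite rowK.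
      by have := row_sub (lift ord_max i) J; rewrite rowK liftK.
    by have := row_sub ord_max J; rewrite rowK unlift_none.
  rewrite /row_free eqn_leq rank_leq_row /=; apply: leq_trans (mxrankS rowsJ).
  have /mxrank_leqif_sup := addsmxSl (jac c p b) (grad q b).
  rewrite rb => -[le eqc]; rewrite ltn_neqAle le andbT eqc.
  by apply: contra nq => /(submx_trans (addsmxSr _ _)).
rewrite Tb lindim_kernel mxrank_tr rb.
(* The determinant of the Jacobian matrix times [L] is a polynomial equal to 1 at [b], so it cannot
   vanish on all of [S]; where it does not, the same equations are still independent. *)
have [L Lb] : exists L : 'M[K]_(k, c), jac c p b *m L = 1%:M.
  by case/row_freeP: fp => L; exists L.
have [s [Ss /eqP ds]] : exists s, S s /\ \det (jac c p s *m L) != 0.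
  apply: contrapT => nex; have : \det (jac c p b *m L) = 0.
    apply: (@zclosure_polyfun _ _ S (fun a => \det (jac c p a *m L))) => //.
      apply: (fun_algebra_det polyfun_algebra).
      apply: (entriesM polyfun_algebra); first exact: entries_grad.
      exact: (entries_cst polyfun_algebra).
    move=> s Ss; apply/eqP; apply: contraT => h; case: nex; by exists s.
  by rewrite Lb det1 => /eqP; rewrite oner_eq0.
apply: leq_trans (Sd s Ss) _.
have rs : \rank (jac c p s)^T = c.
  rewrite mxrank_tr; apply/eqP; rewrite -/(row_free _); apply/row_freeP.
  exists (L *m invmx (jac c p s *m L)).
  by rewrite mulmxA mulmxV // unitmxE unitfE; apply/eqP.
apply: leq_trans (lindim_sub (S' := [set v | v *m (jac c p s)^T = 0]) _) _; last first.
  by rewrite lindim_kernel rs.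
rewrite tangentE vanishing_zclosure => v /= Tv.
apply/matrixP => i j; rewrite ord1 mxE [RHS]mxE.
have /matrixP/(_ 0 0) := Tv _ (Sp j); rewrite !mxE => e; rewrite -[RHS]e.
by apply: eq_bigr => l _; rewrite !mxE.
Qed.

End Lindim.

Section Curves.
Context {K : numFieldType}.

(** A polynomial function with derivative [d] at 0; it determines [d] because the field is infinite
    ([curve_uniq]). *)
Definition curve (f : K -> K) (d : K) :=
  exists q : {poly K}, (forall t, f t = q.[t]) /\ q^`().[0] = d.

Definition curvem p q (F : K -> 'M[K]_(p, q)) (D : 'M[K]_(p, q)) :=
  forall i j, curve (fun t => F t i j) (D i j).

Lemma curve_ext f g d d' : f =1 g -> d = d' -> curve f d -> curve g d'.
Proof. by move=> /funext -> ->. Qed.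

Lemma curve_cst c : curve (fun=> c) 0.
Proof. by exists c%:P; split=> [t|]; rewrite ?derivC !hornerE. Qed.

Lemma curve_id : curve id 1.
Proof. by exists 'X; split=> [t|]; rewrite ?derivX !hornerE. Qed.

Lemma curveD f g d e : curve f d -> curve g e -> curve (fun t => f t + g t) (d + e).
Proof.
move=> [p [fp <-]] [q [gq <-]]; exists (p + q).
by split=> [t|]; rewrite ?derivD hornerD ?fp ?gq.
Qed.

Lemma curveM f g d e : curve f d -> curve g e ->
  curve (fun t => f t * g t) (d * g 0 + f 0 * e).
Proof.
move=> [p [fp <-]] [q [gq <-]]; exists (p * q).
by split=> [t|]; rewrite ?derivM ?hornerD !hornerM !fp !gq.
Qed.

Lemma curve_sum (I : Type) (r : seq I) (f : I -> K -> K) (d : I -> K) :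
  (forall i, curve (f i) (d i)) ->
  curve (fun t => \sum_(i <- r) f i t) (\sum_(i <- r) d i).
Proof.
move=> fd; elim: r => [|i r IH].
  by apply: curve_ext (curve_cst 0) => [t|]; rewrite big_nil.
by apply: curve_ext (curveD (fd i) IH) => [t|]; rewrite big_cons.
Qed.

Lemma curve_uniq f d e : curve f d -> curve f e -> d = e.
Proof.
move=> [p [fp <-]] [q [fq <-]]; suff -> : p = q by [].
apply/eqP; rewrite -subr_eq0; apply/eqP; apply: infinite_roots => n _.
by rewrite hornerD hornerN -fp -fq subrr.
Qed.

Lemma curvem_cst p q (A : 'M[K]_(p, q)) : curvem (fun=> A) 0.
Proof. by move=> i j; rewrite mxE; apply: curve_cst. Qed.

Lemma curvem_line p q (A B : 'M[K]_(p, q)) : curvem (fun t => A + t *: B) B.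
Proof.
move=> i j; have := curveD (curve_cst (A i j)) (curveM curve_id (curve_cst (B i j))).
by apply: curve_ext => [t|]; rewrite ?mxE ?mxE //; ring.
Qed.

Lemma curvemD p q (F G : K -> 'M[K]_(p, q)) D E :
  curvem F D -> curvem G E -> curvem (fun t => F t + G t) (D + E).
Proof. by move=> FD GE i j; apply: curve_ext (curveD (FD i j) (GE i j)) => [t|]; rewrite mxE. Qed.

Lemma curvemN p q (F : K -> 'M[K]_(p, q)) D : curvem F D -> curvem (fun t => - F t) (- D).
Proof.
move=> FD i j; apply: curve_ext (curveM (curve_cst (-1)) (FD i j)) => [t|].
  by rewrite mxE mulN1r.
by rewrite mxE; ring.
Qed.

Lemma curvemM p q r (F : K -> 'M[K]_(p, q)) (G : K -> 'M[K]_(q, r)) D E :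
  curvem F D -> curvem G E -> curvem (fun t => F t *m G t) (D *m G 0 + F 0 *m E).
Proof.
move=> FD GE i j; have := curve_sum (index_enum _) (fun k => curveM (FD i k) (GE k j)).
by apply: curve_ext => [t|]; rewrite !mxE // big_split.
Qed.

Lemma curvem_tr p q (F : K -> 'M[K]_(p, q)) D :
  curvem F D -> curvem (fun t => (F t)^T) D^T.
Proof. by move=> FD i j; apply: curve_ext (FD j i) => [t|]; rewrite mxE. Qed.

Lemma curvem_vec p q (F : K -> 'rV[K]_(p * q)) D :
  curvem F D -> curvem (fun t => vec_mx (F t)) (vec_mx D).
Proof. by move=> FD i j; apply: curve_ext (FD 0 (mxvec_index i j)) => [t|]; rewrite mxE. Qed.

Lemma curvem_mxvec p q (F : K -> 'M[K]_(p, q)) D :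
  curvem F D -> curvem (fun t => mxvec (F t)) (mxvec D).
Proof.
move=> FD i j; case/mxvec_indexP: j => k l.
by apply: curve_ext (FD k l) => [t|]; rewrite ord1 mxvecE.
Qed.

Lemma curvem_row p q r (F : K -> 'M[K]_(p, q)) (G : K -> 'M[K]_(p, r)) D E :
  curvem F D -> curvem G E -> curvem (fun t => row_mx (F t) (G t)) (row_mx D E).
Proof.
move=> FD GE i j; case: (split_ordP j) => l ->.
  by apply: curve_ext (FD i l) => [t|]; rewrite row_mxEl.
by apply: curve_ext (GE i l) => [t|]; rewrite row_mxEr.
Qed.

Section Tangency.
Context {k : nat}.
Implicit Types (S X : set 'rV[K]_k) (a v : 'rV[K]_k).

(** An equation of [S], restricted to the curve, is a polynomial with infinitely many zeros, so it
    vanishes at 0 as well. This takes the place of a limit. *)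
Lemma curve_zclosure S (F : K -> 'rV[K]_k) D : curvem F D ->
  (forall n : nat, (0 < n)%N -> S (F n%:R)) -> zclosure S (F 0).
Proof.
move=> /(_ 0)/choice[c cP] SF p Sp; have [q [qe _]] := chain_rule p c.
have Fc t : F t 0 =1 fun i => (c i).[t] by move=> i; have [] := cP i.
have q0 : q = 0.
  by apply: infinite_roots => n n0; rewrite qe -[RHS](Sp _ (SF n n0)); apply/esym/meval_eq.
by rewrite -[RHS](horner0 0) -q0 qe; apply: meval_eq.
Qed.

(** The function [f] excludes the finitely many parameters at which the curve may leave [X]: an
    equation of [X] times [f] vanishes all along the curve. *)
Lemma curve_tangent X (F : K -> 'rV[K]_k) D f d : curvem F D -> curve f d -> f 0 != 0 ->
  (forall t, f t != 0 -> X (F t)) -> tangent X (F 0) D.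
Proof.
move=> /(_ 0)/choice[c cP] [q0 [fq0 _]] f0 XF p Xp; have [q [qe qd]] := chain_rule p c.
have Fc t : F t 0 =1 fun i => (c i).[t] by move=> i; have [] := cP i.
have q00 : q0 != 0 by apply: contraNneq f0 => q00; rewrite fq0 q00 horner0.
have q_eq0 : q = 0.
  suff : q * q0 = 0 by move/eqP; rewrite mulf_eq0 (negPf q00) orbF => /eqP.
  apply: infinite_roots => n _; rewrite hornerM -fq0.
  have [->|/XF/Xp e] := eqVneq (f n%:R) 0; first by rewrite mulr0.
  rewrite qe; suff -> : p.@[fun i => (c i).[n%:R]] = 0 by rewrite mul0r.
  by rewrite -[RHS]e; apply/esym/meval_eq.
move: qd; rewrite q_eq0 deriv0 horner0 => e; rewrite [RHS]e.
apply: eq_bigr => i _; have [_ ->] := cP i; congr (_ * _).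
exact: meval_eq.
Qed.

Lemma tangent_derivative X f a v d : polyfun f -> (forall x, X x -> f x = 0) ->
  curve (fun t => f (a + t *: v)) d -> tangent X a v -> d = 0.
Proof.
move=> [p fp] Xf fd Tv; apply: (curve_uniq fd).
have [q' [qe qd]] := chain_rule p (fun i => (a 0 i)%:P + (v 0 i) *: 'X).
exists q'; split=> [t|].
  by rewrite qe fp; apply: meval_eq => i; rewrite !mxE !hornerE mulrC.
rewrite qd -[RHS](Tv p) => [|x /Xf]; last by rewrite fp.
apply: eq_bigr => i _; congr (_ * _).
  by apply: meval_eq => j; rewrite !hornerE ?mulr0 ?addr0.
by rewrite derivD derivC derivZ derivX !hornerE.
Qed.

End Tangency.
End Curves.

Section Generic.
Context {K : fieldType} {k : nat}.
Implicit Types (P Q : 'rV[K]_k -> Prop).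

Definition generically P := exists p : {mpoly K[k]}, p != 0 /\
  forall a : 'rV[K]_k, p.@[a 0] != 0 -> P a.

Lemma generically_and P Q : generically P -> generically Q ->
  generically (fun a => P a /\ Q a).
Proof.
move=> [p [p0 pP]] [q [q0 qQ]]; exists (p * q); split; first by rewrite mulf_neq0.
by move=> a; rewrite mevalM mulf_eq0 negb_or => /andP[/pP ? /qQ].
Qed.

Lemma generically_imp P Q : (forall a, P a -> Q a) -> generically P -> generically Q.
Proof. by move=> PQ [p [p0 pP]]; exists p; split=> // a /pP/PQ. Qed.

Lemma generically_all (I : finType) (P : I -> 'rV[K]_k -> Prop) :
  (forall i, generically (P i)) -> generically (fun a => forall i, P i a).
Proof.
move=> PG; suff : generically (fun a => forall i, i \in enum I -> P i a).
  by apply: generically_imp => a H i; apply: H; rewrite mem_enum.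
elim: (enum I) => [|i s IH].
  by exists 1; split=> //; apply: oner_neq0.
apply: generically_imp (generically_and (PG i) IH) => a [Pi Ps] j.
by rewrite inE => /orP[/eqP ->|/Ps].
Qed.

Lemma generically_polyfun (f : 'rV[K]_k -> K) b : polyfun f -> f b != 0 -> generically (fun a =>
  f a != 0).
Proof.
move=> [p fp] fb; exists p; split=> [|a]; last by rewrite fp.
by apply: contraNneq fb => p0; rewrite fp p0 meval0.
Qed.

Lemma generically_notin_closed (Z : set 'rV[K]_k) :
  zclosed Z -> Z != [set: 'rV[K]_k] -> generically (fun a : 'rV[K]_k => ~ Z a).
Proof.
move=> Zc ZT; have [a nZa] : exists a, ~ Z a.
  apply: contrapT => nex; case/eqP: ZT; apply/seteqP; split=> // a _.
  by apply: contrapT => h; apply: nex; exists a.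
have [p Zp pa] : exists2 p, vanishing Z p & p.@[a 0] != 0.
  apply: contrapT => nex; apply: nZa; rewrite -Zc => p Zp.
  by apply/eqP; apply: contraT => h; case: nex; exists p.
exists p; split=> [|b pb /Zp pb0]; last by rewrite pb0 eqxx in pb.
by apply: contraNneq pa => ->; rewrite meval0.
Qed.

End Generic.

Lemma generically_ex (K : numFieldType) k (P : 'rV[K]_k -> Prop) :
  generically P -> exists a : 'I_k -> nat, P (\row_i (a i)%:R).
Proof.
move=> [p [/mpoly_nat_point[a pa] pP]]; exists a; apply: pP.
by rewrite (meval_eq (v2 := fun i => (a i)%:R)) // => i; rewrite mxE.
Qed.

Lemma generically_closed (K : numFieldType) k (P : 'rV[K]_k -> Prop) :
  generically P -> exists Z : set 'rV[K]_k,
  [/\ zclosed Z, Z != [set: 'rV[K]_k] & forall a, ~ Z a -> P a].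
Proof.
move=> gP; have [p [p0 pP]] := gP.
pose Z : set 'rV[K]_k := [set a | p.@[a 0] = 0].
exists Z; split.
- apply/seteqP; split=> [a Za|]; last exact: zclosure_sub.
  by apply: Za => b.
- have [a pa] := mpoly_nat_point p0; apply/eqP => ZT.
  have : Z (\row_i (a i)%:R) by rewrite ZT.
  rewrite /Z /= (meval_eq (v2 := fun i => (a i)%:R)) => [|i]; last by rewrite mxE.
  by apply/eqP.
- by move=> a /eqP/pP.
Qed.

End Tangents.

(** * Algebraic dependence and generically finite values *)

Module FiniteFibers.
Import complex mpoly.
Import Order.TTheory GRing.Theory Num.Theory.
Import Polynomials Tangents.
Local Open Scope classical_set_scope.
Local Open Scope ring_scope.

Lemma mnm_le_mdeg k (m : 'X_{1..k}) i : (m i <= mdeg m)%N.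
Proof. by rewrite mdegE (bigD1 i) //= leq_addr. Qed.

Lemma card_bmultinom k b : (#|{: 'X_{1..k < b}}| <= b ^ k)%N.
Proof.
rewrite -[k in (_ ^ k)%N]card_ord -[b in (b ^ _)%N]card_ord -card_ffun.
pose g (m : 'X_{1..k < b}) : {ffun 'I_k -> 'I_b} :=
  [ffun i => Ordinal (leq_ltn_trans (mnm_le_mdeg m i) (bmdeg m))].
apply: (@leq_card _ _ g) => m m' /ffunP e.
by apply/val_inj/mnmP => i; have := e i; rewrite !ffunE => /(congr1 val).
Qed.

Section Dependence.
Context {K : fieldType} {k : nat}.

Lemma msize_expr_le (p : {mpoly K[k]}) d n : (msize p <= d.+1)%N ->
  (msize (p ^+ n) <= (n * d).+1)%N.
Proof.
move=> pd; elim: n => [|n IH]; first by rewrite expr0 msize1.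
rewrite exprS; have [->|p0] := eqVneq p 0; first by rewrite mul0r msize0.
have [->|pn0] := eqVneq (p ^+ n) 0; first by rewrite mulr0 msize0.
rewrite msizeM //; move: pd IH; set x := msize p; set y := msize _; lia.
Qed.

Lemma msize_prod_le (I : Type) (r : seq I) (F : I -> {mpoly K[k]}) d :
  (forall i, msize (F i) <= d.+1)%N ->
  (msize (\prod_(i <- r) F i) <= (size r * d).+1)%N.
Proof.
move=> Fd; elim: r => [|i r IH]; first by rewrite big_nil msize1.
rewrite big_cons; have := Fd i.
have [->|p0] := eqVneq (F i) 0; first by rewrite mul0r msize0.
have [->|pn0] := eqVneq (\prod_(j <- r) F j) 0; first by rewrite mulr0 msize0.
rewrite msizeM //=; move: IH; set x := msize (F i); set y := msize _; lia.
Qed.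

(** There are [t ^ k.+1] monomials in the [f i] with exponents below [t], and they live in a space
    of dimension at most [b ^ k], which is smaller. *)
Lemma algebraic_dependence (f : 'I_k.+1 -> {mpoly K[k]}) :
  exists P : {mpoly K[k.+1]}, P != 0 /\
    forall a : 'I_k -> K, P.@[fun i => (f i).@[a]] = 0.
Proof.
pose d := (\max_i msize (f i))%N.
have fd i : (msize (f i) <= d.+1)%N by apply/leqW/leq_bigmax.
(* All these products have size at most [b = t * C], and [b ^ k = t ^ k * C ^ k < t ^ k.+1] because
   [t] exceeds [C ^ k]. *)
pose C := (k.+1 * d).+1.
pose t := (C ^ k).+1.
pose b := (t * C)%N.
pose mon (al : {ffun 'I_k.+1 -> 'I_t}) := \prod_i f i ^+ al i.
have mon_size al : (msize (mon al) <= b)%N.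
  apply: leq_trans (@msize_prod_le _ _ _ (C ^ k * d) _) _.
    move=> i; apply: leq_trans (msize_expr_le _ (fd i)) _.
    by rewrite ltnS leq_mul2r -ltnS ltn_ord orbT.
  rewrite /index_enum -enumT -cardT card_ord /b /C /t.
  set c := (_ ^ k)%N; nia.
pose A : 'M[K]_(#|{ffun 'I_k.+1 -> 'I_t}|, #|{: 'X_{1..k < b}}|) :=
  \matrix_(i, j) (mon (enum_val i))@_(enum_val j : 'X_{1..k < b}).
have kerA : kermx A != 0.
  rewrite -mxrank_eq0 mxrank_ker -lt0n subn_gt0.
  apply: leq_ltn_trans (rank_leq_col A) _; apply: leq_ltn_trans (card_bmultinom k b) _.
  rewrite card_ffun !card_ord /b expnMn expnS mulnC ltn_mul2r expn_gt0 /=.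
  by rewrite /t ltnS leqnn.
have [v vA v0] : exists2 v : 'rV[K]_#|{ffun 'I_k.+1 -> 'I_t}|, v *m A = 0 & v != 0.
  by case/rowV0Pn: kerA => v /sub_kermxP vA v0; exists v.
have mon0 : \sum_i v 0 i *: mon (enum_val i) = 0.
  apply/mpolyP => m; rewrite mcoeff0 raddf_sum /=.
  have [mb|mb] := ltnP (mdeg m) b.
    have := congr1 (fun B : 'rV_#|{: 'X_{1..k < b}}| => B 0 (enum_rank (BMultinom mb))) vA.
    rewrite !mxE => e; rewrite -[RHS]e; apply: eq_bigr => i _.
    by rewrite mcoeffZ mxE enum_rankK.
  rewrite big1 // => i _; rewrite mcoeffZ memN_msupp_eq0 ?mulr0 //.
  by apply: msize_mdeg_ge; apply: leq_trans mb; apply: mon_size.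
pose expo (i : 'I_#|{ffun 'I_k.+1 -> 'I_t}|) : 'X_{1..k.+1} :=
  [multinom (enum_val i : {ffun 'I_k.+1 -> 'I_t}) j : nat | j < k.+1].
have expo_inj : injective expo.
  move=> i j /mnmP e; apply: enum_val_inj; apply/ffunP => l; apply/val_inj.
  by have := e l; rewrite !mnmE.
exists (\sum_i v 0 i *: 'X_[expo i]); split.
  have [i vi] : exists i, v 0 i != 0 by apply/rV0Pn.
  apply: contraNneq vi => e; have := congr1 (mcoeff (expo i)) e.
  rewrite mcoeff0 raddf_sum /= (bigD1 i) //= big1 => [|j ji].
    by rewrite mcoeffZ mcoeffX eqxx mulr1 addr0 => ->.
  by rewrite mcoeffZ mcoeffX (inj_eq expo_inj) (negPf ji) mulr0.
move=> a; have := congr1 (meval a) mon0; rewrite meval0 => e; rewrite -[RHS]e !raddf_sum /=;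
  apply: eq_bigr => i _.
rewrite !mevalZ mevalX; congr (_ * _); rewrite rmorph_prod; apply: eq_bigr => j _.
by rewrite mnmE rmorphXn.
Qed.

Lemma specialization_size c (P : {mpoly K[c]}) (s : 'I_c) : exists D, forall b : 'I_c -> K,
  exists2 q : {poly K}, (size q <= D)%N &
    forall t, q.[t] = P.@[fun i => if i == s then t else b i].
Proof.
elim/mpoly_closure: P => [a|i|p q [D Dp] [D' Dq]|p q [D Dp] [D' Dq]].
- by exists 1%N => b; exists a%:P => [|t]; rewrite ?size_polyC_leq1 // hornerC mevalC.
- exists 2 => b; case: (eqVneq i s) => [e|ne].
    by exists 'X => [|t]; rewrite ?size_polyX // hornerX mevalXU e eqxx.
  exists (b i)%:P => [|t]; first by apply: leq_trans (size_polyC_leq1 _) _.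
  by rewrite hornerC mevalXU (negPf ne).
- exists (maxn D D') => b; have [[p' sp pE] [q' sq qE]] := (Dp b, Dq b).
  exists (p' + q') => [|t]; last by rewrite hornerD mevalD pE qE.
  by apply: leq_trans (size_polyD _ _) _; rewrite geq_max !leq_max sp sq orbT.
- exists (D + D')%N => b; have [[p' sp pE] [q' sq qE]] := (Dp b, Dq b).
  exists (p' * q') => [|t]; last by rewrite hornerM mevalM pE qE.
  by apply: leq_trans (size_polyMleq _ _) _; lia.
Qed.

End Dependence.

Lemma finite_roots (K : closedFieldType) (q : {poly K}) : q != 0 ->
  exists2 s : seq K, (size s <= size q)%N & forall t, q.[t] = 0 -> t \in s.
Proof.
move=> q0; have [s qs] := closed_field_poly_normal q; exists s.
  rewrite qs size_scale ?lead_coef_eq0 // size_prod_XsubC; exact: leqnSn.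
move=> t /eqP; rewrite qs hornerZ mulf_eq0 lead_coef_eq0 (negPf q0) /=.
by rewrite -[_ == 0]/(root _ t) root_prod_XsubC.
Qed.

(** A relation [P] between the [u i] and [h] becomes, for fixed [b], an equation in one variable
    satisfied by [h] on the fiber over [b]. A point [a] where [P] is nonzero provides a last
    coordinate at which this equation is generically nontrivial, and [specialization_size] bounds
    its degree independently of [b]. *)
Lemma generically_finite_values (R : realType) k (h : {mpoly R[i]%C[k]})
    (u : 'I_k -> {mpoly R[i]%C[k]}) :
  exists D, generically (fun b : 'rV[R[i]%C]_k => exists2 s : seq R[i]%C, (size s <= D)%N &
    forall z : 'I_k -> R[i]%C, (forall i, (u i).@[z] = b 0 i) -> h.@[z] \in s).
Proof.
pose f (i : 'I_k.+1) := oapp u h (unlift ord_max i).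
have [P [P0 Pf]] := algebraic_dependence f.
have [D DP] := specialization_size P ord_max.
exists D; have [a Pa] := mpoly_nat_point P0.
pose ext (b : 'I_k -> R[i]%C) (i : 'I_k.+1) := oapp b (a ord_max)%:R (unlift ord_max i).
pose b0 : 'rV[R[i]%C]_k := \row_i (a (lift ord_max i))%:R.
apply: (@generically_imp _ _ (fun b => P.@[ext (b 0)] != 0)); last first.
  apply: (generically_polyfun (b := b0)).
    exists (P \mPo [tuple oapp (fun j : 'I_k =>
      'X_j) (a ord_max)%:R%:MP (unlift ord_max i) | i < k.+1]).
    move=> b; rewrite comp_mpoly_meval; apply: meval_eq => i; rewrite tnth_mktuple /ext.
    by case: (unlift _ _) => [j|] /=; rewrite ?mevalXU ?mevalC.
  rewrite (meval_eq (v2 := fun i => (a i)%:R)) // => i; rewrite /ext.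
  by case: unliftP => [j ->|->] //=; rewrite mxE.
move=> b Pb; have [q qD qE] := DP (ext (b 0)).
have q0 : q != 0.
  apply: contraNneq Pb => q0; rewrite -(horner0 (a ord_max)%:R) -q0 qE.
  by apply/eqP/meval_eq => i; rewrite /ext; case: unliftP => [j ->|->] /=;
    rewrite ?eqxx // eq_sym (negPf (neq_lift _ _)).
have [s sq sP] := finite_roots q0; exists s; first exact: leq_trans qD.
move=> z zu; apply: sP; rewrite qE -[RHS](Pf z); apply: meval_eq => i.
rewrite /ext /f; case: unliftP => [j ->|->] /=; last by rewrite eqxx.
by rewrite eq_sym (negPf (neq_lift _ _)) zu.
Qed.

End FiniteFibers.

(** * Finite sets as lists without repetition *)

Module Cardinals.
Import complex mpoly.
Import Order.TTheory GRing.Theory Num.Theory.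
Local Open Scope card_scope.
Local Open Scope classical_set_scope.
Local Open Scope ring_scope.

Section Cardinals.
Context {T : choiceType}.
Implicit Types (A : set T) (s : seq T).

Lemma card_seq s : uniq s -> [set` s] #= `I_(size s).
Proof.
case: s => [_|x0 s us]; first by rewrite set_nil II0 card_eq00.
have -> : [set` x0 :: s] = nth x0 (x0 :: s) @` `I_(size (x0 :: s)).
  apply/seteqP; split=> [x /= xs|_ [i /= ilt <-]]; last exact: mem_nth.
  by exists (index x (x0 :: s)); [move: xs; rewrite -index_mem | apply: nth_index].
apply: inj_card_eq => i j /set_mem /= ilt /set_mem /= jlt /eqP.
by rewrite nth_uniq // => /eqP.
Qed.

Lemma card_eq_seq A d : A #= `I_d -> exists s, [/\ uniq s, size s = d & A = [set` s]].
Proof.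
move=> Ad; have /finite_seqP[s As] : finite_set A by apply/finite_setP; exists d.
exists (undup s); have e : [set` s] = [set` undup s].
  by apply/seteqP; split=> x /=; rewrite mem_undup.
split=> //; rewrite ?undup_uniq -?e //; apply/esym/card_eq_II.
apply: card_eq_trans (card_seq (undup_uniq s)).
by rewrite -e -As card_eq_sym.
Qed.

Lemma card_lt_seq A d : ~ (`I_d #<= A) -> exists2 s, (size s < d)%N & A = [set` s].
Proof.
move=> nA; have [Af|Ainf] := pselect (finite_set A).
  have /finite_setP[e Ae] := Af; have [s [us se As]] := card_eq_seq Ae.
  exists s => //; rewrite ltnNge; apply/negP => ds; apply: nA.
  apply: (card_le_trans (B := `I_(size s))); first by rewrite card_le_II.
  by rewrite As; have := card_seq us; rewrite card_eq_le => /andP[].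
case: nA; apply: (card_le_trans (B := [set: nat])); last exact/infiniteP.
exact: card_leT.
Qed.

End Cardinals.
End Cardinals.

(** * Generic constancy of the fiber cardinality *)

Module Definability.
Import complex mpoly.
Import Order.TTheory GRing.Theory Num.Theory.
Import Polynomials Tangents Cardinals.
Local Open Scope card_scope.
Local Open Scope classical_set_scope.
Local Open Scope ring_scope.

Section Definable.
Context {K : closedFieldType}.
Implicit Types (P Q : (nat -> K) -> Prop) (s : nat -> K).

(** Predicates take assignments of all variables, so that variables are addressed by position; only
    the finitely supported [nth 0 e] are tested. *)
Definition definable P := exists f : GRing.formula K,
  GRing.rformula f /\ forall e : seq K, P (nth 0 e) <-> GRing.holds e f.

Definition definable_fun (F : (nat -> K) -> K) := exists t : GRing.term K,
  GRing.rterm t /\ forall e : seq K, F (nth 0 e) = GRing.eval e t.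

Lemma definable_fun_algebra : fun_algebra definable_fun.
Proof.
split=> [c|F G [t [rt Ft]] [t' [rt' Gt']]|F G [t [rt Ft]] [t' [rt' Gt']]].
- by exists (GRing.Const c).
- by exists (GRing.Add t t'); split=> [|e]; rewrite /= ?rt ?Ft ?Gt'.
- by exists (GRing.Mul t t'); split=> [|e]; rewrite /= ?rt ?Ft ?Gt'.
Qed.

Lemma definable_var i : definable_fun (fun s => s i).
Proof. by exists (GRing.Var K i). Qed.

Lemma definable_ext P Q : (forall s, P s <-> Q s) -> definable P -> definable Q.
Proof. by move=> PQ [f [rf Pf]]; exists f; split=> // e; rewrite -PQ. Qed.

Lemma definable_eq F G : definable_fun F -> definable_fun G ->
  definable (fun s => F s = G s).
Proof.
move=> [t [rt Ft]] [t' [rt' Gt']]; exists (GRing.Equal t t').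
by split=> [|e]; rewrite /= ?rt ?Ft ?Gt'.
Qed.

Lemma definable_not P : definable P -> definable (fun s => ~ P s).
Proof. by move=> [f [rf Pf]]; exists (GRing.Not f); split=> // e /=; rewrite Pf. Qed.

Lemma definable_and P Q : definable P -> definable Q -> definable (fun s => P s /\ Q s).
Proof.
move=> [f [rf Pf]] [g [rg Qg]]; exists (GRing.And f g).
by split=> [|e]; rewrite /= ?rf ?Pf ?Qg.
Qed.

Lemma definable_true : definable (fun=> True).
Proof. by exists (GRing.Bool true). Qed.

Lemma definable_all (I : finType) (P : I -> (nat -> K) -> Prop) :
  (forall i, definable (P i)) -> definable (fun s => forall i, P i s).
Proof.
move=> dP; suff : definable (fun s => forall i, i \in enum I -> P i s).
  by apply: definable_ext => s; split=> H i; [apply: H; rewrite mem_enum | ].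
elim: (enum I) => [|i r IH]; first by apply: definable_ext definable_true.
apply: definable_ext (definable_and (dP i) IH) => s; split.
  by move=> [Pi Pr] j; rewrite inE => /orP[/eqP ->|/Pr].
move=> H; split; first by apply: H; rewrite mem_head.
by move=> j jr; apply: H; rewrite inE jr orbT.
Qed.

Lemma definable_eq0_mx p q (A : (nat -> K) -> 'M[K]_(p, q)) :
  entries definable_fun A -> definable (fun s => A s = 0).
Proof.
move=> dA; have d0 : definable_fun (fun=> 0) by case: definable_fun_algebra.
apply: definable_ext (definable_all (fun i => definable_all (fun j =>
  definable_eq (dA i j) d0))) => s.
by split=> [H|->] => [|i j]; [apply/matrixP => i j; rewrite mxE; apply: H | rewrite mxE].
Qed.

Lemma definable_ex P i :
  definable P -> definable (fun s => exists x, P (fun j => if j == i then x else s j)).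
Proof.
move=> [f [rf Pf]]; exists (GRing.Exists i f); split=> // e /=.
have E x : (fun j => if j == i then x else e`_j) = nth 0 (set_nth 0 e i x).
  by apply/funext => j; rewrite nth_set_nth.
by split=> -[x]; exists x; [apply/Pf; rewrite -E | rewrite E; apply/Pf].
Qed.

Lemma definable_ex_block P k n : definable P ->
  definable (fun s => exists z : nat -> K,
    P (fun i => if (k <= i < k + n)%N then z i else s i)).
Proof.
elim: n P => [|n IH] P dP.
  apply: definable_ext dP => s.
  have E z : (fun i => if (k <= i < k + 0)%N then z i else s i) = s.
    by apply/funext => i; case: ifP => //; rewrite addn0; lia.
  by split=> [Ps|[z]]; [exists s; rewrite E | rewrite E].
apply: definable_ext (IH _ (definable_ex (k + n) dP)) => s; split=> [[z [x Px]]|[z Pz]].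
  exists (fun i => if i == (k + n)%N then x else z i).
  rewrite (_ : (fun i => _) = (fun j => if j == (k + n)%N then x else
    (if (k <= j < k + n)%N then z j else s j))) //.
  apply/funext => i; case: eqVneq => [->|ne]; first by rewrite leq_addr addnS ltnSn.
  by congr (if _ then _ else _); lia.
exists z, (z (k + n)%N); rewrite (_ : (fun i => _) =
  (fun i => if (k <= i < k + n.+1)%N then z i else s i)) //.
apply/funext => i; case: eqVneq => [->|ne]; first by rewrite leq_addr addnS ltnSn.
by congr (if _ then _ else _); lia.
Qed.

Definition env k (a : 'rV[K]_k) : nat -> K := nth 0 [seq a 0 i | i <- enum 'I_k].

Lemma envE k (a : 'rV[K]_k) (i : 'I_k) : env a i = a 0 i.
Proof. by rewrite /env (nth_map i) ?size_enum_ord // nth_ord_enum. Qed.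

Lemma env_row k (a : 'rV[K]_k) : \row_(i < k) env a i = a.
Proof. by apply/rowP => i; rewrite mxE envE. Qed.

(* By quantifier elimination over an algebraically closed field. *)
Lemma generically_decided k P : definable P ->
  generically (fun a : 'rV[K]_k => P (env a)) \/
  generically (fun a : 'rV[K]_k => ~ P (env a)).
Proof.
move=> [f [rf Pf]].
pose e (a : 'rV[K]_k) := [seq a 0 i | i <- enum 'I_k].
have okE := ClosedFieldQE.holds_ex_elim (@solve_monicpoly K).
have wfE := @ClosedFieldQE.wf_ex_elim K.
have /andP[qff rff] := GRing.quantifier_elim_wf wfE rf.
have decP a := GRing.quantifier_elim_rformP wfE okE (e a) rf.
set g := GRing.quantifier_elim _ f in qff rff decP.
(* In a quantifier-free formula, an equation between polynomials is either an identity or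
   generically false, and Boolean operations preserve having a generic truth value. *)
suff [[] gb] : exists b, generically (fun a : 'rV[K]_k => GRing.qf_eval (e a) g = b).
- by left; apply: generically_imp gb => a /decP /Pf.
- by right; apply: generically_imp gb => a ga /Pf /decP; rewrite ga.
have term_poly t : GRing.rterm t -> polyfun (fun a : 'rV[K]_k => GRing.eval (e a) t).
  have [Pc Pa Pm] := @polyfun_algebra K k.
  elim: t => //= [i _|t IH t' IH' /andP[/IH ? /IH' ?]|t IH /IH Pt|t IH n /IH Pt|
      t IH t' IH' /andP[/IH ? /IH' ?]|t IH n /IH Pt].
  - have [ik|ki] := ltnP i k; last first.
      by apply: fun_algebra_ext (Pc 0) => a; rewrite nth_default // size_map size_enum_ord.
    apply: fun_algebra_ext (@polyfun_id K k 0 (Ordinal ik)) => a /=.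
    by rewrite -[RHS]/(env a (Ordinal ik)) envE.
  - exact: Pa.
  - by apply: fun_algebra_ext (Pm _ _ (Pc (-1)) Pt) => a; rewrite mulN1r.
  - by apply: fun_algebra_ext (Pm _ _ (Pc n%:R) Pt) => a; rewrite mulr_natl.
  - exact: Pm.
  - elim: n => [|n IHn]; first by apply: fun_algebra_ext (Pc 1).
    by apply: fun_algebra_ext (Pm _ _ Pt IHn) => a; rewrite exprS.
have triv (b : 'rV[K]_k -> bool) c : (forall a, b a = c) -> generically (fun a => b a = c).
  by move=> bc; exists 1; split=> //; apply: oner_neq0.
elim: (g) qff rff => //= [b _ _|t t' _ /andP[rt rt']|f1 IH1 f2 IH2|f1 IH1 f2 IH2|
  f1 IH1 f2 IH2|f1 IH1].
- by exists b; apply: triv.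
- have [Pc Pa Pm] := @polyfun_algebra K k.
  have [h hP] := Pa _ _ (term_poly t rt) (Pm _ _ (Pc (-1)) (term_poly t' rt')).
  have tt' a : (GRing.eval (e a) t == GRing.eval (e a) t') = (h.@[a 0] == 0).
    by rewrite -hP mulN1r subr_eq0.
  have [h0|h0] := eqVneq h 0.
    by exists true; apply: triv => a; rewrite tt' h0 meval0 eqxx.
  by exists false, h; split=> // a ha; rewrite tt' (negPf ha).
- move=> /andP[/IH1 H1 /IH2 H2] /andP[/H1[b gb] /H2[b' gb']]; exists (b && b').
  by apply: generically_imp (generically_and gb gb') => a [-> ->].
- move=> /andP[/IH1 H1 /IH2 H2] /andP[/H1[b gb] /H2[b' gb']]; exists (b || b').
  by apply: generically_imp (generically_and gb gb') => a [-> ->].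
- move=> /andP[/IH1 H1 /IH2 H2] /andP[/H1[b gb] /H2[b' gb']]; exists (b ==> b').
  by apply: generically_imp (generically_and gb gb') => a [-> ->].
- move=> /IH1 H1 /H1[b gb]; exists (~~ b).
  by apply: generically_imp gb => a ->.
Qed.

End Definable.

(** Having at least [d] points in the fiber is definable, hence generically true or generically
    false. The generic cardinality is the largest [d] for which it is generically true, which exists
    thanks to [D]. *)
Lemma generic_fiber_card (K : numClosedFieldType) k (C : 'rV[K]_k -> 'rV[K]_k -> Prop) D :
  (forall o o' : nat, definable (fun s : nat -> K =>
     C (\row_(i < k) s (o + i)%N) (\row_(i < k) s (o' + i)%N))) ->
  generically (fun u => forall s : seq 'rV[K]_k, uniq s -> (forall x, x \in s -> C u x) ->
     (size s <= D)%N) ->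
  exists d, generically (fun u => [set x | C u x] #= `I_d).
Proof.
move=> dC bd.
pose at_least d u := exists s : seq 'rV[K]_k, [/\ uniq s, size s = d & forall x, x \in s -> C u x].
have defP d : definable (fun s : nat -> K => at_least d (\row_(i < k) s i)).
  (* Layout of the variables: [u] occupies those below [k], the point number [l] the [k] ones
     starting at [k + l * k]. *)
  pose pt (s : nat -> K) (l : nat) := \row_(i < k) s ((k + l * k) + i)%N.
  pose body (s : nat -> K) := (forall l : 'I_d, C (\row_(i < k) s (0 + i)%N) (pt s l)) /\
    forall l l' : 'I_d, l = l' \/ ~ (pt s l - pt s l' = 0).
  have db : definable body.
    apply: definable_and; first by apply: definable_all => l; apply: dC.
    apply: definable_all => l; apply: definable_all => l'.
    have [->|ll'] := eqVneq l l'.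
      by apply: definable_ext definable_true => s; split=> // _; left.
    apply: (@definable_ext _ (fun s => ~ (pt s l - pt s l' = 0))) => [s|].
      by split=> [h|[/eqP|//]]; [right | rewrite (negPf ll')].
    have epts l0 : entries definable_fun (fun s => pt s l0).
      move=> i j; apply: fun_algebra_ext (definable_var (k + l0 * k + j)%N) => s.
      by rewrite mxE.
    apply/definable_not/definable_eq0_mx/(entriesD definable_fun_algebra) => //.
    exact: (entriesN definable_fun_algebra).
  apply: definable_ext (definable_ex_block k (d * k) db) => s.
  have base z : \row_(i < k) (if (k <= 0 + i < k + d * k)%N then z (0 + i)%N else s (0 + i)%N)
      = \row_(i < k) s i :> 'rV[K]_k.
    by apply/rowP => i; rewrite !mxE add0n leqNgt ltn_ord.
  have blk z (l : 'I_d) : pt (fun i => if (k <= i < k + d * k)%N then z i else s i) l = pt z l.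
    apply/rowP => i; rewrite !mxE ifT //; have := ltn_ord i; have := ltn_ord l.
    by move: (nat_of_ord l) (nat_of_ord i) => a b; nia.
  split=> [[z [zC zinj]]|[r [ur sr rC]]].
    exists [seq pt z l | l : 'I_d <- enum 'I_d]; split.
    - rewrite map_inj_in_uniq ?enum_uniq // => l l' _ _ e.
      by case: (zinj l l') => // -[]; rewrite !blk e subrr.
    - by rewrite size_map size_enum_ord.
    - by move=> x /mapP[l _ ->]; have := zC l; rewrite base blk.
  pose z (i : nat) : K := oapp (fun j => nth 0 r ((i - k) %/ k) 0 j) 0
    (insub ((i - k) %% k)%N : option 'I_k).
  exists z.
  have ptz (l : 'I_d) : pt z l = nth 0 r l.
    apply/rowP => i; rewrite mxE /z.
    have -> : (k + l * k + i - k = l * k + i)%N by lia.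
    have k0 : (0 < k)%N by apply: leq_trans (ltn_ord i).
    rewrite modnMDl divnMDl // divn_small // addn0 modn_small //.
    by rewrite valK.
  split=> [l|l l']; first by rewrite base blk ptz; apply: rC; rewrite mem_nth // sr.
  rewrite !blk !ptz; have [->|ll'] := eqVneq l l'; [by left | right].
  by move/eqP; rewrite subr_eq0 nth_uniq ?sr // => /eqP/val_inj/eqP; rewrite (negPf ll').
have dec d : generically (at_least d) \/ generically (fun u => ~ at_least d u).
  by have [g|g] := generically_decided k (defP d); [left|right];
     apply: generically_imp g => u; rewrite env_row.
have g0 : exists d, `[< generically (at_least d) >].
  exists 0%N; apply/asboolP; exists 1; split=> [|u _]; first exact: oner_neq0.
  by exists [::].
have gD d : `[< generically (at_least d) >] -> (d <= D)%N.
  move=> /asboolP gd; have [u [[s [us <- sC]] h]] := generically_ex (generically_and gd bd).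
  exact: h.
case: (ex_maxnP g0 gD) => d /asboolP gd dmax.
have gd1 : generically (fun u => ~ at_least d.+1 u).
  case: (dec d.+1) => // /asboolP /dmax; by rewrite ltnn.
exists d; apply: generically_imp (generically_and gd gd1) => u [[s [us sd sC]] nd].
rewrite -sd (_ : [set x | C u x] = [set` s]); first exact: card_seq.
apply/seteqP; split=> x /=; last exact: sC.
move=> Cx; apply: contraT => xs; case: nd; exists (x :: s); split; rewrite /= ?xs ?sd //.
by move=> y; rewrite inE => /orP[/eqP ->|/sC].
Qed.

End Definability.

(** * The Segre cone, its equations and its tangent spaces *)

Module Segre.
Import complex mpoly.
Import Order.TTheory GRing.Theory Num.Theory.
Import Polynomials Tangents.
Local Open Scope classical_set_scope.
Local Open Scope ring_scope.

Section RankOne.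
Context {K : fieldType} {m n : nat}.
Implicit Types (X V W : 'M[K]_(m, n)) (x a : 'cV[K]_m) (y b : 'rV[K]_n).

Lemma cV0Pn x : reflect (exists i, x i 0 != 0) (x != 0).
Proof.
apply: (iffP idP) => [|[i xi]]; last by apply: contraNneq xi => ->; rewrite mxE.
by move=> /matrix0Pn[i [j]]; rewrite (ord1 j); exists i.
Qed.

Lemma mul_colrow_eq0 x y : (x *m y == 0) = (x == 0) || (y == 0).
Proof.
apply/eqP/orP => [e|[] /eqP ->]; rewrite ?mul0mx ?mulmx0 //.
have [_|/cV0Pn[i xi]] := eqVneq x 0; [by left | right].
apply/eqP/rowP => j; have := congr1 (fun A : 'M_(m, n) => A i j) e.
by rewrite !mxE big_ord1 => /eqP; rewrite mulf_eq0 (negPf xi) => /eqP.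
Qed.

Lemma colrowE x y i j : (x *m y) i j = x i 0 * y 0 j.
Proof. by rewrite mxE big_ord1. Qed.

Definition minors_vanish X := forall i k j l, X i j * X k l - X i l * X k j = 0.

Lemma segre_minors X : segre_cone K m n X -> minors_vanish X.
Proof. by move=> [x _ [y _ <-]] i k j l; rewrite !colrowE; ring. Qed.

Lemma minors_factor X i j : minors_vanish X -> X i j != 0 ->
  X = ((X i j)^-1 *: col j X) *m row i X.
Proof.
move=> mX Xij; apply/matrixP => k l; rewrite colrowE !mxE.
have /eqP := mX i k j l; rewrite subr_eq0 => /eqP e.
by apply: (mulfI Xij); rewrite e; field.
Qed.

Lemma minors_segre X : minors_vanish X -> segre_cone K m n X.
Proof.
move=> mX; have [->|/matrix0Pn[i [j Xij]]] := eqVneq X 0.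
  by exists 0 => //; exists 0; rewrite ?mulmx0.
by exists ((X i j)^-1 *: col j X) => //; exists (row i X); rewrite -?minors_factor.
Qed.

Lemma segreP X : segre_cone K m n X -> X != 0 ->
  exists x y, [/\ x != 0, y != 0 & X = x *m y].
Proof.
move=> [x _ [y _ <-]]; rewrite mul_colrow_eq0 negb_or => /andP[x0 y0].
by exists x, y.
Qed.

Definition fr (A B : 'M[K]_(m, n)) : K := (mxvec A *m (mxvec B)^T) 0 0.

Lemma frE A B : fr A B = \sum_i \sum_j A i j * B i j.
Proof.
rewrite /fr mxE pair_big (reindex _ (curry_mxvec_bij _ _)) /=.
by apply: eq_bigr => -[i j] _; rewrite mxE !mxvecE.
Qed.

Lemma fr_sym A B : fr A B = fr B A.
Proof. by rewrite !frE; apply: eq_bigr => i _; apply: eq_bigr => j _; rewrite mulrC. Qed.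

Lemma frDl A B D : fr (A + B) D = fr A D + fr B D.
Proof. by rewrite /fr linearD mulmxDl mxE. Qed.

Lemma frDr A B D : fr D (A + B) = fr D A + fr D B.
Proof. by rewrite fr_sym frDl !(fr_sym D). Qed.

Lemma frZl c A B : fr (c *: A) B = c * fr A B.
Proof. by rewrite /fr linearZ -scalemxAl mxE. Qed.

Lemma frNl A B : fr (- A) B = - fr A B.
Proof. by rewrite -scaleN1r frZl mulN1r. Qed.

Lemma frZr c A B : fr B (c *: A) = c * fr B A.
Proof. by rewrite fr_sym frZl fr_sym. Qed.

Lemma fr_delta A i j : fr A (delta_mx i j) = A i j.
Proof.
rewrite frE (bigD1 i) //= (bigD1 j) //= mxE !eqxx mulr1 !big1 ?addr0 //.
  move=> k ki; rewrite big1 // => l _; rewrite mxE (negPf ki) mulr0 //.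
by move=> l lj; rewrite mxE (negPf lj) andbF mulr0.
Qed.

Lemma fr_colrow W x y : fr W (x *m y) = (x^T *m W *m y^T) 0 0.
Proof.
rewrite frE mxE exchange_big; apply: eq_bigr => j _; rewrite [in RHS]mxE mulr_suml.
by apply: eq_bigr => i _; rewrite colrowE !mxE; ring.
Qed.

Lemma fr_colrow_l W x : (forall b, fr W (x *m b) = 0) <-> x^T *m W = 0.
Proof.
split=> [H|H b]; last by rewrite fr_colrow H mul0mx mxE.
apply/rowP => j; rewrite [RHS]mxE -(H (delta_mx 0 j)) fr_colrow.
by rewrite trmx_delta -colE [RHS]mxE.
Qed.

Lemma fr_colrow_r W y : (forall a, fr W (a *m y) = 0) <-> W *m y^T = 0.
Proof.
split=> [H|H a]; last by rewrite fr_colrow -mulmxA H mulmx0 mxE.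
apply/matrixP => i j; rewrite (ord1 j) [RHS]mxE -(H (delta_mx i 0)) fr_colrow.
by rewrite trmx_delta -mulmxA -rowE [RHS]mxE.
Qed.

Lemma mul_tr_colrow x y W : y != 0 -> (x *m y)^T *m W = 0 <-> x^T *m W = 0.
Proof.
move=> y0; rewrite trmx_mul -mulmxA; split=> [e|->]; last by rewrite mulmx0.
apply/rowP => l; have [j yj] := rV0Pn _ y0.
have := congr1 (fun A : 'M_(n, n) => A j l) e; rewrite !mxE big_ord1 !mxE => /eqP.
by rewrite mulf_eq0 (negPf yj) => /eqP.
Qed.

Lemma mul_colrow_tr x y W : x != 0 -> W *m (x *m y)^T = 0 <-> W *m y^T = 0.
Proof.
move=> x0; rewrite trmx_mul mulmxA; split=> [e|->]; last by rewrite mul0mx.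
apply/matrixP => l z; rewrite (ord1 z) {z}; have [j xj] := cV0Pn _ x0.
have := congr1 (fun A : 'M_(m, m) => A l j) e; rewrite !mxE big_ord1 !mxE => /eqP.
by rewrite mulf_eq0 (negPf xj) orbF => /eqP.
Qed.

End RankOne.

Section Cone.
Context {K : numFieldType} {m n : nat}.
Implicit Types (X V W : 'M[K]_(m, n)) (x a : 'cV[K]_m) (y b : 'rV[K]_n).

Let cone : set 'rV[K]_(m * n) := mxvec @` segre_cone K m n.

Lemma cone_mxvec X : cone (mxvec X) <-> segre_cone K m n X.
Proof.
split=> [[Y CY /(can_inj mxvecK) <-] //|CX]; by exists X.
Qed.

Definition tangent_factor x y V := exists a b, V = a *m y + x *m b.

Definition linear_minor X V i k j l :=
  V i j * X k l + X i j * V k l - (V i l * X k j + X i l * V k j).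

Lemma curve_minor (F : K -> 'M[K]_(m, n)) V i k j l : curvem F V ->
  curve (fun t => F t i j * F t k l - F t i l * F t k j) (linear_minor (F 0) V i k j l).
Proof.
move=> cl; have := curveD (curveM (cl i j) (cl k l))
  (curveM (curve_cst (-1)) (curveM (cl i l) (cl k j))).
by apply: curve_ext => [t|]; rewrite /linear_minor; ring.
Qed.

Lemma linear_minor_factor x y V : x != 0 -> y != 0 ->
  (forall i k j l, linear_minor (x *m y) V i k j l = 0) -> tangent_factor x y V.
Proof.
move=> x0 y0 eqV; have [i xi] := cV0Pn _ x0; have [j yj] := rV0Pn _ y0.
(* The solution [(a, b)] is determined up to adding [(c x, - c y)]; it is normalized by
   [a i 0 = 0]. *)
exists (\col_k (V k j / y 0 j - V i j * x k 0 / (x i 0 * y 0 j))), (\row_l (V i l / x i 0)).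
apply/matrixP => k l; rewrite mxE !colrowE !mxE.
have xy : x i 0 * y 0 j != 0 by rewrite mulf_neq0.
apply: (mulfI xy); have /eqP := eqV i k j l; rewrite /linear_minor !colrowE subr_eq0 => /eqP e.
transitivity (V i l * (x k 0 * y 0 j) + x i 0 * y 0 l * V k j - V i j * (x k 0 * y 0 l)).
  by rewrite -e; ring.
by field; rewrite xi yj.
Qed.

Lemma tangent_cone x y V : x != 0 -> y != 0 ->
  tangent cone (mxvec (x *m y)) (mxvec V) <-> tangent_factor x y V.
Proof.
move=> x0 y0; split; last first.
  move=> [a [b ->]].
  have cv := curvem_mxvec (curvemM (curvem_line x a) (curvem_line y b)).
  have := curve_tangent cv (curve_cst 1) (oner_neq0 _) (X := cone).
  rewrite !scale0r !addr0; apply => t _; apply/cone_mxvec.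
  by exists (x + t *: a) => //; exists (y + t *: b).
move=> TV; apply: linear_minor_factor => // i k j l.
pose f (z : 'rV[K]_(m * n)) := vec_mx z i j * vec_mx z k l - vec_mx z i l * vec_mx z k j.
apply: (@tangent_derivative _ _ cone f _ (mxvec V) _ _ _ _ TV).
- have [Pc Pa Pm] := @polyfun_algebra K (m * n).
  have e := entries_vec (@polyfun_id K (m * n)).
  apply: fun_algebra_ext (Pa _ _ (Pm _ _ (e i j) (e k l))
    (Pm _ _ (Pc (-1)) (Pm _ _ (e i l) (e k j)))) => z.
  by rewrite mulN1r.
- by move=> z [Y /segre_minors mY <-]; rewrite /f mxvecK mY.
- have := curve_minor i k j l (curvem_vec (curvem_line (mxvec (x *m y)) (mxvec V))).
  by rewrite scale0r addr0 !mxvecK.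
Qed.

(** The lines through 0 along the matrix units lie in the cone and span the whole space. *)
Lemma tangent_cone0 V : tangent cone 0 (mxvec V).
Proof.
rewrite tangentE => p Cp; rewrite [V]matrix_sum_delta linear_sum mulmx_suml.
apply: big1 => i _; rewrite linear_sum mulmx_suml; apply: big1 => j _.
rewrite linearZ -scalemxAl.
suff : tangent cone 0 (mxvec (delta_mx i j)).
  by rewrite tangentE => /(_ _ Cp) ->; rewrite scaler0.
have cv := curvem_mxvec (curvem_line 0 (delta_mx i j : 'M[K]_(m, n))).
have := curve_tangent cv (curve_cst 1) (oner_neq0 _) (X := cone).
rewrite scale0r addr0 linear0; apply => t _; apply/cone_mxvec.
exists (t *: delta_mx i 0) => //; exists (delta_mx 0 j) => //.
by rewrite add0r -scalemxAl mul_delta_mx.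
Qed.

Definition param_mx x y : 'M[K]_(m + n, m * n) :=
  col_mx (lin1_mx (mxvec \o (mulmxr y \o trmx))) (lin1_mx (mxvec \o mulmx x)).

Lemma param_mxE x y (a : 'rV[K]_m) b :
  row_mx a b *m param_mx x y = mxvec (a^T *m y + x *m b).
Proof. by rewrite mul_row_col !mul_rV_lin1 /= linearD. Qed.

(** The m + n parameters of the product map lose one dimension: the kernel of the differential is
    the line of [(x, - y)], which comes from rescaling the factors. *)
Lemma lindim_tangent_cone x y : x != 0 -> y != 0 ->
  lindim (tangent cone (mxvec (x *m y))) = (m + n).-1.
Proof.
move=> x0 y0.
have -> : tangent cone (mxvec (x *m y)) = [set v | (v <= param_mx x y)%MS].
  apply/seteqP; split=> v /=.
    rewrite -{1}[v]vec_mxK; case/(iffLR (tangent_cone _ x0 y0)) => a [b e]; apply/submxP;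
      exists (row_mx a^T b).
    by rewrite param_mxE trmxK -e vec_mxK.
  move=> /submxP[u e]; rewrite -[v]vec_mxK; apply/(iffRL (tangent_cone _ x0 y0)).
  exists (lsubmx u)^T, (rsubmx u); apply: (can_inj mxvecK).
  by rewrite vec_mxK -param_mxE hsubmxK.
rewrite lindim_row_space; have := mxrank_ker (param_mx x y).
suff -> : \rank (kermx (param_mx x y)) = 1%N by have := rank_leq_row (param_mx x y); lia.
pose z := row_mx x^T (- y).
have z0 : z != 0.
  apply: contraNneq x0 => z0; apply/eqP/trmx_inj; rewrite trmx0.
  by have := row_mxKl x^T (- y); rewrite -/z z0 linear0.
have zk : (z <= kermx (param_mx x y))%MS.
  by apply/sub_kermxP; rewrite param_mxE trmxK mulmxN subrr linear0.
apply/eqP; rewrite eqn_leq; apply/andP; split; last first.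
  by have := mxrankS zk; rewrite rank_rV z0.
suff /mxrankS : (kermx (param_mx x y) <= z)%MS by rewrite rank_rV z0.
apply/rV_subP => u /sub_kermxP; rewrite -[u]hsubmxK param_mxE.
move: (lsubmx u) (rsubmx u) => {u} a b /(congr1 vec_mx); rewrite mxvecK linear0 => e.
have [j yj] := rV0Pn _ y0.
have ek k l : a 0 k * y 0 l + x k 0 * b 0 l = 0.
  by have := congr1 (fun A : 'M_(m, n) => A k l) e; rewrite !mxE !big_ord1 !mxE.
pose c := - b 0 j / y 0 j.
have ax : a = c *: x^T.
  apply/rowP => k; rewrite !mxE; apply: (mulIf yj).
  have /eqP := ek k j; rewrite addr_eq0 => /eqP ->; rewrite /c; by field.
have [i xi] := cV0Pn _ x0.
have by_ : b = - c *: y.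
  apply/rowP => l; rewrite !mxE; apply: (mulfI xi).
  have := ek i l; rewrite ax !mxE => h.
  by apply/eqP; rewrite -subr_eq0 -h; apply/eqP; ring.
by apply/sub_rVP; exists c; rewrite ax by_ scale_row_mx scaleNr scalerN.
Qed.

Lemma lindim_tangent_cone0 : lindim (tangent cone 0) = (m * n)%N.
Proof.
rewrite -[RHS](mxrank1 K) -lindim_row_space; congr lindim.
apply/seteqP; split=> v _; first exact: submx1.
by rewrite -[v]vec_mxK; apply: tangent_cone0.
Qed.

Lemma cone_smooth_neq0 X : segre_cone K m n X -> X != 0 -> smooth_point cone (mxvec X).
Proof.
move=> CX X0; split; first exact/cone_mxvec.
move=> _ [Y CY <-]; have [x [y [x0 y0 ->]]] := segreP CX X0.
rewrite lindim_tangent_cone //; have [->|Y0] := eqVneq Y 0.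
  rewrite linear0 lindim_tangent_cone0.
  have [[i _] [j _]] := (cV0Pn _ x0, rV0Pn _ y0).
  case: (m) i => [[]//|m' _]; case: (n) j => [[]//|n' _]; nia.
by have [x' [y' [x'0 y'0 ->]]] := segreP CY Y0; rewrite lindim_tangent_cone.
Qed.

(** The tangent space at the vertex has dimension m n, against m + n - 1 elsewhere, and the
    difference (m - 1) (n - 1) is positive unless one factor is a line. *)
Lemma vertex_smooth : (0 < m)%N -> (0 < n)%N -> smooth_point cone 0 -> (minn m n <= 1)%N.
Proof.
move=> m0 n0 [_]; pose x : 'cV[K]_m := const_mx 1; pose y : 'rV[K]_n := const_mx 1.
move=> /(_ (mxvec (x *m y))).
have x0 : x != 0.
  by apply/cV0Pn; exists (Ordinal m0); rewrite mxE oner_neq0.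
have y0 : y != 0.
  by apply/rV0Pn; exists (Ordinal n0); rewrite mxE oner_neq0.
rewrite lindim_tangent_cone0 lindim_tangent_cone // => H.
have /H : cone (mxvec (x *m y)) by apply/cone_mxvec; exists x => //; exists y.
case: (m) m0 => [//|m' _]; case: (n) n0 => [//|n' _]; rewrite geq_min; nia.
Qed.

End Cone.
End Segre.

(** * Equations and fibers of the ED correspondence *)

Module EDTheory.
Import complex mpoly.
Import Order.TTheory GRing.Theory Num.Theory.
Import Polynomials Tangents Segre.
Local Open Scope classical_set_scope.
Local Open Scope ring_scope.

Section GramMap.
Context {K : fieldType} {m n : nat}.
Implicit Types (L : 'M[K]_(m * n)) (X Y : 'M[K]_(m, n)).

Definition gmap L X : 'M[K]_(m, n) := vec_mx (mxvec X *m L).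

Lemma gmapD L X Y : gmap L (X + Y) = gmap L X + gmap L Y.
Proof. by rewrite /gmap linearD mulmxDl linearD. Qed.

Lemma gmapZ L a X : gmap L (a *: X) = a *: gmap L X.
Proof. by rewrite /gmap linearZ -scalemxAl linearZ. Qed.

Lemma gmapN L X : gmap L (- X) = - gmap L X.
Proof. by rewrite /gmap linearN mulNmx linearN. Qed.

Lemma gmapB L X Y : gmap L (X - Y) = gmap L X - gmap L Y.
Proof. by rewrite gmapD gmapN. Qed.

Lemma gmap0 L : gmap L 0 = 0.
Proof. by rewrite /gmap linear0 mul0mx linear0. Qed.

Lemma gmapK L X : L \in unitmx -> gmap (invmx L) (gmap L X) = X.
Proof. by move=> uL; rewrite /gmap vec_mxK mulmxK // mxvecK. Qed.

Lemma gmapVK L X : L \in unitmx -> gmap L (gmap (invmx L) X) = X.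
Proof. by move=> uL; rewrite /gmap vec_mxK mulmxKV // mxvecK. Qed.

Lemma gmap_sym L X Y : L^T = L -> fr (gmap L X) Y = fr (gmap L Y) X.
Proof.
move=> Ls; rewrite /fr !vec_mxK -[LHS]trace_mx11 -mxtrace_tr trace_mx11.
by rewrite !trmx_mul trmxK Ls mulmxA.
Qed.

Lemma entries_gmap (T : Type) (P : (T -> K) -> Prop) (F : T -> 'M[K]_(m, n)) L :
  fun_algebra P -> entries P F -> entries P (fun t => gmap L (F t)).
Proof.
move=> PA PF; apply: entries_vec; apply: (entriesM PA); first exact: entries_mxvec.
exact: (entries_cst PA).
Qed.

End GramMap.

Lemma curvem_gmap (K : numFieldType) m n (L : 'M[K]_(m * n)) F D :
  curvem F D -> curvem (fun t => gmap L (F t)) (gmap L D).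
Proof.
move=> FD; apply: curvem_vec.
have := curvemM (curvem_mxvec FD) (curvem_cst L).
by rewrite mulmx0 addr0.
Qed.

Section InnerProduct.
Context {R : realType} {m n : nat} (Q : inner_product 'M[R]_(m, n)).

Lemma inner_sym X Y : Q X Y = Q Y X.
Proof. by rewrite hermC /= expr0 mul1r. Qed.

Lemma innerD X Y Z : Q (X + Y) Z = Q X Z + Q Y Z.
Proof. by rewrite -[X]scale1r linearPl scale1r /= mul1r. Qed.

Lemma inner0 Z : Q 0 Z = 0.
Proof. by have := innerD 0 0 Z; rewrite addr0; lra. Qed.

Lemma innerZ a X Z : Q (a *: X) Z = a * Q X Z.
Proof.
have : Q (a *: X + 0) Z = a * Q X Z + Q 0 Z by rewrite linearPl.
by rewrite addr0 inner0 addr0.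
Qed.

Lemma inner_gt0 X : X != 0 -> 0 < Q X X.
Proof. exact: neq0_dnorm_gt0. Qed.

Definition gram_mx : 'M[R]_(m * n) :=
  \matrix_(k, l) Q (vec_mx (delta_mx 0 k)) (vec_mx (delta_mx 0 l)).

Lemma inner_suml (I : Type) (r : seq I) (F : I -> 'M[R]_(m, n)) Y :
  Q (\sum_(i <- r) F i) Y = \sum_(i <- r) Q (F i) Y.
Proof.
elim: r => [|i r IH]; first by rewrite !big_nil inner0.
by rewrite !big_cons innerD IH.
Qed.

Lemma inner_gmap X Y : Q X Y = fr (gmap gram_mx X) Y.
Proof.
have expand Z : Z = \sum_k mxvec Z 0 k *: vec_mx (delta_mx 0 k) :> 'M[R]_(m, n).
  rewrite -{1}[Z]mxvecK {1}[mxvec Z]row_sum_delta linear_sum.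
  by apply: eq_bigr => k _; rewrite linearZ.
rewrite {1}[X]expand inner_suml /fr vec_mxK [RHS]mxE.
transitivity (\sum_k mxvec X 0 k * \sum_l mxvec Y 0 l * gram_mx k l).
  apply: eq_bigr => k _; rewrite innerZ inner_sym {1}[Y]expand inner_suml; congr (_ * _).
  by apply: eq_bigr => l _; rewrite innerZ mxE inner_sym.
under eq_bigr do rewrite mulr_sumr.
rewrite exchange_big; apply: eq_bigr => l _; rewrite !mxE mulr_suml.
by apply: eq_bigr => k _; ring.
Qed.

Lemma gram_mx_sym : gram_mx^T = gram_mx.
Proof. by apply/matrixP => k l; rewrite !mxE inner_sym. Qed.

Lemma gram_mx_unit : gram_mx \in unitmx.
Proof.
rewrite -row_free_unit -kermx_eq0; apply/rowV0P => u /sub_kermxP uL.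
apply: (can_inj vec_mxK); rewrite linear0; apply/eqP; apply: contraT => /inner_gt0.
by rewrite inner_gmap /gmap vec_mxK uL linear0 /fr linear0 mul0mx mxE ltxx.
Qed.

Local Notation C := (R[i]%C).
Local Notation V := 'M[C]_(m, n).
Local Notation rc := (real_complex R).

Definition gramC : 'M[C]_(m * n) := map_mx rc gram_mx.

Lemma gramC_sym : gramC^T = gramC.
Proof. by rewrite /gramC -[in RHS]gram_mx_sym; apply/matrixP => k l; rewrite !mxE. Qed.

Lemma gramC_unit : gramC \in unitmx.
Proof. by rewrite map_unitmx gram_mx_unit. Qed.

Lemma complexify_gmap X : gmap gramC (complexify X) = complexify (gmap gram_mx X).
Proof. by rewrite /gmap /complexify map_vec_mx map_mxM map_mxvec. Qed.

Lemma complexify_inj : injective (@complexify R m n).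
Proof. exact: (@map_mx_inj _ _ _ m n). Qed.

Lemma fr_complexify (X Y : 'M[R]_(m, n)) : fr (complexify X) (complexify Y) = rc (fr X Y).
Proof.
by rewrite !frE rmorph_sum; apply: eq_bigr => i _; rewrite rmorph_sum;
   apply: eq_bigr => j _; rewrite !mxE rmorphM.
Qed.

Lemma complex_split (z : V) :
  z = complexify (map_mx (@complex.Re R) z) + 'i%C *: complexify (map_mx (@complex.Im R) z).
Proof. by apply/matrixP => i j; rewrite !mxE -complexE. Qed.

Lemma cformE (v w : V) : cform Q v w = fr (gmap gramC v) w.
Proof.
rewrite {2}[v]complex_split {2}[w]complex_split gmapD gmapZ !complexify_gmap.
rewrite frDl !frDr !frZl !frZr !fr_complexify -!inner_gmap /cform.
by apply/eqP; rewrite eq_complex /=; apply/andP; split; apply/eqP; ring.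
Qed.

Lemma cform_nondegenerate v : (forall w, cform Q v w = 0) -> v = 0.
Proof.
move=> H; rewrite -[v](gmapK _ gramC_unit).
have -> : gmap gramC v = 0; last by rewrite gmap0.
by apply/matrixP => i j; rewrite -fr_delta -cformE H mxE.
Qed.

Local Notation G := (gmap gramC).

Implicit Types (u v X : V) (x : 'cV[C]_m) (y : 'rV[C]_n).

(** For [X = x *m y] nonzero they say that the Gram image of [u - X] is annihilated by [x] and [y].
    Written with [X] itself they are polynomial in [(X, u)] and pass to the Zariski closure. *)
Definition normal_eqs (u X : V) := X^T *m G (u - X) = 0 /\ G (u - X) *m X^T = 0.

Lemma normal_eqs_factor u x y : x != 0 -> y != 0 ->
  normal_eqs u (x *m y) <-> x^T *m G (u - x *m y) = 0 /\ G (u - x *m y) *m y^T = 0.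
Proof. by move=> x0 y0; rewrite /normal_eqs mul_tr_colrow // mul_colrow_tr. Qed.

Lemma critical_neq0 u X : X != 0 ->
  critical Q u X <-> segre_cone C m n X /\ normal_eqs u X.
Proof.
move=> X0; split=> [[[CX _] NX]|[CX NX]].
  have {}CX : segre_cone C m n X by apply/cone_mxvec.
  split=> //; have [x [y [x0 y0 e]]] := segreP CX X0.
  rewrite e in NX *; apply/normal_eqs_factor => //.
  split; [apply/(iffLR (fr_colrow_l _ _)) => b | apply/(iffLR (fr_colrow_r _ _)) => a];
    rewrite -cformE;
    apply: NX; apply/(iffRL (tangent_cone _ x0 y0)).
    by exists 0, b; rewrite mul0mx add0r.
  by exists a, 0; rewrite mulmx0 addr0.
split; first exact: cone_smooth_neq0.
have [x [y [x0 y0 e]]] := segreP CX X0; rewrite e in NX *.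
move=> w /(iffLR (tangent_cone _ x0 y0)) [a [b ->]]; rewrite cformE frDr.
case/normal_eqs_factor: NX => // /(iffRL (fr_colrow_l _ _)) -> /(iffRL (fr_colrow_r _ _)) ->.
by rewrite add0r.
Qed.

Lemma critical0 u : critical Q u 0 -> u = 0.
Proof.
move=> [_ N0]; apply: cform_nondegenerate => w; rewrite -[u]subr0; apply: N0.
by rewrite linear0; apply: tangent_cone0.
Qed.

Lemma critical_eqs u X : critical Q u X -> minors_vanish X /\ normal_eqs u X.
Proof.
have [->|X0] := eqVneq X 0.
  by move=> _; split=> [i k j l|]; [rewrite !mxE; ring|split; rewrite trmx0 ?mul0mx ?mulmx0].
by case/(critical_neq0 _ X0) => /segre_minors.
Qed.

Let S : set 'rV[C]_(m * n + m * n) := [set z | exists X u, critical Q u X /\ z = pair_mx X u].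

Let Xz (z : 'rV[C]_(m * n + m * n)) : V := vec_mx (lsubmx z).
Let Uz (z : 'rV[C]_(m * n + m * n)) : V := vec_mx (rsubmx z).

Lemma Xz_pair X u : Xz (pair_mx X u) = X. Proof. by rewrite /Xz row_mxKl mxvecK. Qed.
Lemma Uz_pair X u : Uz (pair_mx X u) = u. Proof. by rewrite /Uz row_mxKr mxvecK. Qed.

Lemma entries_Xz : entries polyfun Xz.
Proof.
apply: entries_vec => i j.
by apply: fun_algebra_ext (polyfun_id i (lshift _ j)) => z; rewrite mxE.
Qed.

Lemma entries_Uz : entries polyfun Uz.
Proof.
apply: entries_vec => i j.
by apply: fun_algebra_ext (polyfun_id i (rshift _ j)) => z; rewrite mxE.
Qed.

Let Wz z := G (Uz z - Xz z).

Lemma entries_Wz : entries polyfun Wz.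
Proof.
apply: (entries_gmap _ polyfun_algebra); apply: (entriesD polyfun_algebra).
  exact: entries_Uz.
exact/(entriesN polyfun_algebra)/entries_Xz.
Qed.

Lemma ED_polyfun f X u : polyfun f -> (forall X u, critical Q u X -> f (pair_mx X u) = 0) ->
  ED_correspondence Q (pair_mx X u) -> f (pair_mx X u) = 0.
Proof. by move=> pf Sf; apply: zclosure_polyfun => // _ [x [v [c ->]]]; apply: Sf. Qed.

Let f_minor i k j l z := Xz z i j * Xz z k l - Xz z i l * Xz z k j.

Lemma f_minor_poly i k j l : polyfun (f_minor i k j l).
Proof.
have [Pc Pa Pm] := @polyfun_algebra C (m * n + m * n).
have e := entries_Xz; apply: fun_algebra_ext (Pa _ _ (Pm _ _ (e i j) (e k l))
  (Pm _ _ (Pc (-1)) (Pm _ _ (e i l) (e k j)))) => z.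
by rewrite mulN1r.
Qed.

Lemma entries_XW : entries polyfun (fun z => (Xz z)^T *m Wz z).
Proof.
apply: (@entriesM _ _ _ polyfun_algebra _ _ _ (fun z => (Xz z)^T) Wz).
  exact: entries_tr entries_Xz.
exact: entries_Wz.
Qed.

Lemma entries_WX : entries polyfun (fun z => Wz z *m (Xz z)^T).
Proof.
apply: (@entriesM _ _ _ polyfun_algebra _ _ _ Wz (fun z => (Xz z)^T)).
  exact: entries_Wz.
exact: entries_tr entries_Xz.
Qed.

Lemma ED_eqs X u : ED_correspondence Q (pair_mx X u) -> minors_vanish X /\ normal_eqs u X.
Proof.
move=> E; split.
  move=> i k j l; rewrite -[X](Xz_pair X u).
  apply: (ED_polyfun (f_minor_poly i k j l)) E => Y v /critical_eqs[mY _].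
  by rewrite /f_minor Xz_pair mY.
rewrite /normal_eqs -[X](Xz_pair X u) -[u](Uz_pair X u) !Xz_pair.
split; apply/matrixP => i j; rewrite [RHS]mxE.
  have := ED_polyfun (entries_XW i j) _ E; rewrite /Wz Xz_pair Uz_pair; apply=> Y v.
  by rewrite /Wz Xz_pair Uz_pair => /critical_eqs[_ [-> _]]; rewrite mxE.
have := ED_polyfun (entries_WX i j) _ E; rewrite /Wz Xz_pair Uz_pair; apply=> Y v.
by rewrite /Wz Xz_pair Uz_pair => /critical_eqs[_ [_ ->]]; rewrite mxE.
Qed.

Lemma critical_ED u X : critical Q u X -> ED_fiber Q u X.
Proof. by move=> c; apply: zclosure_sub; exists X, u. Qed.

(** The equations of [ED_eqs] characterize criticality off the vertex, so the closure adds points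
    over the vertex only. *)
Lemma ED_fiber_neq0 u X : X != 0 -> ED_fiber Q u X <-> critical Q u X.
Proof.
move=> X0; split=> [/ED_eqs[mX NX]|]; last exact: critical_ED.
by apply/critical_neq0 => //; split=> //; apply: minors_segre.
Qed.

Lemma singular_det p (A : 'M[C]_p) : (exists2 v : 'rV_p, v != 0 & v *m A = 0) -> \det A = 0.
Proof.
case=> v v0 vA; apply/eqP; apply: contraT => dA.
have uA : A \in unitmx by rewrite unitmxE unitfE.
by case/negP: v0; rewrite -[v](mulmxK uA) vA mul0mx.
Qed.

(** The vertex is covered too: it can be critical only for [u = 0], when any two nonzero vectors
    will do, here the constant ones. *)
Lemma critical_singular u X : (0 < m)%N -> (0 < n)%N -> critical Q u X -> exists x y,
  [/\ x != 0, y != 0, x^T *m G (u - X) = 0 & G (u - X) *m y^T = 0].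
Proof.
move=> m0 n0; have [->|X0] := eqVneq X 0; last first.
  case/(critical_neq0 _ X0) => /segreP -/(_ X0) [x [y [x0 y0 ->]]].
  by case/normal_eqs_factor => // N1 N2; exists x, y.
move/critical0 => ->; exists (const_mx 1), (const_mx 1).
rewrite subr0 gmap0 mulmx0 mul0mx; split=> //.
  by apply/cV0Pn; exists (Ordinal m0); rewrite mxE oner_neq0.
by apply/rV0Pn; exists (Ordinal n0); rewrite mxE oner_neq0.
Qed.

(** At full rank, a fixed one-sided inverse [B] of the Gram image of [u] would give a polynomial,
    the determinant of the product of [B] and the Gram image of the normal vector, equal to 1 at
    [(0, u)] but zero on all critical pairs by [critical_singular]. *)
Lemma ED_fiber0_rank u : (0 < m)%N -> (0 < n)%N -> ED_fiber Q u 0 ->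
  (\rank (G u) < minn m n)%N.
Proof.
move=> m0 n0 E; rewrite ltnNge; apply/negP => rk.
have [mn|/ltnW nm] := leqP m n.
  have [B WB] : exists B, G u *m B = 1%:M.
    by apply/row_freeP; rewrite /row_free eqn_leq rank_leq_row; rewrite (minn_idPl mn) in rk.
  pose f z := \det (Wz z *m B).
  have pf : polyfun f.
    apply: (fun_algebra_det polyfun_algebra); apply: (entriesM polyfun_algebra).
      exact: entries_Wz.
    exact: (entries_cst polyfun_algebra).
  suff Sf X v : critical Q v X -> f (pair_mx X v) = 0.
    have := ED_polyfun pf Sf E; rewrite /f /Wz Xz_pair Uz_pair subr0 WB det1 => /eqP.
    by rewrite oner_eq0.
  move=> c; have [x [_ [x0 _ xW _]]] := critical_singular m0 n0 c.
  apply: singular_det; exists x^T; first by rewrite trmx_eq0.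
  by rewrite /Wz Xz_pair Uz_pair mulmxA xW mul0mx.
have [B BW] : exists B, B *m G u = 1%:M.
  by apply/row_fullP; rewrite /row_full eqn_leq rank_leq_col; rewrite (minn_idPr nm) in rk.
pose f z := \det (B *m Wz z).
have pf : polyfun f.
  apply: (fun_algebra_det polyfun_algebra); apply: (entriesM polyfun_algebra).
    exact: (entries_cst polyfun_algebra).
  exact: entries_Wz.
suff Sf X v : critical Q v X -> f (pair_mx X v) = 0.
  have := ED_polyfun pf Sf E; rewrite /f /Wz Xz_pair Uz_pair subr0 BW det1 => /eqP.
  by rewrite oner_eq0.
move=> c; have [_ [y [_ y0 _ Wy]]] := critical_singular m0 n0 c.
rewrite /f -det_tr; apply: singular_det; exists y => //.
by apply: trmx_inj; rewrite trmx_mul trmxK trmx0 /Wz Xz_pair Uz_pair -mulmxA Wy mulmx0.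
Qed.

(** For t <> 0 the matrix t x y is critical for u + t x y, with the constant normal vector u; then t
    goes to 0 inside the closure. *)
Lemma ED_vertex u x y : x != 0 -> y != 0 -> x^T *m G u = 0 -> G u *m y^T = 0 ->
  ED_fiber Q u 0.
Proof.
move=> x0 y0 xW Wy.
have cX : curvem (fun t : C => t *: (x *m y)) (x *m y).
  by move=> i j; have := curvem_line (0 : V) (x *m y) i j; apply: curve_ext => [t|];
    rewrite // add0r.
have cU := curvemD (curvem_cst u) cX.
have := curve_zclosure (curvem_row (curvem_mxvec cX) (curvem_mxvec cU)) (S := S).
rewrite scale0r addr0; apply => k k0.
exists (k%:R *: (x *m y)), (u + k%:R *: (x *m y)); split=> //.
have kx0 : k%:R *: x != 0 by rewrite scaler_eq0 negb_or pnatr_eq0 -lt0n k0.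
rewrite scalemxAl; apply/critical_neq0; first by rewrite mul_colrow_eq0 negb_or kx0.
split; first by exists (k%:R *: x) => //; exists y.
apply/normal_eqs_factor => //; rewrite addrK; split=> //.
by rewrite linearZ /= -scalemxAl xW scaler0.
Qed.

End InnerProduct.
End EDTheory.

(** * Tangent spaces of the ED correspondence *)

Module TangentED.
Import complex mpoly.
Import Order.TTheory GRing.Theory Num.Theory.
Import Polynomials Tangents Segre EDTheory.
Local Open Scope classical_set_scope.
Local Open Scope ring_scope.

Section LinearSets.
Context {K : fieldType} {k : nat}.

Lemma linear_set_row_space (S : set 'rV[K]_k) : S 0 ->
  (forall a u v, S u -> S v -> S (a *: u + v)) ->
  exists A : 'M[K]_k, S = [set v | (v <= A)%MS].
Proof.
move=> S0 Slin.
pose good d := `[< exists B : 'M[K]_(d, k), row_free B /\ forall i, S (row i B) >].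
have good0 : exists d, good d.
  exists 0%N; apply/asboolP; exists 0; split=> [|[]//].
  by rewrite /row_free -leqn0 rank_leq_row.
have goodk d : good d -> (d <= k)%N.
  by move=> /asboolP[B [fB _]]; rewrite -(eqP fB) rank_leq_col.
case: (ex_maxnP good0 goodk) => d /asboolP[B [fB SB]] dmax.
have rB : \rank B = d := eqP fB.
have SB' v : (v <= B)%MS -> S v.
  move=> /submxP[u ->]; rewrite mulmx_sum_row.
  elim/big_rec: _ => // i w _ Sw; exact: Slin.
exists <<B>>%MS; apply/seteqP; split=> v /=; rewrite genmxE; last exact: SB'.
move=> Sv; apply: contraT => nv; suff : (d.+1 <= d)%N by rewrite ltnn.
apply: dmax; apply/asboolP.
have rBv : \rank (B + v)%MS = d.+1.
  apply/eqP; rewrite eqn_leq; apply/andP; split.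
    apply: leq_trans (mxrank_adds_leqif B v) _.
    by rewrite rB; have := rank_leq_row v; lia.
  have /mxrank_leqif_sup := addsmxSl B v; rewrite rB => -[le eqB].
  rewrite ltn_neqAle le andbT eqB; apply: contra nv => /(submx_trans (addsmxSr _ _)) //.
rewrite -rBv; exists (row_base (B + v)%MS); split; first exact: row_base_free.
move=> i; have : (row i (row_base (B + v)%MS) <= (B + v)%MS)%MS.
  by apply: submx_trans (row_sub i _) _; rewrite eq_row_base.
move=> /sub_addsmxP[[u1 u2] -> /=]; rewrite -[u1 *m B]scale1r; apply: (Slin).
  by apply: SB'; apply: submxMl.
rewrite [u2]mx11_scalar mul_scalar_mx -[_ *: v]addr0; exact: Slin.
Qed.

Lemma tangent_row_space (X : set 'rV[K]_k) a :
  exists A : 'M[K]_k, tangent X a = [set v | (v <= A)%MS].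
Proof.
rewrite tangentE; apply: linear_set_row_space => [p _|c u v Tu Tv p Xp].
  by rewrite mul0mx.
by rewrite mulmxDl -scalemxAl Tu // Tv // scaler0 addr0.
Qed.

(** The row space of [A] is its own orthogonal for [F], and that orthogonal has dimension
    [k - \rank A]. *)
Lemma lagrangian_rank N p (A : 'M[K]_(p, k)) (F : 'M[K]_k) : k = (N + N)%N ->
  F \in unitmx -> (forall u v, (u <= A)%MS -> (v <= A)%MS -> u *m F *m v^T = 0 :> 'M_1) ->
  (forall u : 'rV_k, (forall v, (v <= A)%MS -> u *m F *m v^T = 0 :> 'M_1) -> (u <= A)%MS) ->
  \rank A = N.
Proof.
move=> kN uF iso coiso.
have rFA : \rank (F *m A^T) = \rank A.
  by rewrite -mxrank_tr trmx_mul trmxK mxrankMfree // row_free_unit unitmx_tr.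
have AFA : (A <= kermx (F *m A^T))%MS.
  apply/row_subP => i; apply/sub_kermxP/rowP => j; rewrite [RHS]mxE.
  have := iso (row i A) (row j A) (row_sub i A) (row_sub j A).
  move=> /(congr1 (fun B : 'M_1 => B 0 0)); rewrite mulmxA [in RHS]mxE => e.
  by rewrite -[RHS]e !mxE; apply: eq_bigr => l _; rewrite !mxE.
have kerA : (kermx (F *m A^T) <= A)%MS.
  apply/rV_subP => u /sub_kermxP uk; apply: coiso => v /submxP[w ->].
  by rewrite trmx_mul mulmxA -(mulmxA u F) uk mul0mx.
have := mxrankS AFA; have := mxrankS kerA; rewrite mxrank_ker rFA.
by have := rank_leq_col A; lia.
Qed.

End LinearSets.

Section Charts.
Context {K : fieldType} {m n : nat}.
Implicit Types (x : 'cV[K]_m) (y : 'rV[K]_n) (W : 'M[K]_(m, n)).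

(* The matrices annihilated by x on the left and by y on the right are the
   [chartl i x *m N *m chartr j y], as soon as x_i and y_j do not vanish. *)
Definition chartl i x : 'M[K]_m := (x i 0)%:M - delta_mx i 0 *m x^T.
Definition chartr j y : 'M[K]_n := (y 0 j)%:M - y^T *m delta_mx 0 j.

Lemma mul_chartl i x (a : 'cV[K]_m) : a^T *m chartl i x = x i 0 *: a^T - a i 0 *: x^T.
Proof.
rewrite mulmxBr mul_mx_scalar mulmxA.
have -> : a^T *m delta_mx i 0 = (a i 0)%:M :> 'M_1.
  by rewrite -colE; apply/matrixP => k l; rewrite !ord1 !mxE eqxx mulr1n.
by rewrite mul_scalar_mx.
Qed.

Lemma mul_chartr j y (b : 'rV[K]_n) : chartr j y *m b^T = y 0 j *: b^T - b 0 j *: y^T.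
Proof.
rewrite mulmxBl mul_scalar_mx -mulmxA.
have -> : delta_mx 0 j *m b^T = (b 0 j)%:M :> 'M_1.
  by rewrite -rowE; apply/matrixP => k l; rewrite !ord1 !mxE eqxx mulr1n.
by rewrite mul_mx_scalar.
Qed.

Lemma mul_chartl0 i x : x^T *m chartl i x = 0.
Proof. by rewrite mul_chartl subrr. Qed.

Lemma mul_chartr0 j y : chartr j y *m y^T = 0.
Proof. by rewrite mul_chartr subrr. Qed.

Lemma chartl_fix i x W : x^T *m W = 0 -> chartl i x *m W = x i 0 *: W.
Proof. by move=> xW; rewrite mulmxBl mul_scalar_mx -mulmxA xW mulmx0 subr0. Qed.

Lemma chartr_fix j y W : W *m y^T = 0 -> W *m chartr j y = y 0 j *: W.
Proof. by move=> Wy; rewrite mulmxBr mul_mx_scalar mulmxA Wy mul0mx subr0. Qed.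

Lemma chart_fix i j x y W : x i 0 != 0 -> y 0 j != 0 -> x^T *m W = 0 -> W *m y^T = 0 ->
  chartl i x *m ((x i 0 * y 0 j)^-1 *: W) *m chartr j y = W.
Proof.
move=> xi yj xW Wy; rewrite -scalemxAr -scalemxAl chartl_fix // -scalemxAl chartr_fix //.
rewrite !scalerA; set c := (X in X *: _); have -> : c = 1 by rewrite /c; field; rewrite xi yj.
exact: scale1r.
Qed.

(** [D] is the derivative of the chart in the direction [(a, b)] at fixed [M0]: a particular
    solution of the linearized equations. *)
Lemma chart_variation i j x y (a : 'cV[K]_m) (b : 'rV[K]_n) W :
  x i 0 != 0 -> y 0 j != 0 -> x^T *m W = 0 -> W *m y^T = 0 ->
  let M0 := (x i 0 * y 0 j)^-1 *: W in
  let D := chartl i a *m M0 *m chartr j y + chartl i x *m M0 *m chartr j b in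
  x^T *m D = - (a^T *m W) /\ D *m y^T = - (W *m b^T).
Proof.
move=> xi yj xW Wy M0 D; split.
  rewrite mulmxDr !mulmxA mul_chartl0 !mul0mx addr0 mul_chartl.
  rewrite mulmxBl -!scalemxAl -!scalemxAr xW !scaler0 sub0r mulNmx.
  rewrite -!scalemxAl -mulmxA chartr_fix // -scalemxAr !scalerA.
  by set c := (X in X *: _); have -> : c = 1; [rewrite /c; field; rewrite xi yj|rewrite scale1r].
rewrite mulmxDl -!mulmxA mul_chartr0 !mulmx0 add0r mul_chartr !mulmxA.
rewrite mulmxBr -!scalemxAr -!scalemxAl chartl_fix // -!scalemxAl Wy !scaler0 sub0r.
by rewrite !scalerA; set c := (X in X *: _); have -> : c = 1; [rewrite /c; field;
  rewrite xi yj|rewrite scale1r].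
Qed.

Lemma linearized_left x y (a : 'cV[K]_m) (b : 'rV[K]_n) W (D : 'M[K]_(m, n)) :
  y != 0 -> x^T *m W = 0 -> (a *m y + x *m b)^T *m W + (x *m y)^T *m D = 0 ->
  x^T *m D = - (a^T *m W).
Proof.
move=> y0 xW; rewrite linearD /= mulmxDl !trmx_mul -!mulmxA xW mulmx0 addr0 -mulmxDr.
have [j yj] := rV0Pn _ y0 => e; apply/eqP; rewrite eq_sym -subr_eq0 -opprD oppr_eq0.
apply/eqP/rowP => l; have := congr1 (fun A : 'M_n => A j l) e.
by rewrite !mxE big_ord1 !mxE => /eqP; rewrite mulf_eq0 (negPf yj) => /eqP.
Qed.

Lemma linearized_right x y (a : 'cV[K]_m) (b : 'rV[K]_n) W (D : 'M[K]_(m, n)) :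
  x != 0 -> W *m y^T = 0 -> D *m (x *m y)^T + W *m (a *m y + x *m b)^T = 0 ->
  D *m y^T = - (W *m b^T).
Proof.
move=> x0 Wy; rewrite linearD /= mulmxDr !trmx_mul !mulmxA Wy mul0mx add0r -mulmxDl.
have [j xj] := cV0Pn _ x0 => e; apply/eqP; rewrite -subr_eq0 opprK.
apply/eqP/matrixP => l z; rewrite (ord1 z) {z}; have := congr1 (fun A : 'M_m => A l j) e.
by rewrite !mxE big_ord1 !mxE => /eqP; rewrite mulf_eq0 (negPf xj) orbF => /eqP.
Qed.

(** The two linear relations recover row [i] and column [j] from the other entries, because [x i 0]
    and [y 0 j] are invertible. *)
Lemma normal_eq0 i j x y W : x i 0 != 0 -> y 0 j != 0 -> x^T *m W = 0 -> W *m y^T = 0 ->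
  (forall k l, k != i -> l != j -> W k l = 0) -> W = 0.
Proof.
move=> xi yj xW Wy W0.
have Wl l : l != j -> forall k, W k l = 0.
  move=> lj k; have [->|ki] := eqVneq k i; last exact: W0.
  have := congr1 (fun A : 'rV_n => A 0 l) xW; rewrite !mxE (bigD1 i) //= big1 => [|k' k'i].
    by rewrite mxE addr0 => /eqP; rewrite mulf_eq0 (negPf xi) => /eqP.
  by rewrite W0 // mulr0.
apply/matrixP => k l; rewrite mxE; have [->|lj] := eqVneq l j; last exact: Wl.
have := congr1 (fun A : 'cV_m => A k 0) Wy; rewrite !mxE (bigD1 j) //= big1 => [|l' l'j].
  by rewrite mxE addr0 => /eqP; rewrite mulf_eq0 (negPf yj) orbF => /eqP.
by rewrite Wl // mul0r.
Qed.

End Charts.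
(* The linearized equations of the ED correspondence at (x *m y, u), where L
   is the Gram matrix and W the Gram image of the normal vector u - x *m y. *)
Definition ED_linear (K : fieldType) m n (L : 'M[K]_(m * n)) (x : 'cV[K]_m) (y : 'rV[K]_n)
    (W Y Z : 'M[K]_(m, n)) := exists a b, [/\ Y = a *m y + x *m b,
  x^T *m gmap L (Z - Y) = - (a^T *m W) & gmap L (Z - Y) *m y^T = - (W *m b^T)].

Lemma curvem_chartl (K : numFieldType) m i (F : K -> 'cV[K]_m) D :
  curvem F D -> curvem (fun t => chartl i (F t)) (chartl i D).
Proof.
move=> FD k l; rewrite /chartl !mxE.
have := curveD (curveM (FD i 0) (curve_cst (k == l)%:R))
  (curveM (curve_cst (- (k == i)%:R)) (FD l 0)).
apply: curve_ext => [t|]; last by rewrite big_ord1 !mxE eqxx andbT -mulr_natr; ring.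
by rewrite !mxE big_ord1 !mxE eqxx andbT -mulr_natr; ring.
Qed.

Lemma curvem_chartr (K : numFieldType) n j (F : K -> 'rV[K]_n) D :
  curvem F D -> curvem (fun t => chartr j (F t)) (chartr j D).
Proof.
move=> FD k l; rewrite /chartr !mxE.
have := curveD (curveM (FD 0 j) (curve_cst (k == l)%:R))
  (curveM (FD 0 k) (curve_cst (- (l == j)%:R))).
apply: curve_ext => [t|]; last by rewrite big_ord1 !mxE eqxx -mulr_natr; ring.
by rewrite !mxE big_ord1 !mxE eqxx -mulr_natr; ring.
Qed.

(** Moving the chart produces the particular solution of [chart_variation]; what remains of [D] is
    annihilated by [x] and [y], so it is obtained by moving the matrix parameter of the chart. *)
Lemma normal_curve (K : numFieldType) m n i j (x a : 'cV[K]_m) (y b : 'rV[K]_n)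
    (W D : 'M[K]_(m, n)) : x i 0 != 0 -> y 0 j != 0 ->
  x^T *m W = 0 -> W *m y^T = 0 -> x^T *m D = - (a^T *m W) -> D *m y^T = - (W *m b^T) ->
  exists om : K -> 'M[K]_(m, n), [/\ om 0 = W, curvem om D &
    forall t, (x + t *: a)^T *m om t = 0 /\ om t *m (y + t *: b)^T = 0].
Proof.
move=> xi yj xW Wy xG Gy; have [xD1 D1y] := chart_variation a b xi yj xW Wy.
pose M0 := (x i 0 * y 0 j)^-1 *: W.
pose D1 := chartl i a *m M0 *m chartr j y + chartl i x *m M0 *m chartr j b.
pose D' := D - D1.
have xD' : x^T *m D' = 0 by rewrite mulmxBr xG xD1 subrr.
have Dy' : D' *m y^T = 0 by rewrite mulmxBl Gy D1y subrr.
pose M1 := (x i 0 * y 0 j)^-1 *: D'.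
exists (fun t => chartl i (x + t *: a) *m (M0 + t *: M1) *m chartr j (y + t *: b)); split.
- by rewrite !scale0r !addr0 chart_fix.
- have cl := curvem_chartl i (curvem_line x a); have cr := curvem_chartr j (curvem_line y b).
  have := curvemM (curvemM cl (curvem_line M0 M1)) cr; rewrite !scale0r !addr0.
  rewrite mulmxDl (chart_fix xi yj xD' Dy'); congr curvem.
  by rewrite /D' /D1; apply/matrixP => k l; rewrite !mxE; ring.
- by move=> t; split; [rewrite !mulmxA mul_chartl0 !mul0mx | rewrite -!mulmxA mul_chartr0 !mulmx0].
Qed.

Section EDTangent.
Local Opaque gmap gramC.
Context {R : realType} {m n : nat} (Q : inner_product 'M[R]_(m, n)).
Local Notation C := (R[i]%C).
Local Notation V := 'M[C]_(m, n).
Local Notation G := (gmap (gramC Q)).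
Local Notation E := (ED_correspondence Q).
Implicit Types (u X Y Z : V) (x a : 'cV[C]_m) (y b : 'rV[C]_n).

Lemma pair_mx_line X u Y Z t :
  pair_mx X u + t *: pair_mx Y Z = pair_mx (X + t *: Y) (u + t *: Z).
Proof. by rewrite /pair_mx scale_row_mx add_row_mx !linearD !linearZ. Qed.

Lemma curvem_pair (F H : C -> V) D D' :
  curvem F D -> curvem H D' -> curvem (fun t => pair_mx (F t) (H t)) (pair_mx D D').
Proof. by move=> FD HD; apply: curvem_row; apply: curvem_mxvec. Qed.

Lemma tangent_ED_linear x y u Y Z : x != 0 -> y != 0 ->
  critical Q u (x *m y) -> tangent E (pair_mx (x *m y) u) (pair_mx Y Z) ->
  ED_linear (gramC Q) x y (G (u - x *m y)) Y Z.
Proof.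
move=> x0 y0 c T; set W := G (u - x *m y).
have [xW Wy] : x^T *m W = 0 /\ W *m y^T = 0.
  by have [_ /normal_eqs_factor] := critical_eqs c; apply.
have E0 f : polyfun f -> (forall X v, critical Q v X -> f (pair_mx X v) = 0) ->
    forall z, E z -> f z = 0.
  by move=> pf Sf z; apply: zclosure_polyfun => // _ [X [v [cX ->]]]; apply: Sf.
have cX := curvem_line (x *m y) Y; have cu := curvem_line u Z.
have cW : curvem (fun t => G ((u + t *: Z) - (x *m y + t *: Y))) (G (Z - Y)).
  exact/curvem_gmap/curvemD/curvemN.
have [a [b YE]] : tangent_factor x y Y.
  apply: linear_minor_factor => // i k j l.
  apply: (tangent_derivative (f_minor_poly i k j l) _ _ T).
    apply: E0; first exact: f_minor_poly.
    by move=> X v /critical_eqs[mX _]; rewrite !Xz_pair mX.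
  have := curve_minor i k j l cX; rewrite scale0r addr0; apply: curve_ext => // t.
  by rewrite pair_mx_line !Xz_pair.
exists a, b; split=> //.
  apply: (linearized_left y0 xW (b := b)); rewrite -YE.
  apply/matrixP => i j; rewrite [RHS]mxE.
  apply: (tangent_derivative (entries_XW Q i j) _ _ T).
    apply: E0; first exact: entries_XW.
    by move=> X v /critical_eqs[_ [e _]]; rewrite !Xz_pair !Uz_pair e mxE.
  have := curvemM (curvem_tr cX) cW i j; rewrite !scale0r !addr0.
  apply: curve_ext => [t|]; last by [].
  by rewrite pair_mx_line !Xz_pair !Uz_pair.
apply: (linearized_right x0 Wy (a := a)); rewrite -YE.
apply/matrixP => i j; rewrite [RHS]mxE.
apply: (tangent_derivative (entries_WX Q i j) _ _ T).
  apply: E0; first exact: entries_WX.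
  by move=> X v /critical_eqs[_ [_ e]]; rewrite !Xz_pair !Uz_pair e mxE.
have := curvemM cW (curvem_tr cX) i j; rewrite !scale0r !addr0.
apply: curve_ext => [t|]; last by [].
by rewrite pair_mx_line !Xz_pair !Uz_pair.
Qed.

(** A solution of the linearized equations is the velocity of a curve of critical pairs: the factors
    move on lines, and the normal vector follows [normal_curve]. *)
Lemma linear_tangent_ED x y u Y Z : x != 0 -> y != 0 ->
  critical Q u (x *m y) -> ED_linear (gramC Q) x y (G (u - x *m y)) Y Z ->
  tangent E (pair_mx (x *m y) u) (pair_mx Y Z).
Proof.
move=> x0 y0 c [a [b [YE xG Gy]]]; set W := G (u - x *m y) in xG Gy.
have [xW Wy] : x^T *m W = 0 /\ W *m y^T = 0.
  by have [_ /normal_eqs_factor] := critical_eqs c; apply.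
have [i xi] := cV0Pn _ x0; have [j yj] := rV0Pn _ y0.
have [om [om0 c_om omP]] := normal_curve xi yj xW Wy xG Gy.
have cXt : curvem (fun t => (x + t *: a) *m (y + t *: b)) Y.
  have := curvemM (curvem_line x a) (curvem_line y b).
  by rewrite !scale0r !addr0 -YE.
have cUt := curvemD cXt (curvem_gmap (invmx (gramC Q)) c_om).
(* Where this product of coordinates vanishes along the curve, the pair may fail to be critical; it
   is the function that [curve_tangent] excludes. *)
have cq : curve (fun t => (x + t *: a) i 0 * (y + t *: b) 0 j)
    (a i 0 * (y + 0 *: b) 0 j + (x + 0 *: a) i 0 * b 0 j).
  exact: curveM (curvem_line x a i 0) (curvem_line y b 0 j).
have := curve_tangent (curvem_pair cXt cUt) cq (X := E).
rewrite !scale0r !addr0 om0 mulf_neq0 // => /(_ isT).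
rewrite /W !gmapK ?gramC_unit // !(addrC _ (_ - _)) !subrK.
apply=> t; rewrite mulf_eq0 negb_or => /andP[xti ytj].
have xt0 : x + t *: a != 0 by apply/cV0Pn; exists i.
have yt0 : y + t *: b != 0 by apply/rV0Pn; exists j.
apply: critical_ED; apply/critical_neq0; first by rewrite mul_colrow_eq0 negb_or xt0.
split; first by exists (x + t *: a) => //; exists (y + t *: b).
set X := _ *m _; have -> : normal_eqs Q (X + gmap (invmx (gramC Q)) (om t)) X
    = (X^T *m om t = 0 /\ om t *m X^T = 0).
  by rewrite /normal_eqs [X + _]addrC addrK gmapVK ?gramC_unit.
have [e1 e2] := omP t; split; first exact/mul_tr_colrow.
exact/mul_colrow_tr.
Qed.

End EDTangent.
End TangentED.

(** * Lagrangian tangent spaces and critical values *)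

Module Discriminant.
Import complex mpoly.
Import Order.TTheory GRing.Theory Num.Theory.
Import Polynomials Tangents Segre EDTheory TangentED.
Local Open Scope classical_set_scope.
Local Open Scope ring_scope.

Section Symplectic.
Context {K : numFieldType} {m n : nat} (L : 'M[K]_(m * n)).
Hypotheses (L_sym : L^T = L) (L_unit : L \in unitmx).
Local Notation V := 'M[K]_(m, n).
Local Notation G := (gmap L).
Implicit Types (u X Y Z : V) (x a : 'cV[K]_m) (y b : 'rV[K]_n).

(** The form Q(Y, Z') - Q(Z, Y'). In the coordinates (X, u - X) it is the canonical symplectic form
    of a cotangent bundle, for which the conormal bundle of the cone is Lagrangian; since Q is
    symmetric, passing from u - X to u does not change it. *)
Definition symp : 'M[K]_(m * n + m * n) := block_mx 0 L (- L) 0.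

Lemma symp_unit : symp \in unitmx.
Proof.
have : symp *m block_mx 0 (- invmx L) (invmx L) 0 = 1%:M.
  rewrite mulmx_block !mul0mx !mulmx0 !addr0 !add0r mulNmx mulmxN opprK.
  by rewrite mulmxV // -scalar_mx_block.
by move/mulmx1_unit => [].
Qed.

Definition vec2 Y Z := row_mx (mxvec Y) (mxvec Z).

Lemma sympE Y Z Y' Z' : (vec2 Y Z *m symp *m (vec2 Y' Z')^T) 0 0 =
  fr (G (Z' - Y')) Y - fr (G (Z - Y)) Y'.
Proof.
rewrite /vec2 mul_row_block !mulmx0 add0r addr0 tr_row_mx mul_row_col mxE.
rewrite !gmapB !frDl !frNl (gmap_sym Y' Y L_sym) (gmap_sym Z' Y L_sym).
by rewrite /fr !vec_mxK mulmxN mulNmx [in LHS]mxE; ring.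
Qed.

Lemma fr_form_l D x y a b : fr D (a *m y + x *m b) =
  (a^T *m (D *m y^T)) 0 0 + (x^T *m D *m b^T) 0 0.
Proof. by rewrite frDr !fr_colrow mulmxA. Qed.

(** Both terms of [sympE] reduce to - (a^T W b'^T + a'^T W b^T), which is symmetric in the two
    vectors. *)
Lemma ED_linear_isotropic x y W Y Z Y' Z' :
  ED_linear L x y W Y Z -> ED_linear L x y W Y' Z' ->
  vec2 Y Z *m symp *m (vec2 Y' Z')^T = 0.
Proof.
move=> [a [b [YE xD Dy]]] [a' [b' [YE' xD' Dy']]].
apply/matrixP => i j; rewrite !ord1 [RHS]mxE sympE {1}YE {2}YE' !fr_form_l xD Dy xD' Dy'.
have N (A : 'M[K]_1) : (- A) 0 0 = - A 0 0 by rewrite mxE.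
by rewrite !mulmxN !mulNmx !mulmxA !N; ring.
Qed.

(** Special vectors suffice: normal directions, with [a] and [b] zero, force [Y0] to be tangent to
    the cone; then the variations of [y] alone and of [x] alone give the two remaining equations. *)
Lemma ED_linear_coisotropic x y W Y0 Z0 : x != 0 -> y != 0 ->
  x^T *m W = 0 -> W *m y^T = 0 ->
  (forall Y Z, ED_linear L x y W Y Z -> vec2 Y0 Z0 *m symp *m (vec2 Y Z)^T = 0) ->
  ED_linear L x y W Y0 Z0.
Proof.
move=> x0 y0 xW Wy H; set D0 := G (Z0 - Y0).
have [i xi] := cV0Pn _ x0; have [j yj] := rV0Pn _ y0.
have test a b D : x^T *m D = - (a^T *m W) -> D *m y^T = - (W *m b^T) ->
    fr D Y0 = fr D0 (a *m y + x *m b).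
  move=> xD Dy; pose Y := a *m y + x *m b; pose Z := Y + gmap (invmx L) D.
  have GD : G (Z - Y) = D by rewrite /Z addrC addKr gmapVK.
  have /H/matrixP/(_ 0 0) : ED_linear L x y W Y Z by exists a, b; rewrite GD.
  by rewrite sympE GD [RHS]mxE => /eqP; rewrite subr_eq0 => /eqP.
have [a0 [b0 Y0E]] : tangent_factor x y Y0.
  (* A column of [chartl] times a row of [chartr] is a normal vector, and [Y0] is orthogonal to all
     of these. *)
  have perp : (chartl i x)^T *m Y0 *m (chartr j y)^T = 0.
    apply/matrixP => k l; rewrite [RHS]mxE.
    have := test 0 0 (col k (chartl i x) *m row l (chartr j y)).
    rewrite !(trmx0, mul0mx, mulmx0, addr0, oppr0) fr_sym fr_colrow.
    have -> : fr D0 0 = 0 by rewrite /fr linear0 trmx0 mulmx0 mxE.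
    have -> : ((col k (chartl i x))^T *m Y0 *m (row l (chartr j y))^T) 0 0 =
        ((chartl i x)^T *m Y0 *m (chartr j y)^T) k l.
      rewrite tr_col tr_row -row_mul [LHS]mxE [RHS]mxE.
      by apply: eq_bigr => z _; rewrite !mxE.
    apply; rewrite ?mulmxA.
      by rewrite colE !mulmxA mul_chartl0 !mul0mx.
    by rewrite -!mulmxA rowE -mulmxA mul_chartr0 !mulmx0.
  have mulPl : (chartl i x)^T *m Y0 = x i 0 *: Y0 - x *m row i Y0.
    rewrite /chartl linearB /= tr_scalar_mx trmx_mul trmxK trmx_delta.
    by rewrite mulmxBl mul_scalar_mx -mulmxA -rowE.
  have mulPr (A : V) : A *m (chartr j y)^T = y 0 j *: A - col j A *m y.
    rewrite /chartr linearB /= tr_scalar_mx trmx_mul trmxK trmx_delta.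
    by rewrite mulmxBr mul_mx_scalar mulmxA -colE.
  exists (\col_k (Y0 k j / y 0 j - Y0 i j * x k 0 / (x i 0 * y 0 j))), (\row_l (Y0 i l / x i 0)).
  apply/matrixP => k l; have := congr1 (fun A : V => A k l) perp.
  rewrite mulPl mulPr !mxE !big_ord1 !mxE !big_ord1 !mxE => e.
  apply/eqP; rewrite -subr_eq0; apply/eqP; apply: (mulfI (mulf_neq0 xi yj)).
  by rewrite mulr0 -[RHS]e; field; rewrite xi yj.
have z00 : (0 : 'M[K]_1) 0 0 = 0 by rewrite mxE.
have N (A : 'M[K]_1) : (- A) 0 0 = - A 0 0 by rewrite mxE.
exists a0, b0; split=> //.
  have v (b : 'rV[K]_n) : ((x^T *m D0 + a0^T *m W) *m b^T) 0 0 = 0.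
    have [xD Dy] := chart_variation 0 b xi yj xW Wy.
    have := test 0 b _ xD Dy; rewrite Y0E !fr_form_l xD Dy.
    rewrite !(trmx0, mul0mx, oppr0) !z00 add0r addr0 => e.
    by rewrite mulmxDl mxE -e mulmxN N mulmxA addNr.
  apply/eqP; rewrite -subr_eq0 opprK; apply/eqP/rowP => l; rewrite [RHS]mxE.
  rewrite -[RHS](v (delta_mx 0 l)) trmx_delta -colE [RHS]mxE //.
have v (a : 'cV[K]_m) : (a^T *m (D0 *m y^T + W *m b0^T)) 0 0 = 0.
  have [xD Dy] := chart_variation a 0 xi yj xW Wy.
  have := test a 0 _ xD Dy; rewrite Y0E !fr_form_l xD Dy.
  rewrite !(trmx0, mulmx0, oppr0) !z00 add0r addr0 => e.
  by rewrite mulmxDr mxE -e mulNmx N mulmxA addNr.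
apply/eqP; rewrite -subr_eq0 opprK; apply/eqP/matrixP => k z; rewrite (ord1 z) [RHS]mxE.
by rewrite -[RHS](v (delta_mx k 0)) trmx_delta -rowE [RHS]mxE.
Qed.

Lemma vec2K (z : 'rV[K]_(m * n + m * n)) : vec2 (vec_mx (lsubmx z)) (vec_mx (rsubmx z)) = z.
Proof. by rewrite /vec2 !vec_mxK hsubmxK. Qed.

End Symplectic.

Section EDDiscriminant.
Context {R : realType} {m n : nat} (Q : inner_product 'M[R]_(m, n)).
Local Opaque gmap gramC.
Local Notation C := (R[i]%C).
Local Notation V := 'M[C]_(m, n).
Local Notation G := (gmap (gramC Q)).
Local Notation E := (ED_correspondence Q).
Implicit Types (u X Y Z : V) (x a : 'cV[C]_m) (y b : 'rV[C]_n).

Lemma tangent_EDP x y u Y Z : x != 0 -> y != 0 -> critical Q u (x *m y) ->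
  tangent E (pair_mx (x *m y) u) (vec2 Y Z) <->
  ED_linear (gramC Q) x y (G (u - x *m y)) Y Z.
Proof.
by move=> x0 y0 c; split; [apply: tangent_ED_linear | apply: linear_tangent_ED].
Qed.

Lemma lindim_tangent_ED x y u : x != 0 -> y != 0 -> critical Q u (x *m y) ->
  lindim (tangent E (pair_mx (x *m y) u)) = (m * n)%N.
Proof.
move=> x0 y0 c; have T Y Z := tangent_EDP Y Z x0 y0 c.
have [xW Wy] : x^T *m G (u - x *m y) = 0 /\ G (u - x *m y) *m y^T = 0.
  by have [_ /normal_eqs_factor] := critical_eqs c; apply.
move: (G (u - x *m y)) xW Wy T => W xW Wy T.
have [A TA] := tangent_row_space E (pair_mx (x *m y) u).
have {}T Y Z : (vec2 Y Z <= A)%MS <-> ED_linear (gramC Q) x y W Y Z.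
  by rewrite -T TA.
rewrite TA lindim_row_space.
apply: (lagrangian_rank erefl (symp_unit (gramC_unit Q))) => [v v'|v H].
  rewrite -[v]vec2K -[v']vec2K => /T h /T h'.
  exact: (ED_linear_isotropic (gramC_sym Q) h h').
rewrite -[v]vec2K; apply/T; apply: (ED_linear_coisotropic (gramC_sym Q) (gramC_unit Q)) => //.
by move=> Y Z /T h; rewrite vec2K; apply: H.
Qed.

(** When both factors have dimension at least 2 the vertex is singular, so every critical pair has a
    nonzero matrix and a tangent space of dimension m n; semicontinuity extends the bound to the
    closure. *)
Lemma ED_tangent_ge z : (1 < minn m n)%N -> E z -> (m * n <= lindim (tangent E z))%N.
Proof.
move=> N1; apply: lindim_tangent_ge => _ [X [v [c ->]]].
have [m0 n0] : (0 < m)%N /\ (0 < n)%N by move: N1; rewrite leq_min => /andP[]; lia.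
have X0 : X != 0.
  apply: contraTneq N1 => X0; move: c; rewrite X0 => -[s _]; rewrite -leqNgt.
  by rewrite /cone_smooth linear0 in s; apply: (@vertex_smooth C m n).
have [[x [y [x0 y0 e]]] _] : (exists x y, [/\ x != 0, y != 0 & X = x *m y]) /\ True.
  by split=> //; have [CX _] := iffLR (critical_neq0 Q v X0) c; apply: segreP.
by rewrite e in c *; rewrite lindim_tangent_ED.
Qed.

(** The tangent vector [(Y, 0)] is killed by the second projection, whose rank on the tangent space
    is thus below m n. The point is smooth because its tangent space has the least dimension allowed
    by [ED_tangent_ge]. *)
Lemma critical_value x y u Y : (1 < minn m n)%N -> x != 0 -> y != 0 ->
  critical Q u (x *m y) -> Y != 0 ->
  ED_linear (gramC Q) x y (G (u - x *m y)) Y 0 -> critical_values Q u.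
Proof.
move=> N1 x0 y0 c Y0 /(iffRL (tangent_EDP _ _ x0 y0 c)) T; exists (x *m y).
have dT := lindim_tangent_ED x0 y0 c; split.
  split; first exact: critical_ED.
  by move=> z Ez; rewrite dT; apply: ED_tangent_ge.
have [A TA] := tangent_row_space E (pair_mx (x *m y) u).
rewrite TA /= in T; rewrite TA lindim_row_space in dT.
pose P : 'M[C]_(m * n + m * n, m * n) := col_mx 0 1%:M.
have PE (v : 'rV[C]_(m * n + m * n)) : rsubmx v = v *m P.
  by rewrite -[in RHS](hsubmxK v) mul_row_col mulmx0 mulmx1 add0r.
apply: (@leq_ltn_trans (\rank (A *m P))).
  rewrite -lindim_row_space; apply: lindim_sub => _ [v + <-]; rewrite TA PE /= => vA.
  exact: submxMr.
have := mxrank_mul_ker A P; rewrite dT.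
suff : (0 < \rank (A :&: kermx P)%MS)%N by move: (\rank _) (\rank _) => r1 r2; lia.
rewrite lt0n mxrank_eq0; apply: contraNneq Y0 => k0.
have : (vec2 Y 0 <= A :&: kermx P)%MS.
  rewrite sub_capmx T; apply/sub_kermxP; by rewrite -PE row_mxKr linear0.
rewrite k0 submx0 => /eqP /(congr1 lsubmx); rewrite row_mxKl linear0 => e.
by apply/eqP/(can_inj mxvecK); rewrite e linear0.
Qed.

End EDDiscriminant.

End Discriminant.

(** * Generic data have corank at most one *)

Module GenericRank.
Import complex mpoly.
Import Order.TTheory GRing.Theory Num.Theory.
Import Polynomials Tangents Segre EDTheory TangentED Discriminant.
Local Open Scope classical_set_scope.
Local Open Scope ring_scope.

(** For the matrix t p q and the normal vector w + t v, the parameter t cancels from the linearized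
    equations in the direction [(D, 0)]: one [v] serves for all t <> 0, arbitrarily close to 0. *)
Lemma degenerate_linear (K : numFieldType) m n (L : 'M[K]_(m * n)) (p a : 'rV[K]_m)
    (q b : 'rV[K]_n) (w v : 'M[K]_(m, n)) t : t != 0 ->
  p *m w = 0 -> a *m w = 0 -> w *m q^T = 0 -> w *m b^T = 0 -> p *m v = 0 -> v *m q^T = 0 ->
  let D := p^T *m b + a^T *m q in
  a *m v = p *m gmap L D -> v *m b^T = gmap L D *m q^T ->
  let x := t *: p^T in let W := w + t *: v in
  [/\ x^T *m W = 0, W *m q^T = 0 & ED_linear L x q W D 0].
Proof.
move=> t0 pw aw wq wb pv vq D av vb x W.
have xT : x^T = t *: p by rewrite linearZ /= trmxK.
split.
- by rewrite xT -scalemxAl mulmxDr pw -scalemxAr pv scaler0 addr0 scaler0.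
- by rewrite mulmxDl wq -scalemxAl vq scaler0 addr0.
exists a^T, (t^-1 *: b); split.
- by rewrite /x -scalemxAl -scalemxAr scalerA mulfV // scale1r addrC.
- rewrite xT sub0r gmapN mulmxN -scalemxAl -av trmxK mulmxDr aw add0r.
  by rewrite -scalemxAr.
- rewrite sub0r gmapN mulNmx -vb linearZ /= mulmxDl -scalemxAr wb scaler0 add0r.
  by rewrite -scalemxAl -scalemxAr scalerA mulfV // scale1r.
Qed.

(** The column [c] separates [a] from [p]; it serves to build a matrix with prescribed products with
    both. *)
Lemma two_in_kernel (K : fieldType) m n (A : 'M[K]_(m, n)) : (\rank A + 2 <= m)%N ->
  exists (p a : 'rV[K]_m) (c : 'cV[K]_m),
    [/\ p *m A = 0, a *m A = 0, p != 0, p *m c = 0 & a *m c = 1%:M].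
Proof.
move=> rA; have r2 : (2 <= \rank (kermx A))%N by rewrite mxrank_ker; lia.
have /rowV0Pn[p /sub_kermxP pA p0] : kermx A != 0 by rewrite -mxrank_eq0; lia.
have /row_subPn[i ai] : ~~ (kermx A <= p)%MS.
  by apply/negP => /mxrankS; rewrite rank_rV p0; lia.
move: ai; rewrite submxE => /rV0Pn[j aj].
pose a := row i (kermx A).
exists p, a, (((a *m cokermx p) 0 j)^-1 *: col j (cokermx p)); split=> //.
- by apply/sub_kermxP/row_sub.
- have pc : p *m col j (cokermx p) = 0 by rewrite colE mulmxA (mulmx_coker p) mul0mx.
  by rewrite -scalemxAr pc scaler0.
- have pc : a *m col j (cokermx p) = col j (a *m cokermx p) by rewrite !colE mulmxA.
  rewrite -scalemxAr -/a pc; apply/matrixP => k l; rewrite !ord1.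
  by rewrite [LHS]mxE [in X in _ * X]mxE mulVf // mxE.
Qed.

Section Degeneracy.
Context {R : realType} {m n : nat} (Q : inner_product 'M[R]_(m, n)).
Local Notation w := (gmap (gram_mx Q)).
Implicit Types (u : 'M[R]_(m, n)) (p a : 'rV[R]_m) (q b : 'rV[R]_n).

Lemma inner_colrow D p q : Q D (p^T *m q) = (p *m w D *m q^T) 0 0.
Proof. by rewrite inner_gmap fr_colrow trmxK. Qed.

Lemma innerZr t X Z : Q Z (t *: X) = t * Q Z X.
Proof. by rewrite inner_sym innerZ (inner_sym Q Z). Qed.

Lemma orth_correction X Y : Y != 0 -> exists t, Q (X - t *: Y) Y = 0.
Proof.
move=> Y0; exists (Q X Y / Q Y Y).
by rewrite -scaleNr innerD innerZ mulNr mulfVK ?subrr // gt_eqF ?inner_gt0.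
Qed.

(* The points s (p (x) q) with p, q in the two kernels of the Gram image of u,
   and normal vectors close to u, can be chosen such that the second
   fundamental form is degenerate: then u is a limit of critical values. *)
Lemma degenerate_pair u : (\rank (w u) + 2 <= minn m n)%N ->
  exists p a q b (v : 'M[R]_(m, n)), [/\ [/\ p != 0, q != 0 & p^T *m b + a^T *m q != 0],
    [/\ p *m w u = 0, a *m w u = 0, w u *m q^T = 0 & w u *m b^T = 0] &
    [/\ p *m v = 0, v *m q^T = 0, a *m v = p *m w (p^T *m b + a^T *m q) &
        v *m b^T = w (p^T *m b + a^T *m q) *m q^T]].
Proof.
rewrite leq_min => /andP[rm rn].
have [p [a0 [c [pw a0w p0 pc a0c]]]] := two_in_kernel rm.
have [|q [b0 [d [qw b0w q0 qd b0d]]]] := @two_in_kernel _ _ _ (w u)^T; first by rewrite mxrank_tr.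
have wT (z : 'rV_n) : z *m (w u)^T = 0 -> w u *m z^T = 0.
  by move=> e; apply: trmx_inj; rewrite trmx_mul trmxK e trmx0.
pose pq := p^T *m q.
have pq0 : pq != 0 by rewrite mul_colrow_eq0 negb_or trmx_eq0 p0.
(* Multiplying the four conditions on [v] by the vectors on the other side shows when they are
   compatible: [D] must be orthogonal to [p^T *m q], which these corrections achieve, and must have
   the same product with [p^T *m b] as with [a^T *m q]. *)
have [t aq] := orth_correction (a0^T *m q) pq0.
have [t' pb] := orth_correction (p^T *m b0) pq0.
pose a := a0 - t *: p; pose b1 := b0 - t' *: q.
have ac : a *m c = 1%:M by rewrite mulmxBl a0c -scalemxAl pc scaler0 subr0.
have b1d : b1 *m d = 1%:M by rewrite mulmxBl b0d -scalemxAl qd scaler0 subr0.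
have aw : a *m w u = 0 by rewrite mulmxBl a0w -scalemxAl pw scaler0 subr0.
have b1w : w u *m b1^T = 0 by apply: wT; rewrite mulmxBl b0w -scalemxAl qw scaler0 subr0.
have {}aq : Q (a^T *m q) pq = 0.
  by rewrite -[RHS]aq /a linearB linearZ /= mulmxBl -scalemxAl.
have {}pb : Q (p^T *m b1) pq = 0 by rewrite -[RHS]pb mulmxBr -scalemxAr.
have nz1 (k : nat) (x : 'rV[R]_k) (y : 'cV[R]_k) : x *m y = 1%:M -> x != 0.
  move=> e; apply/eqP => x0; move: e; rewrite x0 mul0mx => /matrixP/(_ 0 0).
  by rewrite !mxE => /eqP; rewrite eq_sym oner_eq0.
have aq0 : a^T *m q != 0 by rewrite mul_colrow_eq0 negb_or trmx_eq0 (nz1 _ _ _ ac).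
have pb0 : p^T *m b1 != 0 by rewrite mul_colrow_eq0 negb_or trmx_eq0 p0 (nz1 _ _ _ b1d).
have Naq := inner_gt0 Q aq0; have Npb := inner_gt0 Q pb0.
(* The scaling gives [p^T *m b] the same length as [a^T *m q], so that their sum [D] has the same
   product with both. *)
pose s := Num.sqrt (Q (a^T *m q) (a^T *m q) / Q (p^T *m b1) (p^T *m b1)).
have s0 : 0 < s by rewrite sqrtr_gt0 divr_gt0.
have ss : s * s = Q (a^T *m q) (a^T *m q) / Q (p^T *m b1) (p^T *m b1).
  by rewrite -expr2 sqr_sqrtr // ltW // divr_gt0.
pose b := s *: b1; pose D := p^T *m b + a^T *m q.
have pbE : p^T *m b = s *: (p^T *m b1) by rewrite -scalemxAr.
pose e := s^-1 *: d.
have be : b *m e = 1%:M by rewrite /b /e -scalemxAl -scalemxAr scalerA mulfV ?gt_eqF // b1d scale1r.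
have qe : q *m e = 0 by rewrite -scalemxAr qd scaler0.
have Dpq : Q D pq = 0 by rewrite innerD pbE innerZ pb aq mulr0 addr0.
have Dab : Q D (p^T *m b) = Q D (a^T *m q).
  rewrite !innerD (inner_sym Q (p^T *m b) (a^T *m q)) addrC; congr (_ + _).
  by rewrite pbE innerZ innerZr mulrA ss mulfVK ?gt_eqF.
pose g := p *m w D; pose h := w D *m q^T.
have ph : p *m h = 0 by apply/matrixP => i j; rewrite !ord1 mulmxA -inner_colrow Dpq mxE.
have gq : g *m q^T = 0 by rewrite -mulmxA ph.
pose kap := Q D (p^T *m b).
have gb : g *m b^T = kap%:M.
  by apply/matrixP => i j; rewrite !ord1 -inner_colrow mxE eqxx.
have ah : a *m h = kap%:M.
  by apply/matrixP => i j; rewrite !ord1 mulmxA -inner_colrow /kap Dab mxE eqxx.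
have eb : e^T *m b^T = 1%:M by rewrite -trmx_mul be trmx1.
have eq' : e^T *m q^T = 0 by rewrite -trmx_mul qe trmx0.
have [gE hE] : p *m w D = g /\ w D *m q^T = h by [].
rewrite -/D in gE hE *; clearbody g h.
(* The first term realizes the product prescribed with [a], the second the one with [b], and the
   third removes the value [kap], counted by both. *)
exists p, a, q, b, (c *m g + h *m e^T - kap *: (c *m e^T)); split; split=> //.
- apply/eqP => D0; case/negP: q0; apply/eqP.
  have := congr1 (mulmx c^T) D0; rewrite mulmx0 mulmxDr !mulmxA -!trmx_mul pc ac.
  by rewrite trmx0 mul0mx add0r trmx1 mul1mx.
- exact: wT.
- by rewrite linearZ /= -scalemxAr b1w scaler0.
- by rewrite mulmxBr mulmxDr -scalemxAr !mulmxA pc ph !mul0mx scaler0 addr0 subrr.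
- by rewrite mulmxBl mulmxDl -scalemxAl -!mulmxA gq eq' !mulmx0 scaler0 addr0 subrr.
- by rewrite gE mulmxBr mulmxDr -scalemxAr !mulmxA ac ah !mul1mx mul_scalar_mx addrK.
- by rewrite hE mulmxBl mulmxDl -scalemxAl -!mulmxA gb eb !mulmx1 mul_mx_scalar addrC addKr.
Qed.

Lemma generic_rank u : generic_data Q u -> (minn m n <= (\rank (w u)).+1)%N.
Proof.
move=> gen; rewrite leqNgt; apply/negP => rk; apply: gen.
have N1 : (1 < minn m n)%N by lia.
have [|p [a [q [b [v [[p0 q0 D0] [pw aw wq wb] [pv vq av vb]]]]]]] := @degenerate_pair u.
  by rewrite addn2.
set D := p^T *m b + a^T *m q in D0 av vb.
pose rc k l := @map_mx _ _ (real_complex R) k l.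
(* For each positive integer k, k p q is a degenerate critical point for u + k [dir]; at k = 0 the
   curve of these critical values passes through [u]. *)
pose dir : 'M[R]_(m, n) := p^T *m q + gmap (invmx (gram_mx Q)) v.
have cl := curvem_mxvec (curvem_line (complexify u) (complexify dir)).
have := curve_zclosure cl (S := mxvec @` critical_values Q).
rewrite scale0r addr0; apply => k k0; exists (complexify u + k%:R *: complexify dir) => //.
have t0 : k%:R != 0 :> R[i]%C by rewrite pnatr_eq0 -lt0n.
have rcM k1 k2 k3 (A : 'M[R]_(k1, k2)) (A' : 'M[R]_(k2, k3)) :
  rc _ _ (A *m A') = rc _ _ A *m rc _ _ A' by apply: map_mxM.
have rcT k1 k2 (A : 'M[R]_(k1, k2)) : rc _ _ A^T = (rc _ _ A)^T.
  by apply/matrixP => i j; rewrite !mxE.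
have rcD : rc _ _ D = (rc _ _ p)^T *m rc _ _ b + (rc _ _ a)^T *m rc _ _ q.
  by rewrite -!rcT -!rcM -map_mxD.
have GD : gmap (gramC Q) (rc _ _ D) = rc _ _ (w D) by apply: complexify_gmap.
have rc0 k1 k2 : rc k1 k2 0 = 0 by apply: map_mx0.
have [||||||||xW Wq lin] := @degenerate_linear _ m n (gramC Q) (rc _ _ p) (rc _ _ a)
  (rc _ _ q) (rc _ _ b) (rc _ _ (w u)) (rc _ _ v) _ t0.
- by rewrite -rcM pw rc0.
- by rewrite -rcM aw rc0.
- by rewrite -rcT -rcM wq rc0.
- by rewrite -rcT -rcM wb rc0.
- by rewrite -rcM pv rc0.
- by rewrite -rcT -rcM vq rc0.
- by rewrite -rcD GD -!rcM av.
- by rewrite -rcD GD -!rcT -!rcM vb.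
rewrite -rcD in lin.
pose c := k%:R : R[i]%C; rewrite -/c in t0 xW lin *.
have xy : complexify u + c *: complexify dir - c *: (rc _ _ p)^T *m rc _ _ q =
    complexify u + c *: complexify (gmap (invmx (gram_mx Q)) v).
  have -> : complexify dir = (rc _ _ p)^T *m rc _ _ q + complexify (gmap (invmx (gram_mx Q)) v).
    by rewrite -rcT -rcM -map_mxD.
  by rewrite -scalemxAl scalerDr addrA addrAC addrK.
have GE : gmap (gramC Q) (complexify u + c *: complexify dir - c *: (rc _ _ p)^T *m rc _ _ q) =
    rc _ _ (w u) + c *: rc _ _ v.
  by rewrite xy gmapD gmapZ !complexify_gmap gmapVK // gram_mx_unit.
have rcN k1 k2 (A : 'M[R]_(k1, k2)) : A != 0 -> rc _ _ A != 0.
  by apply: contraNneq => A0; apply/eqP/(@map_mx_inj _ _ (real_complex R));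
    exact: etrans A0 (esym (rc0 _ _)).
have x0 : c *: (rc _ _ p)^T != 0 by rewrite scaler_eq0 negb_or t0 trmx_eq0 rcN.
have y0 := rcN _ _ _ q0.
apply: (critical_value N1 x0 y0 _ (rcN _ _ _ D0)).
  apply/critical_neq0; first by rewrite mul_colrow_eq0 negb_or x0.
  by split; [exists (c *: (rc _ _ p)^T) => //; exists (rc _ _ q) | apply/normal_eqs_factor;
    rewrite // GE].
by rewrite GE.
Qed.

End Degeneracy.
End GenericRank.

(** * The lower bound for real critical points *)

Module RealCount.
Import complex mpoly.
Import Order.TTheory GRing.Theory Num.Theory.
Import Polynomials Tangents Segre EDTheory GenericRank Cardinals.
Local Open Scope classical_set_scope.
Local Open Scope ring_scope.

Lemma count_critical (R : realType) m n (B : 'M[R]_(m.+1, n) -> 'M[R]_(m.+1, n) -> R)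
    (G : 'M[R]_(m.+1, n) -> 'M[R]_(m.+1, n)) (w : 'M[R]_(m.+1, n)) (s : seq 'M[R]_(m.+1, n)) :
  (forall X Y Z, B (X + Y) Z = B X Z + B Y Z) -> (forall t X Z, B (t *: X) Z = t * B X Z) ->
  (forall X Z, B X Z = B Z X) -> (forall X, X != 0 -> 0 < B X X) ->
  (forall X i j, G X i j = B X (delta_mx i j)) -> (m <= \rank w)%N ->
  (forall X, X != 0 -> segre_cone R m.+1 n X -> X^T *m (w - G X) = 0 ->
     (w - G X) *m X^T = 0 -> X \in s) ->
  ((\rank w < m.+1)%N -> 0 \in s) -> (m < size s)%N.
Proof.
move=> BD BZ Bs B0 GB rw sX s0.
apply: (RealCritical.real_critical_points BD BZ Bs B0 rw) => x y x0.
have -> : RealCritical.gram B (x^T *m y) = G (x^T *m y) by apply/matrixP => i j; rewrite mxE GB.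
have [->|y0] := eqVneq y 0 => xW Wy.
  rewrite mulmx0; apply: s0; rewrite ltn_neqAle rank_leq_row andbT.
  have G0 : G 0 = 0.
    apply/matrixP => i j; rewrite GB mxE; have := BZ 0 0 (delta_mx i j).
    by rewrite scaler0 mul0r.
  apply: contraNneq x0 => rk; have wf : row_free w by apply/eqP.
  move: xW; rewrite mulmx0 G0 subr0 => xW.
  by apply/eqP/(row_free_inj wf); rewrite /= mul0mx.
apply: sX; first by rewrite mul_colrow_eq0 negb_or trmx_eq0 x0.
- by exists x^T => //; exists y.
- by apply/mul_tr_colrow => //; rewrite trmxK.
- by apply/mul_colrow_tr => //; rewrite trmx_eq0.
Qed.

Section RealPoints.
Context {R : realType} {m n : nat} (Q : inner_product 'M[R]_(m.+1, n.+1)).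
Local Notation w := (gmap (gram_mx Q)).
Implicit Types u X : 'M[R]_(m.+1, n.+1).

(** The topological bound is the dimension of the factor whose sphere is used; when the second
    factor is the smaller one, the problem is transposed. *)
Lemma real_count u s : (minn m.+1 n.+1 <= (\rank (w u)).+1)%N ->
  (forall X, X != 0 -> segre_cone R m.+1 n.+1 X -> X^T *m w (u - X) = 0 ->
     w (u - X) *m X^T = 0 -> X \in s) ->
  ((\rank (w u) < minn m.+1 n.+1)%N -> 0 \in s) -> (minn m.+1 n.+1 <= size s)%N.
Proof.
move=> rw sX s0.
have wE X i j : w X i j = Q X (delta_mx i j) by rewrite inner_gmap fr_delta.
have [mn|/ltnW nm] := leqP m n.
  have e : minn m.+1 n.+1 = m.+1 by apply/minn_idPl.
  rewrite e in rw s0 *; apply: (@count_critical _ _ _ (fun X Y => Q X Y) w (w u)) => //.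
  - exact: innerD.
  - exact: innerZ.
  - exact: inner_sym.
  - exact: inner_gt0.
  - by move=> X X0 CX; rewrite -gmapB; apply: sX.
have e : minn m.+1 n.+1 = n.+1 by apply/minn_idPr.
rewrite e in rw s0 *; rewrite -(size_map (@trmx R m.+1 n.+1)).
pose B (X Y : 'M[R]_(n.+1, m.+1)) := Q X^T Y^T.
apply: (@count_critical R n m.+1 B (fun Y => (w Y^T)^T) (w u)^T).
- by move=> X Y Z; rewrite /B linearD innerD.
- by move=> t X Z; rewrite /B linearZ innerZ.
- by move=> X Y; rewrite /B inner_sym.
- by move=> X X0; apply: inner_gt0; rewrite trmx_eq0.
- by move=> X i j; rewrite mxE wE /B trmx_delta.
- by rewrite mxrank_tr.
- move=> X X0 [x _ [y _ xy]] XW WX; rewrite -[X]trmxK; apply: map_f; apply: sX.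
  + by rewrite trmx_eq0.
  + by exists y^T => //; exists x^T => //; rewrite -trmx_mul xy.
  + by rewrite gmapB; apply: trmx_inj; rewrite trmx_mul trmxK linearB trmx0 /= WX.
  + by rewrite gmapB trmxK; apply: trmx_inj; rewrite trmx_mul linearB trmx0 /= XW.
- by rewrite mxrank_tr => rk; rewrite -trmx0; apply: map_f; apply: s0.
Qed.

Local Opaque gmap gramC.
Local Notation G := (gmap (gramC Q)).

Lemma rank_complexify u : \rank (G (complexify u)) = \rank (w u).
Proof. by rewrite complexify_gmap mxrank_map. Qed.

Lemma critical_complexify u X : X != 0 -> segre_cone R m.+1 n.+1 X ->
  X^T *m w (u - X) = 0 -> w (u - X) *m X^T = 0 -> critical Q (complexify u) (complexify X).
Proof.
move=> X0 [x _ [y _ xy]] XW WX.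
have cB : complexify u - complexify X = complexify (u - X) by rewrite /complexify map_mxB.
have cT : (complexify X)^T = map_mx (real_complex R) X^T by rewrite /complexify map_trmx.
apply/critical_neq0.
  apply: contraNneq X0 => X0; apply/eqP/complexify_inj; rewrite X0.
  by rewrite /complexify map_mx0.
split; first by exists (map_mx (real_complex R) x) => //;
  exists (map_mx (real_complex R) y) => //; rewrite -map_mxM xy.
rewrite /normal_eqs cB complexify_gmap cT /complexify.
by rewrite -!map_mxM XW WX !map_mx0.
Qed.

Lemma vertex_fiber (u : 'M[R[i]%C]_(m.+1,
  n.+1)) : ED_fiber Q u 0 <-> (\rank (G u) < minn m.+1 n.+1)%N.
Proof.
split; first exact: ED_fiber0_rank.
rewrite leq_min => /andP[rm rn].
have /rowV0Pn[x /sub_kermxP xA x0] : kermx (G u) != 0.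
  by rewrite -mxrank_eq0 mxrank_ker subn_eq0 -ltnNge.
have /rowV0Pn[y /sub_kermxP yA y0] : kermx (G u)^T != 0.
  by rewrite -mxrank_eq0 mxrank_ker mxrank_tr subn_eq0 -ltnNge.
apply: (@ED_vertex _ _ _ Q u x^T y) => //; first by rewrite trmx_eq0.
  by rewrite trmxK.
by apply: trmx_inj; rewrite trmx_mul trmxK yA trmx0.
Qed.

Lemma vertex_real_critical u : (0 < minn m n)%N ->
  (\rank (w u) < minn m.+1 n.+1)%N -> real_critical Q u 0.
Proof.
move=> mn rk; split; first by exists 0 => //; exists 0; rewrite ?mulmx0.
have c0 : complexify (0 : 'M[R]_(m.+1, n.+1)) = 0 by rewrite /complexify map_mx0.
rewrite c0; right; split; last by apply/vertex_fiber; rewrite rank_complexify.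
rewrite /cone_smooth linear0 => /vertex_smooth; rewrite minnSS => /(_ isT isT); lia.
Qed.

(** If one factor is a line, the cone is the whole space and [u] is a critical point for itself. The
    case is apart because the vertex is then smooth and cannot be counted as a singular point. *)
Lemma real_critical_nonempty u : minn m n = 0%N -> exists X, real_critical Q u X.
Proof.
move=> mn0; exists u; have Cu : segre_cone R m.+1 n.+1 u.
  apply: minors_segre => i k j l; have [m0|n0] : m = 0%N \/ n = 0%N by lia.
    have -> : i = k by apply: val_inj => /=; have := ltn_ord i; have := ltn_ord k; lia.
    by rewrite mulrC subrr.
  have -> : j = l by apply: val_inj => /=; have := ltn_ord j; have := ltn_ord l; lia.
  by rewrite subrr.
split=> //; have [->|u0] := eqVneq u 0; last first.
  by left; apply: critical_complexify; rewrite ?subrr ?gmap0 ?mulmx0 ?mul0mx.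
have -> : complexify (0 : 'M[R]_(m.+1, n.+1)) = 0 by rewrite /complexify map_mx0.
case: (pselect (cone_smooth (0 : 'M[R[i]%C]_(m.+1, n.+1)))) => c0; [left|right]; split=> //.
  by move=> v _; rewrite subrr cformE gmap0 /fr linear0 mul0mx mxE.
by apply/vertex_fiber; rewrite gmap0 mxrank0 minnSS.
Qed.

Theorem real_critical_card u : generic_data Q u ->
  (`I_(minn m n).+1 #<= real_critical Q u)%card.
Proof.
move=> /generic_rank gen; apply: contrapT => /card_lt_seq[s sN sE].
have [mn0|mn0] := posnP (minn m n).
  have [X] := real_critical_nonempty u mn0; rewrite sE /= => Xs.
  by move: sN Xs; rewrite mn0 ltnS leqn0 => /nilP ->.
move: sN; rewrite -minnSS ltnNge => /negP; apply; apply: real_count gen _ _ => [X X0 CX XW WX|rk].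
  have : real_critical Q u X by split=> //; left; apply: critical_complexify.
  by rewrite sE.
by have := vertex_real_critical mn0 rk; rewrite sE.
Qed.

End RealPoints.
End RealCount.

(** * Existence of the ED degree and its lower bound *)

Module EDDegree.
Import complex mpoly.
Import Order.TTheory GRing.Theory Num.Theory.
Import Polynomials Tangents FiniteFibers Segre EDTheory TangentED GenericRank Cardinals Definability RealCount.
Local Open Scope classical_set_scope.
Local Open Scope ring_scope.

Section Parametrization.
Context {K : fieldType} {m n : nat} (L : 'M[K]_(m * n)).
Local Notation V := 'M[K]_(m, n).
Local Notation G := (gmap L).
Implicit Types (X u W Z : V) (x : 'cV[K]_m) (y : 'rV[K]_n).

Lemma chart_entry i j x y Z k l : k != i -> l != j ->
  (chartl i x *m Z *m chartr j y) k l = x i 0 * y 0 j * Z k l.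
Proof.
move=> ki lj.
have rowP (M : V) : (chartl i x *m M) k l = x i 0 * M k l.
  rewrite /chartl mulmxBl mul_scalar_mx -mulmxA [LHS]mxE [X in X + _]mxE [X in _ + X]mxE.
  by rewrite [X in _ - X]mxE big1 ?subr0 // => z _; rewrite mxE (negPf ki) mul0r.
rewrite -mulmxA rowP -mulrA; congr (_ * _).
rewrite /chartr mulmxBr mul_mx_scalar mulmxA [LHS]mxE [X in X + _]mxE [X in _ + X]mxE.
by rewrite [X in _ - X]mxE big1 ?subr0 // => z _;
  rewrite [delta_mx _ _ _ _]mxE (negPf lj) andbF mulr0.
Qed.

(** A chart of the critical pairs with as many parameters as the space has dimensions: row [i] of
    [Z] is [y], the rest of column [j] gives [x] normalized by [x i 0 = 1], and the other entries
    give the normal vector through [chartl] and [chartr]. *)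
Definition param_x i j Z : 'cV[K]_m := \col_k (if k == i then 1 else Z k j).
Definition param_X i j Z : V := param_x i j Z *m row i Z.
Definition param_u i j Z : V := param_X i j Z +
  gmap (invmx L) (chartl i (param_x i j Z) *m Z *m chartr j (row i Z)).

Lemma param_onto i j u X : L \in unitmx -> minors_vanish X ->
  X^T *m G (u - X) = 0 -> G (u - X) *m X^T = 0 -> X i j != 0 ->
  exists Z, param_X i j Z = X /\ param_u i j Z = u.
Proof.
move=> uL mX XW WX Xij; set x := (X i j)^-1 *: col j X; set y := row i X.
have XE : X = x *m y by apply: minors_factor.
have xi : x i 0 = 1 by rewrite !mxE mulVf.
have yj : y 0 j = X i j by rewrite mxE.
have x0 : x != 0 by apply/cV0Pn; exists i; rewrite xi oner_neq0.
have y0 : y != 0 by apply/rV0Pn; exists j; rewrite yj.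
have WE : G (u - X) = G (u - X) by [].
move: {1 3 4}(G (u - X)) WE XW WX => W WE XW WX.
have {}XW : x^T *m W = 0.
  by move: XW; rewrite XE; apply: (iffLR (mul_tr_colrow _ _ y0)).
have {}WX : W *m y^T = 0.
  by move: WX; rewrite XE; apply: (iffLR (mul_colrow_tr _ _ x0)).
pose Z : V := \matrix_(k, l) if k == i then y 0 l else if l == j then x k 0 else W k l / y 0 j.
have xZ : param_x i j Z = x.
  apply/matrixP => k z; rewrite (ord1 z) !mxE eqxx.
  by case: eqVneq => [->|_]; rewrite ?mulVf // !mxE.
have yZ : row i Z = y by apply/rowP => l; rewrite !mxE eqxx.
exists Z; rewrite /param_u /param_X xZ yZ -XE; split=> //.
suff -> : chartl i x *m Z *m chartr j y = W by rewrite WE gmapK // addrC subrK.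
apply/eqP; rewrite -subr_eq0; apply/eqP; apply: (@normal_eq0 K m n i j x y).
- by rewrite xi oner_neq0.
- by rewrite yj.
- by rewrite mulmxBr !mulmxA mul_chartl0 !mul0mx XW subrr.
- by rewrite mulmxBl -!mulmxA mul_chartr0 !mulmx0 WX subrr.
move=> k l ki lj; rewrite [LHS]mxE [X in _ + X]mxE chart_entry // xi mul1r [Z k l]mxE (negPf ki) (negPf lj).
by rewrite yj mulrC divfK ?subrr.
Qed.

Section Entries.
Context {T : Type} (P : (T -> K) -> Prop) (PA : fun_algebra P).
Implicit Types (F : T -> V).

Lemma entries_sub p q (A B : T -> 'M[K]_(p, q)) : entries P A -> entries P B ->
  entries P (fun t => A t - B t).
Proof. by move=> PF PG; apply: (entriesD PA) => //; apply: (entriesN PA). Qed.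

Lemma entries_param_x i j F : entries P F -> entries P (fun t => param_x i j (F t)).
Proof.
move=> PF k z; have [Pc _ _] := PA.
case: (eqVneq k i) => [->|ki]; first by apply: fun_algebra_ext (Pc 1) => t; rewrite mxE eqxx.
by apply: fun_algebra_ext (PF k j) => t; rewrite mxE (negPf ki).
Qed.

Lemma entries_row i F : entries P F -> entries P (fun t => row i (F t)).
Proof. by move=> PF k l; apply: fun_algebra_ext (PF i l) => t; rewrite mxE. Qed.

Lemma entries_param_X i j F : entries P F -> entries P (fun t => param_X i j (F t)).
Proof.
by move=> PF; apply: (entriesM PA); [apply: entries_param_x | apply: entries_row].
Qed.

Lemma entries_scalar p (f : T -> K) : P f -> entries P (fun t => (f t)%:M : 'M[K]_p).
Proof.
move=> Pf; have Pz := entriesZ PA Pf (entries_cst PA (1%:M : 'M_p)).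
by move=> k l; apply: fun_algebra_ext (Pz k l) => t; rewrite scalemx1.
Qed.

Lemma entries_param_u i j F : entries P F -> entries P (fun t => param_u i j (F t)).
Proof.
move=> PF; have Px := entries_param_x i j PF; have Py := entries_row i PF.
apply: (entriesD PA); first exact: entries_param_X.
apply: (entries_gmap _ PA); apply: (entriesM PA).
  apply: (entriesM PA) => //; apply: entries_sub; first exact/entries_scalar/Px.
  by apply: (entriesM PA); [apply: (entries_cst PA) | apply: entries_tr].
apply: entries_sub; first exact/entries_scalar/Py.
by apply: (entriesM PA); [apply: entries_tr | apply: (entries_cst PA)].
Qed.

End Entries.
End Parametrization.

(** Full rank follows from a nonzero determinant against a fixed one-sided inverse of [pid_mx]; it
    is 1 at the data with Gram image [pid_mx]. *)
Lemma generic_full_rank (K : numFieldType) m n (L : 'M[K]_(m * n)) : L \in unitmx ->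
  generically (fun a : 'rV[K]_(m * n) => (minn m n <= \rank (gmap L (vec_mx a)))%N).
Proof.
move=> uL; pose A : 'M[K]_(m, n) := pid_mx (minn m n).
have rA : \rank A = minn m n by rewrite rank_pid_mx ?geq_minl ?geq_minr.
have pG := entries_gmap L polyfun_algebra (entries_vec (@polyfun_id K (m * n))).
have e : gmap L (vec_mx (mxvec (gmap (invmx L) A))) = A by rewrite mxvecK gmapVK.
have [mn|/ltnW nm] := leqP m n.
  have [B AB] : exists B, A *m B = 1%:M.
    by apply/row_freeP; rewrite /row_free rA (minn_idPl mn).
  have := generically_polyfun (b := mxvec (gmap (invmx L) A))
    (fun_algebra_det polyfun_algebra (entriesM polyfun_algebra pG (entries_cst polyfun_algebra B))).
  rewrite e AB det1 oner_neq0 => /(_ isT); apply: generically_imp => a.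
  rewrite -unitfE -unitmxE => /mxrank_unit r.
  by have := mxrankM_maxl (gmap L (vec_mx a)) B; rewrite r.
have [B BA] : exists B, B *m A = 1%:M.
  by apply/row_fullP; rewrite /row_full rA (minn_idPr nm).
have := generically_polyfun (b := mxvec (gmap (invmx L) A))
  (fun_algebra_det polyfun_algebra (entriesM polyfun_algebra (entries_cst polyfun_algebra B) pG)).
rewrite e BA det1 oner_neq0 => /(_ isT); apply: generically_imp => a.
rewrite -unitfE -unitmxE => /mxrank_unit r.
by have := mxrankM_maxr B (gmap L (vec_mx a)); rewrite r.
Qed.

Lemma uniq_entries_size (K : eqType) k (s : seq 'rV[K]_k) (e : seq K) : uniq s ->
  (forall x p, x \in s -> x 0 p \in e) -> (size s <= (size e).+1 ^ k)%N.
Proof.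
move=> us es; pose f (x : 'rV[K]_k) := [ffun p => inord (index (x 0 p) e) : 'I_(size e).+1].
have fi : {in s &, injective f}.
  move=> x y xs ys /ffunP fxy; apply/rowP => p; have := fxy p; rewrite !ffunE.
  move=> /(congr1 val) /=; rewrite !inordK ?ltnS ?index_size // => i.
  by rewrite -(nth_index (x 0 p) (es x p xs)) i nth_index // es.
rewrite -(size_map f); have /card_uniqP <- : uniq (map f s) by rewrite map_inj_in_uniq.
by apply: leq_trans (max_card _) _; rewrite card_ffun !card_ord.
Qed.

Section EDDegree.
Context {R : realType} {m n : nat} (Q : inner_product 'M[R]_(m.+1, n.+1)).
Local Notation C := (R[i]%C).
Local Notation k := (m.+1 * n.+1)%N.
Local Notation V := 'M[C]_(m.+1, n.+1).
Local Notation G := (gmap (gramC Q)).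
Implicit Types (u X : V) (a b : 'rV[C]_k).

(** Criticality off the vertex by equations only, to make it first-order: [critical] quantifies over
    polynomials through [tangent] and [smooth_point]. *)
Definition critical_eq u X := [/\ X != 0, minors_vanish X & normal_eqs Q u X].

Lemma critical_eqP u X : critical_eq u X <-> X != 0 /\ critical Q u X.
Proof.
split=> [[X0 mX NX]|[X0 c]]; first by split=> //; apply/critical_neq0 => //; split=> //;
  apply: minors_segre.
by have [mX NX] := critical_eqs c.
Qed.

Lemma definable_critical o o' : definable (fun s : nat -> C =>
  critical_eq (vec_mx (\row_(i < k) s (o + i)%N)) (vec_mx (\row_(i < k) s (o' + i)%N))).
Proof.
have DA := @definable_fun_algebra C.
have vars q : entries (@definable_fun C) (fun s => vec_mx (\row_(i < k) s (q + i)%N) : V).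
  apply: entries_vec => i j; apply: fun_algebra_ext (definable_var (q + j)%N) => s.
  by rewrite mxE.
have [vU vX] := (vars o, vars o').
have vW := entries_gmap (gramC Q) DA (entries_sub DA vU vX).
have [_ Pa Pm] := DA.
apply: (@definable_ext _ (fun s => ~ (vec_mx (\row_(i < k) s (o' + i)%N) : V) = 0 /\
  (minors_vanish (vec_mx (\row_(i < k) s (o' + i)%N) : V) /\
   normal_eqs Q (vec_mx (\row_(i < k) s (o + i)%N)) (vec_mx (\row_(i < k) s (o' + i)%N))))).
  by move=> s; split=> [[/eqP ? [? ?]]|[/eqP ? ? ?]].
apply: definable_and; first exact/definable_not/definable_eq0_mx/vX.
apply: definable_and.
  do 4![apply: definable_all => ?]; apply: definable_eq; last by case: DA.
  apply: (Pa) => //; first exact: Pm.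
  by apply: fun_algebra_ext (Pm _ _ (let: And3 c _ _ :=
    DA in c (-1)) (Pm _ _ (vX _ _) (vX _ _))) => s; rewrite mulN1r.
apply: definable_and; apply: definable_eq0_mx; apply: (entriesM DA) => //; exact: entries_tr.
Qed.

Lemma polyfun_matrix p q (A : 'rV[C]_k -> 'M[C]_(p, q)) : entries polyfun A ->
  exists f : 'I_p -> 'I_q -> {mpoly C[k]}, forall a i j, A a i j = (f i j).@[a 0].
Proof.
move=> PA; have /choice[f fP] : forall ij : 'I_p * 'I_q, exists f : {mpoly C[k]},
    forall a, A a ij.1 ij.2 = f.@[a 0] by move=> [i j]; apply: PA.
by exists (fun i j => f (i, j)) => a i j; rewrite -(fP (i, j)).
Qed.

(** In the chart at a nonzero entry, both the data and each entry of the critical point are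
    polynomials in [Z], so [generically_finite_values] applies. *)
Lemma finite_entries (t : 'I_m.+1 * 'I_n.+1 * 'I_k) : exists D,
  generically (fun b => exists2 s : seq C, (size s <= D)%N &
    forall x, critical_eq (vec_mx b) (vec_mx x) -> vec_mx x t.1.1 t.1.2 != 0 -> x 0 t.2 \in s).
Proof.
case: t => [[i j] p] /=.
have pv := entries_vec (@polyfun_id C k).
have [X XE] := polyfun_matrix (entries_mxvec (entries_param_X (@polyfun_algebra C k) i j pv)).
have [U UE] := polyfun_matrix (entries_mxvec (entries_param_u (gramC Q) (@polyfun_algebra C k) i j pv)).
have [D gen] := generically_finite_values (X 0 p) (U 0); exists D.
apply: generically_imp gen => b [s sD sP]; exists s => // x [_ mx [XW WX]] xij.
have [Z [ZX Zu]] := param_onto (gramC_unit Q) mx XW WX xij.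
have <- : (X 0 p).@[mxvec Z 0] = x 0 p by rewrite -XE mxvecK ZX vec_mxK.
by apply: sP => q; rewrite -UE mxvecK Zu vec_mxK.
Qed.

Lemma finite_critical : exists D, generically (fun b => forall s : seq 'rV[C]_k, uniq s ->
  (forall x, x \in s -> critical_eq (vec_mx b) (vec_mx x)) -> (size s <= D)%N).
Proof.
have [D DP] := choice finite_entries; exists ((\sum_t D t).+1 ^ k)%N.
apply: generically_imp (generically_all DP) => b bP s us sP.
have [e eP] := choice (fun t => let: ex_intro2 s h h' := bP t in
   ex_intro (fun s => (size s <= D t)%N /\ _) s (conj h h')).
pose E := flatten [seq e t | t <- enum {: 'I_m.+1 * 'I_n.+1 * 'I_k}].
have sE : (size E <= \sum_t D t)%N.
  rewrite size_flatten /shape -map_comp sumnE big_map big_enum /=.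
  by apply: leq_sum => t _; case: (eP t).
apply: leq_trans (_ : (size E).+1 ^ k <= _)%N; last by rewrite leq_exp2r.
apply: uniq_entries_size => // x p xs; have cx := sP x xs.
have [/matrix0Pn[i [j xij]] _ _] := cx.
apply/flattenP; exists (e (i, j, p)); first by apply: map_f; rewrite mem_enum.
by case: (eP (i, j, p)) => _; apply.
Qed.

Lemma generic_critical_card : exists d, generically (fun b =>
  ([set x | critical_eq (vec_mx b) (vec_mx x)] #= `I_d)%card).
Proof.
have [D] := finite_critical; apply: (generic_fiber_card (C := fun a b =>
  critical_eq (vec_mx a) (vec_mx b))).
exact: definable_critical.
Qed.

Lemma ED_fiber_critical u : (minn m.+1 n.+1 <= \rank (G u))%N ->
  ED_fiber Q u = vec_mx @` [set x | critical_eq u (vec_mx x)].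
Proof.
move=> rk; apply/seteqP; split=> [X EX|_ [x /critical_eqP[_ c] <-]]; last exact: critical_ED.
exists (mxvec X); last exact: mxvecK; rewrite /= mxvecK; apply/critical_eqP.
have [X0|X0] := eqVneq X 0; last by split=> //; apply/ED_fiber_neq0.
by move: EX rk; rewrite X0 => /vertex_fiber; rewrite ltnNge => /negPf ->.
Qed.

Lemma is_EDdegree_ex : exists d, is_EDdegree Q d.
Proof.
have [d dP] := generic_critical_card; exists d.
have [Z [cZ ZT ZP]] := generically_closed (generically_and dP (generic_full_rank (gramC_unit Q))).
exists Z; split=> // u /ZP; rewrite mxvecK => -[card_u /ED_fiber_critical ->].
apply: card_eq_trans card_u; apply: inj_card_eq => x y _ _; exact: (can_inj vec_mxK).
Qed.

Lemma EDdegreeP : is_EDdegree Q (EDdegree Q).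
Proof. exact: xgetPex is_EDdegree_ex. Qed.

(** Some data with natural coordinates avoid the exceptional set and have a Gram image of full rank.
    They are real, their real critical points lie in a fiber of [d] elements, and full rank keeps
    the vertex out of the count. *)
Lemma EDdegree_ge d : is_EDdegree Q d -> (minn m.+1 n.+1 <= d)%N.
Proof.
move=> [Z [cZ ZT ZP]].
have [a []] := generically_ex (generically_and (generically_notin_closed cZ ZT)
  (generic_full_rank (gramC_unit Q))).
pose u : 'M[R]_(m.+1, n.+1) := vec_mx (\row_p (a p)%:R).
have -> : \row_p (a p)%:R = mxvec (complexify u).
  rewrite /complexify map_vec_mx vec_mxK; apply/rowP => p.
  by rewrite !mxE rmorph_nat.
move=> /ZP /card_eq_seq[s [us <- sE]]; rewrite mxvecK rank_complexify => rk.
rewrite -(size_map (map_mx (@complex.Re R))).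
apply: (real_count (Q := Q) (u := u)) => [|X X0 CX XW WX|]; first exact: ltnW.
  have : ED_fiber Q (complexify u) (complexify X) by apply/critical_ED/critical_complexify.
  have ReX : map_mx (@complex.Re R) (complexify X) = X by apply/matrixP => i j; rewrite !mxE.
  by rewrite sE /= -{2}ReX; apply: map_f.
by rewrite ltnNge rk.
Qed.

End EDDegree.
End EDDegree.

(** * Frobenius forms and the matching upper bound *)

Module Frobenius.
Import complex mpoly.
Import Order.TTheory GRing.Theory Num.Theory.
Import Polynomials Tangents Segre EDTheory GenericRank Cardinals RealCount EDDegree.
Local Open Scope classical_set_scope.
Local Open Scope ring_scope.

(** Gram-Schmidt: the rank leaves a nonzero vector orthogonal to the rows already found, and it is
    divided by its length. *)
Lemma orthonormal_rows (R : rcfType) n (A : 'M[R]_n) r : A^T = A ->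
  (forall v : 'rV_n, v != 0 -> 0 < (v *m A *m v^T) 0 0) -> (r <= n)%N ->
  exists P : 'M[R]_(r, n), P *m A *m P^T = 1%:M.
Proof.
move=> As Ap; elim: r => [_|r IH rn]; first by exists 0; apply/matrixP => -[].
have [P PA] := IH (ltnW rn).
have /rowV0Pn[v /sub_kermxP vP v0] : kermx (A *m P^T) != 0.
  rewrite -mxrank_eq0 mxrank_ker subn_eq0 -ltnNge.
  exact: leq_ltn_trans (rank_leq_col _) rn.
have Pv : P *m A *m v^T = 0.
  by apply: trmx_inj; rewrite trmx0 !trmx_mul trmxK As.
have c0 := Ap v v0; set c := (v *m A *m v^T) 0 0 in c0.
pose P1 : 'M_(1 + r, n) := col_mx ((Num.sqrt c)^-1 *: v) P.
suff : P1 *m A *m P1^T = 1%:M by exists P1.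
rewrite mul_col_mx tr_col_mx mul_col_row PA linearZ /= -!scalemxAl -!scalemxAr.
rewrite -mulmxA vP Pv !scaler0 [_ *: _](_ : _ = 1%:M) -?scalar_mx_block //.
rewrite [v *m A *m v^T]mx11_scalar -/c !scale_scalar_mx mulrA -invfM -expr2.
by rewrite sqr_sqrtr ?ltW // mulVf ?gt_eqF.
Qed.

Section Eigenvectors.
Context {K : fieldType} {m n : nat} (A : 'M[K]_m.+1) (B : 'M[K]_n).
Implicit Types (u X : 'M[K]_(m.+1, n)) (x : 'cV[K]_m.+1) (e : 'rV[K]_m.+1).

Definition eigen_mx u : 'M[K]_m.+1 := u *m B *m u^T *m A.

(** Invertible exactly when [e] is a cyclic covector of [M]. *)
Definition krylov e (M : 'M[K]_m.+1) : 'M[K]_m.+1 := \matrix_(i < m.+1) (e *m M ^+ i).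

Definition eigen_point u x : 'M[K]_(m.+1, n) :=
  ((x^T *m A *m x) 0 0)^-1 *: (x *m (x^T *m A *m u)).

Lemma eigen_pointZ u x t : t != 0 -> eigen_point u (t *: x) = eigen_point u x.
Proof.
move=> t0; have tx : (t *: x)^T = t *: x^T by rewrite linearZ.
rewrite /eigen_point tx -!scalemxAl -!scalemxAr !scalerA; congr (_ *: _).
by rewrite mxE invfM -mulrA mulrAC mulVf ?mul1r // mulf_neq0.
Qed.

Lemma mx11_mul p (a : 'M[K]_1) (y : 'M[K]_(1, p)) : a *m y = a 0 0 *: y.
Proof. by rewrite {1}[a]mx11_scalar mul_scalar_mx. Qed.

Lemma mx11_mulr p (a : 'M[K]_1) (y : 'M[K]_(p, 1)) : y *m a = a 0 0 *: y.
Proof. by rewrite {1}[a]mx11_scalar mul_mx_scalar. Qed.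

Hypotheses (As : A^T = A) (Au : A \in unitmx) (Bu : B \in unitmx).

(** The equations read x^T A u = q y and u B y^T = r x, so [x] is an eigenvector with eigenvalue q
    r. Over the complex numbers q may vanish at a nonzero [x], but then x^T A u = 0, against the
    rank hypothesis. *)
Lemma critical_eigen u X : row_free (A *m u *m B) -> X != 0 -> minors_vanish X ->
  X^T *m (A *m (u - X) *m B) = 0 -> A *m (u - X) *m B *m X^T = 0 ->
  exists x l, [/\ x != 0, eigen_mx u *m x = l *: x & X = eigen_point u x].
Proof.
move=> fW X0 mX XW WX; have [x [y [x0 y0 XE]]] := segreP (minors_segre mX) X0.
have {}XW : x^T *m (A *m (u - X) *m B) = 0.
  by move: XW; rewrite {1}XE; apply: (iffLR (mul_tr_colrow _ _ y0)).
have {}WX : A *m (u - X) *m B *m y^T = 0.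
  by move: WX; rewrite {2}XE; apply: (iffLR (mul_colrow_tr _ _ x0)).
pose q := (x^T *m A *m x) 0 0; pose r := (y *m B *m y^T) 0 0.
have Y : x^T *m A *m u = q *: y.
  apply: (can_inj (mulmxK Bu)); apply/eqP; rewrite -subr_eq0 -XW XE; apply/eqP.
  by rewrite mulmxBr !mulmxBl mulmxBr -/q !mulmxA -mx11_mul.
have uy : u *m B *m y^T = r *: x.
  apply: (can_inj (mulKmx Au)); apply/eqP; rewrite -subr_eq0 -WX XE; apply/eqP.
  by rewrite mulmxBr !mulmxBl -/r -mx11_mulr !mulmxA.
have q0 : q != 0.
  apply: contraNneq x0 => q0; rewrite -trmx_eq0; apply/eqP/(row_free_inj fW).
  by rewrite /= mul0mx !mulmxA Y q0 scale0r mul0mx.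
exists x, (q * r); split=> //.
  rewrite -scalerA -uy /eigen_mx -!mulmxA scalemxAr; congr (u *m _).
  rewrite scalemxAr; congr (B *m _); apply: trmx_inj.
  by rewrite !trmx_mul trmxK As Y linearZ /= trmxK.
by rewrite /eigen_point Y -scalemxAr scalerA mulVf // scale1r.
Qed.

Lemma krylov_eigen e M x l : M *m x = l *: x ->
  krylov e M *m x = (e *m x) 0 0 *: \col_(i < m.+1) l ^+ i.
Proof.
move=> Mx; have Mi i : M ^+ i *m x = l ^+ i *: x.
  elim: i => [|i IH]; first by rewrite !expr0 mul1mx scale1r.
  by rewrite exprSr -mulmxE -mulmxA Mx -scalemxAr IH scalerA exprS.
apply/matrixP => i j; rewrite (ord1 j).
transitivity ((row i (krylov e M) *m x) 0 0); first by rewrite -row_mul [RHS]mxE.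
by rewrite rowK -mulmxA Mi -scalemxAr [LHS]mxE !mxE mulrC.
Qed.

(** The Krylov matrix sends every eigenvector for [l] to a multiple of one and the same vector, that
    of the powers of [l]. *)
Lemma eigen_line e M x x' l : krylov e M \in unitmx -> x != 0 -> x' != 0 ->
  M *m x = l *: x -> M *m x' = l *: x' -> exists2 t, t != 0 & x' = t *: x.
Proof.
move=> uK x0 x'0 Mx Mx'; have inj := can_inj (@mulKmx _ _ 1 _ uK).
have c0 (z : 'cV[K]_m.+1) : z != 0 -> M *m z = l *: z -> (e *m z) 0 0 != 0.
  move=> z0 Mz; apply: contraNneq z0 => c0; apply/eqP; apply: inj.
  by rewrite mulmx0 (krylov_eigen e Mz) c0 scale0r.
exists ((e *m x') 0 0 / (e *m x) 0 0).
  by rewrite mulf_neq0 ?invr_eq0 ?c0.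
apply: inj; rewrite -scalemxAr !(krylov_eigen e Mx, krylov_eigen e Mx') scalerA.
by rewrite divfK ?c0.
Qed.

(** Critical points inject into the eigenvalues: equal eigenvalues have proportional eigenvectors,
    and [eigen_point] is homogeneous of degree 0. The characteristic polynomial has degree
    [m.+1]. *)
Lemma critical_count e u (s : seq 'M[K]_(m.+1, n)) : krylov e (eigen_mx u) \in unitmx ->
  row_free (A *m u *m B) -> uniq s ->
  (forall X, X \in s -> [/\ X != 0, minors_vanish X, X^T *m (A *m (u - X) *m B) = 0 &
     A *m (u - X) *m B *m X^T = 0]) ->
  (size s <= m.+1)%N.
Proof.
move=> uK fW us sP; pose M := eigen_mx u.
have : forall X, exists xl : 'cV[K]_m.+1 * K, X \in s ->
    [/\ xl.1 != 0, M *m xl.1 = xl.2 *: xl.1 & X = eigen_point u xl.1].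
  move=> X; case: (boolP (X \in s)) => [Xs|_]; last by exists (0, 0).
  have [X0 mX XW WX] := sP X Xs.
  by have [x [l [x0 Mx XE]]] := critical_eigen fW X0 mX XW WX; exists (x, l).
move=> /choice[f fP]; pose ev X := (f X).2.
have evi : {in s &, injective ev}.
  move=> X X' Xs X's ee; have [x0 Mx ->] := fP X Xs; have [x'0 Mx' ->] := fP X' X's.
  rewrite -[(f X').2]ee in Mx'.
  by have [t t0 ->] := eigen_line uK x0 x'0 Mx Mx'; rewrite eigen_pointZ.
rewrite -(size_map ev) -ltnS -(size_char_poly M^T).
apply: max_poly_roots; first exact/monic_neq0/char_poly_monic.
  apply/allP => _ /mapP[X Xs ->]; rewrite -eigenvalue_root_char.
  have [x0 Mx _] := fP X Xs; apply/eigenvalueP; exists (f X).1^T; last by rewrite trmx_eq0.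
  by rewrite -trmx_mul Mx linearZ.
by rewrite map_inj_in_uniq.
Qed.

End Eigenvectors.

(** In the orthonormal bases given by [P] and [S], take [u] with singular values 1, ..., m + 1. Then
    [eigen_mx] is conjugate to the diagonal matrix of their squares, and for the all-ones covector
    the Krylov matrix is, up to an invertible factor, a Vandermonde matrix with distinct nodes. *)
Lemma cyclic_point (K : numFieldType) m n (A P : 'M[K]_m.+1) (B : 'M[K]_n) (S : 'M[K]_(m.+1, n)) :
  P *m A *m P^T = 1%:M -> S *m B *m S^T = 1%:M ->
  exists e u, krylov e (eigen_mx A B u) \in unitmx.
Proof.
move=> PA SB; pose d : 'rV[K]_m.+1 := \row_j ((j.+1)%:R ^+ 2).
pose D : 'M[K]_m.+1 := diag_mx (\row_j (j.+1)%:R).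
have DD : D *m D = diag_mx d.
  rewrite mul_mx_diag; apply/matrixP => i j; rewrite !mxE.
  by case: eqP => [->|_]; rewrite ?mulr1n // !mulr0n mul0r.
have [_ uT] := mulmx1_unit PA; have uP : P \in unitmx by rewrite -unitmx_tr.
have AE : A = invmx P *m invmx P^T.
  apply: (can_inj (mulKmx uP)); apply: (can_inj (mulmxK uT)).
  by rewrite /= PA mulKVmx // mulVmx.
pose u := P^T *m D *m S; pose e : 'rV_m.+1 := const_mx 1 *m invmx P^T.
have ME : eigen_mx A B u = P^T *m diag_mx d *m invmx P^T.
  rewrite /eigen_mx /u !trmx_mul trmxK tr_diag_mx AE -DD -!mulmxA; congr (_ *m (_ *m _)).
  by rewrite !mulmxA SB mul1mx -(mulmxA D) mulmxV // mulmx1.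
have eM i : e *m (eigen_mx A B u) ^+ i = (\row_j d 0 j ^+ i) *m invmx P^T.
  elim: i => [|i IH].
    by rewrite expr0 mulmx1; congr (_ *m _); apply/rowP => j; rewrite !mxE expr0.
  rewrite exprSr -mulmxE mulmxA IH ME !mulmxA mulmxKV //; congr (_ *m _).
  by rewrite mul_mx_diag; apply/rowP => j; rewrite !mxE -exprSr.
exists e, u; have -> : krylov e (eigen_mx A B u) = Vandermonde m.+1 d *m invmx P^T.
  apply/row_matrixP => i; rewrite rowK row_mul eM; congr (_ *m _).
  by apply/rowP => j; rewrite !mxE.
rewrite unitmx_mul unitmx_inv uT andbT unitmxE det_Vandermonde unitfE.
apply/prodf_neq0 => i _; apply/prodf_neq0 => j ij; rewrite !mxE subr_eq0.
rewrite eqrXn2 ?ler0n // eqr_nat eqSS; apply: contraTneq ij => /val_inj ->.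
by rewrite ltnn.
Qed.


Section InnerGram.
Context {R : realType}.

Definition gram_col m (Q1 : inner_product 'cV[R]_m) : 'M[R]_m :=
  \matrix_(i, j) Q1 (delta_mx i 0) (delta_mx j 0).

Definition gram_row n (Q2 : inner_product 'rV[R]_n) : 'M[R]_n :=
  \matrix_(i, j) Q2 (delta_mx 0 i) (delta_mx 0 j).

Lemma gram_colE m (Q1 : inner_product 'cV[R]_m) x y :
  Q1 x y = (x^T *m gram_col Q1 *m y) 0 0.
Proof.
have ex (z : 'cV[R]_m) : z = \sum_i z i 0 *: delta_mx i 0.
  by rewrite {1}[z]matrix_sum_delta; apply: eq_bigr => i _; rewrite big_ord1.
rewrite {1}[x]ex inner_suml -mulmxA mxE; apply: eq_bigr => i _.
rewrite innerZ mxE inner_sym {1}[y]ex inner_suml [in RHS]mxE; congr (_ * _).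
by apply: eq_bigr => j _; rewrite innerZ inner_sym mxE mulrC.
Qed.

Lemma gram_rowE n (Q2 : inner_product 'rV[R]_n) x y :
  Q2 x y = (x *m gram_row Q2 *m y^T) 0 0.
Proof.
rewrite {1}[x]row_sum_delta inner_suml -mulmxA mxE; apply: eq_bigr => i _.
rewrite innerZ inner_sym {1}[y]row_sum_delta inner_suml [in RHS]mxE; congr (_ * _).
by apply: eq_bigr => j _; rewrite innerZ inner_sym !mxE mulrC.
Qed.

Lemma gram_col_sym m (Q1 : inner_product 'cV[R]_m) : (gram_col Q1)^T = gram_col Q1.
Proof. by apply/matrixP => i j; rewrite !mxE inner_sym. Qed.

Lemma gram_row_sym n (Q2 : inner_product 'rV[R]_n) : (gram_row Q2)^T = gram_row Q2.
Proof. by apply/matrixP => i j; rewrite !mxE inner_sym. Qed.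

Lemma gram_col_gt0 m (Q1 : inner_product 'cV[R]_m) (v : 'rV_m) :
  v != 0 -> 0 < (v *m gram_col Q1 *m v^T) 0 0.
Proof.
move=> v0; have vT : v^T != 0 by rewrite trmx_eq0.
by have := inner_gt0 Q1 vT; rewrite gram_colE trmxK.
Qed.

Lemma gram_row_gt0 n (Q2 : inner_product 'rV[R]_n) (v : 'rV_n) :
  v != 0 -> 0 < (v *m gram_row Q2 *m v^T) 0 0.
Proof. by move=> /(inner_gt0 Q2); rewrite gram_rowE. Qed.

Lemma frobenius_gmap m n (Q : inner_product 'M[R]_(m, n))
    (Q1 : inner_product 'cV[R]_m) (Q2 : inner_product 'rV[R]_n) :
  (forall (x1 y1 : 'cV[R]_m) (x2 y2 : 'rV[R]_n),
     Q (x1 *m x2) (y1 *m y2) = Q1 x1 y1 * Q2 x2 y2) ->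
  forall X, gmap (gram_mx Q) X = gram_col Q1 *m X *m gram_row Q2.
Proof.
move=> QE X; apply/matrixP => i j; rewrite -fr_delta -inner_gmap -(mul_delta_mx (0 : 'I_1) i j).
have {1}-> : X = \sum_k delta_mx k 0 *m row k X.
  apply/matrixP => k l; rewrite summxE (bigD1 k) //= colrowE !mxE !eqxx mul1r.
  by rewrite big1 ?addr0 // => k' k'k; rewrite colrowE !mxE eq_sym (negPf k'k) mul0r.
rewrite inner_suml -mulmxA [RHS]mxE; apply: eq_bigr => k _.
rewrite QE inner_sym [gram_col Q1 i k]mxE gram_rowE -row_mul trmx_delta -colE.
by rewrite [in LHS]mxE [in LHS]mxE.
Qed.

End InnerGram.

Lemma entries_exp (K : fieldType) T (P : (T -> K) -> Prop) p (F : T -> 'M[K]_p.+1) i :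
  fun_algebra P -> entries P F -> entries P (fun t => F t ^+ i).
Proof.
move=> PA PF; elim: i => [|i IH].
  by move=> k l; apply: fun_algebra_ext (entries_cst PA 1 k l) => t; rewrite expr0.
move=> k l; apply: fun_algebra_ext (entriesM PA PF IH k l) => t.
by rewrite exprS.
Qed.

Lemma generic_krylov (K : numFieldType) k m n (A P : 'M[K]_m.+1) (B : 'M[K]_n)
    (S : 'M[K]_(m.+1, n)) (F : 'rV[K]_k -> 'M[K]_(m.+1, n)) :
  P *m A *m P^T = 1%:M -> S *m B *m S^T = 1%:M ->
  entries polyfun F -> (forall u, exists a, F a = u) ->
  exists e, generically (fun a => krylov e (eigen_mx A B (F a)) \in unitmx).
Proof.
move=> PA SB pF sF; have [e [u]] := cyclic_point PA SB; have [b <-] := sF u => uK; exists e.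
have QA := @polyfun_algebra K k.
have pM : entries polyfun (fun a => eigen_mx A B (F a)).
  apply: (entriesM QA); last exact: (entries_cst QA).
  apply: (entriesM QA); last exact: entries_tr.
  by apply: (entriesM QA) => //; apply: (entries_cst QA).
have pK : entries polyfun (fun a => krylov e (eigen_mx A B (F a))).
  move=> i j; have := entriesM QA (entries_cst QA e) (entries_exp i QA pM).
  by move=> /(_ 0 j); apply: fun_algebra_ext => a; rewrite [RHS]mxE.
have := generically_polyfun (b := b) (fun_algebra_det QA pK).
rewrite -unitfE -unitmxE uK => /(_ isT); apply: generically_imp => a.
by rewrite -unitfE -unitmxE.
Qed.

Section FrobeniusDegree.
Context {R : realType} {m n : nat} (Q : inner_product 'M[R]_(m.+1, n.+1)).
Context (Q1 : inner_product 'cV[R]_m.+1) (Q2 : inner_product 'rV[R]_n.+1).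
Hypothesis QE : forall (x1 y1 : 'cV[R]_m.+1) (x2 y2 : 'rV[R]_n.+1),
  Q (x1 *m x2) (y1 *m y2) = Q1 x1 y1 * Q2 x2 y2.
Local Notation C := (R[i]%C).
Local Notation V := 'M[C]_(m.+1, n.+1).
Local Notation G := (gmap (gramC Q)).
Local Notation k := (m.+1 * n.+1)%N.
Local Notation A := (map_mx (real_complex R) (gram_col Q1)).
Local Notation B := (map_mx (real_complex R) (gram_row Q2)).
Implicit Types (u X : V).

Lemma frobenius_gmapC X : G X = A *m X *m B.
Proof.
have cE (Y : 'M[R]_(m.+1, n.+1)) : G (complexify Y) = A *m complexify Y *m B.
  by rewrite complexify_gmap (frobenius_gmap QE) /complexify !map_mxM.
rewrite [X]complex_split gmapD gmapZ !cE mulmxDr mulmxDl.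
by rewrite -scalemxAr -scalemxAl.
Qed.

Lemma gram_orthonormal r p (S : 'M[R]_p) : S^T = S ->
  (forall v : 'rV_p, v != 0 -> 0 < (v *m S *m v^T) 0 0) -> (r <= p)%N ->
  exists P : 'M[C]_(r, p), P *m map_mx (real_complex R) S *m P^T = 1%:M.
Proof.
move=> Ss Sp rp; have [P PS] := orthonormal_rows Ss Sp rp.
exists (map_mx (real_complex R) P).
by rewrite map_trmx -!map_mxM PS map_mx1.
Qed.

Lemma gram_unit p (S : 'M[R]_p) : S^T = S ->
  (forall v : 'rV_p, v != 0 -> 0 < (v *m S *m v^T) 0 0) ->
  map_mx (real_complex R) S \in unitmx.
Proof.
move=> Ss Sp; have [P PS] := orthonormal_rows Ss Sp (leqnn p).
have [_ uP] := mulmx1_unit PS; have [+ _] := mulmx1_unit PS.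
by rewrite unitmx_mul => /andP[_]; rewrite map_unitmx.
Qed.

(** The eigenvalue count bounds by the number of rows and needs data of full row rank, so with fewer
    columns than rows the transposed problem is counted. *)
Lemma generic_critical_bound : generically (fun a : 'rV[C]_k =>
  forall s : seq V, uniq s -> (forall X, X \in s -> critical_eq Q (vec_mx a) X) ->
  (size s <= minn m.+1 n.+1)%N).
Proof.
have [As Ap] := (gram_col_sym Q1, @gram_col_gt0 _ _ Q1).
have [Bs Bp] := (gram_row_sym Q2, @gram_row_gt0 _ _ Q2).
have [Au Bu] := (gram_unit As Ap, gram_unit Bs Bp).
have sC p (S : 'M[R]_p) : S^T = S -> (map_mx (real_complex R) S)^T = map_mx (real_complex R) S.
  by move=> Ss; rewrite map_trmx Ss.
have {}As := sC _ _ As; have {}Bs := sC _ _ Bs.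
have [mn|/ltnW nm] := leqP m.+1 n.+1.
  have [P PA] := gram_orthonormal (gram_col_sym Q1) Ap (leqnn _).
  have [S SB] := gram_orthonormal (gram_row_sym Q2) Bp mn.
  have [|e] := generic_krylov PA SB (entries_vec (@polyfun_id C k)).
    by move=> u; exists (mxvec u); rewrite mxvecK.
  move=> gK; apply: generically_imp (generically_and gK (generic_full_rank (gramC_unit Q))).
  move=> a [uK rk] s us sP; apply: (critical_count As Au Bu uK _ us) => [|X /sP[X0 mX [XW WX]]].
    by rewrite -frobenius_gmapC /row_free eqn_leq rank_leq_row; rewrite (minn_idPl mn) in rk.
  by rewrite frobenius_gmapC in XW WX.
have [P PA] := gram_orthonormal (gram_row_sym Q2) Bp (leqnn _).
have [S SB] := gram_orthonormal (gram_col_sym Q1) Ap nm.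
have [|e] := generic_krylov PA SB (entries_tr (entries_vec (@polyfun_id C k))).
  by move=> u; exists (mxvec u^T); rewrite mxvecK trmxK.
move=> gK; apply: generically_imp (generically_and gK (generic_full_rank (gramC_unit Q))).
have tG X : B *m X^T *m A = (G X)^T.
  by rewrite frobenius_gmapC !trmx_mul As Bs mulmxA.
move=> a [uK rk] s us sP; rewrite -(size_map trmx).
apply: (critical_count Bs Bu Au uK) => [||_ /mapP[X /sP[X0 mX [XW WX]] ->]].
- by rewrite tG /row_free mxrank_tr eqn_leq rank_leq_col; rewrite (minn_idPr nm) in rk.
- by rewrite map_inj_uniq //; apply: trmx_inj.
have uX : (vec_mx a)^T - X^T = (vec_mx a - X)^T by apply/matrixP => i j; rewrite !mxE.
rewrite uX tG trmx_eq0; split=> //.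
- by move=> i j i' j'; rewrite !mxE [X j' i * _]mulrC mX.
- by rewrite -trmx_mul WX trmx0.
- by rewrite -trmx_mul XW trmx0.
Qed.

Lemma EDdegree_frobenius_le d : is_EDdegree Q d -> (d <= minn m.+1 n.+1)%N.
Proof.
move=> [Z [cZ ZT ZP]].
have [a [[Za bd] rk]] := generically_ex (generically_and (generically_and
  (generically_notin_closed cZ ZT) generic_critical_bound) (generic_full_rank (gramC_unit Q))).
have := ZP (vec_mx (\row_p (a p)%:R)); rewrite vec_mxK => /(_ Za) /card_eq_seq[s [us <- sE]].
apply: bd => // X Xs; have : ED_fiber Q (vec_mx (\row_p (a p)%:R)) X by rewrite sE.
by rewrite (ED_fiber_critical rk) => -[x cx <-].
Qed.

End FrobeniusDegree.
End Frobenius.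

Theorem theorem4p1 (R : realType) (n1 n2 : nat)
    (Q : inner_product 'M[R]_(n1.+1, n2.+1)) :
  (forall u : 'M[R]_(n1.+1, n2.+1), generic_data Q u ->
     (`I_(minn n1 n2).+1 #<= real_critical Q u)%card) /\
  (forall QF : inner_product 'M[R]_(n1.+1, n2.+1), frobenius QF ->
     (EDdegree QF <= EDdegree Q)%N /\ EDdegree QF = (minn n1 n2).+1).
Proof.
split=> [u|QF [Q1 [Q2 QE]]]; first exact: RealCount.real_critical_card.
have dF := EDDegree.EDdegreeP QF; have d := EDDegree.EDdegreeP Q.
have eF : EDdegree QF = (minn n1 n2).+1.
  apply/eqP; rewrite eqn_leq -minnSS (Frobenius.EDdegree_frobenius_le QE dF).
  exact: EDDegree.EDdegree_ge dF.
by split=> //; rewrite eF -minnSS; apply: EDDegree.EDdegree_ge d.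
Qed.
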